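(* Let $d\ge1$, $k\ge0$ and $0\le l\le d-1$ be integers. For $0\le j\le d$ set \[ E_{j,k,d}(n)=\begin{cases}2^{-(k+2)n}(n+1)^{d-1}, & j=0,\\ 2^{-(k+1)n}(n+1)^{j-1}, & 1\le j\le d.\end{cases} \] Then there is a constant $C_{k,d,l}$, depending only on $k,d,l$, such that for every $n\in\mathbb N_0$ and every $\omega\in\mathcal X_l^k$ with $\mathrm d\omega\in\mathcal X_{l+1}^k$, \[ \|\omega-\mathcal I_n^l\omega\|_{H(\mathrm d,\Omega)}\le C_{k,d,l}\Big(E_{l,k,d}(n)\,\|\omega\|_{\mathcal X_l^k}+E_{l+1,k,d}(n)\,\|\mathrm d\omega\|_{\mathcal X_{l+1}^k}\Big). \]
   Context: $\Omega=(0,1)^d$, $[d]=\{1,\dots,d\}$, $\mathbb N_0=\{0,1,2,\dots\}$. For $I=\{i_1<\dots<i_l\}\subseteq[d]$ put $\mathrm dx_I=\mathrm dx_{i_1}\wedge\cdots\wedge\mathrm dx_{i_l}$. An $l$-form is $\omega=\sum_{|I|=l}u_I\,\mathrm dx_I$ with $I\subseteq[d]$, and $\|\omega\|_{L^2\Lambda^l(\Omega)}^2=\sum_{|I|=l}\|u_I\|_{L^2(\Omega)}^2$. The (weak) exterior derivative is $\mathrm d\omega=\sum_{|I|=l}\sum_{j\notin I}\partial_{x_j}u_I\,\mathrm dx_j\wedge\mathrm dx_I$, and $\|\omega\|_{H(\mathrm d,\Omega)}^2=\|\omega\|_{L^2\Lambda^l(\Omega)}^2+\|\mathrm d\omega\|_{L^2\Lambda^{l+1}(\Omega)}^2$.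 Mixed regularity. For $I\subseteq[d]$ let $r_s=k+1$ if $s\in I$ and $r_s=k+2$ if $s\notin I$, and $\boldsymbol r=(r_1,\dots,r_d)$. $\mathcal X_I^k$ is the space of $v\in L^2(\Omega)$ with weak derivatives $\partial_{x_1}^{q_1}\cdots\partial_{x_d}^{q_d}v\in L^2(\Omega)$ for all $\boldsymbol q\in\mathbb N_0^d$ with $\boldsymbol 0\le\boldsymbol q\le\boldsymbol r$ (componentwise), normed by $\|v\|_{\mathcal X_I^k}^2=\sum_{\boldsymbol 0\le\boldsymbol q\le\boldsymbol r}\|\partial_{x_1}^{q_1}\cdots\partial_{x_d}^{q_d}v\|_{L^2(\Omega)}^2$. $\mathcal X_l^k$ is the space of $l$-forms with $u_I\in\mathcal X_I^k$ for all $|I|=l$, with $\|\omega\|_{\mathcal X_l^k}^2=\sum_{|I|=l}\|u_I\|_{\mathcal X_I^k}^2$. One-dimensional interpolants. $\mathbb P_r(K)$ denotes polynomials of degree at most $r$ on the interval $K$, $\mathbb P_{-1}(K)=\{0\}$. $\mathcal T_m$ is the uniform partition of $(0,1)$ into $2^m$ cells; $S_m^{k+1}=\{v\in C^0([0,1]):v|_K\in\mathbb P_{k+1}(K)\ \forall K\in\mathcal T_m\}$, $Q_m^k=\{q\in L^2(0,1):q|_K\in\mathbb P_k(K)\ \forall K\in\mathcal T_m\}$. For $v\in H^1(0,1)$, $\Pi_m^0v\in S_m^{k+1}$ is the unique function that, on each $K\in\mathcal T_m$, agrees with $v$ at both endpoints of $K$ and satisfies $\int_K(\Pi_m^0v-v)w\,\mathrm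 dx=0$ for all $w\in\mathbb P_{k-1}(K)$. For $q\in L^2(0,1)$, $\Pi_m^1q$ is the $L^2(0,1)$-orthogonal projection of $q$ onto $Q_m^k$. Put $\Pi_{-1}^0=\Pi_{-1}^1=0$ and $\Delta_m^r=\Pi_m^r-\Pi_{m-1}^r$ for $r\in\{0,1\}$, $m\in\mathbb N_0$. $\Delta_{s,m}^r$ denotes $\Delta_m^r$ acting only in the variable $x_s$ (other variables are parameters); operators in different variables commute. Sparse interpolant. For $\boldsymbol m=(m_1,\dots,m_d)\in\mathbb N_0^d$ let $H_{\boldsymbol m}^I=\big(\prod_{i\in I}\Delta_{i,m_i}^1\big)\big(\prod_{j\notin I}\Delta_{j,m_j}^0\big)$. With $\mathcal M_n=\{\boldsymbol m\in\mathbb N_0^d: m_1+\dots+m_d\le n+d-1\}$, set $\mathcal I_n^Iu_I=\sum_{\boldsymbol m\in\mathcal M_n}H_{\boldsymbol m}^Iu_I$ and $\mathcal I_n^l\omega=\sum_{|I|=l}(\mathcal I_n^Iu_I)\,\mathrm dx_I$. *)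

(* Defs.v *)
From HB Require Import structures.
From mathcomp Require Import all_boot all_order all_algebra.
From mathcomp Require Import all_classical all_reals all_analysis.

Set Implicit Arguments.
Unset Strict Implicit.
Unset Printing Implicit Defensive.

Import Order.TTheory GRing.Theory Num.Theory.
Import numFieldNormedType.Exports.

Local Open Scope classical_set_scope.
Local Open Scope ring_scope.

(** * Lebesgue measure on R^d

    Points of R^d are row vectors ['rV[R]_d], for which the library provides the
    norm and the directional derivatives, but neither a sigma-algebra nor a
    measure. *)

Definition rV_display : Type -> measure_display.
Proof. exact. Qed.

Section MeasurableRV.
Context {R : realType} (d : nat).

Let coors (i : 'I_d) (x : 'rV[R]_d) : measurableTypeR R := x ord0 i.

Let rV_set0 : g_sigma_preimage coors set0.
Proof. exact: sigma_algebra0. Qed.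

Let rV_setC A : g_sigma_preimage coors A -> g_sigma_preimage coors (~` A).
Proof. exact: sigma_algebraC. Qed.

Let rV_bigcup (F : (set 'rV[R]_d)^nat) :
  (forall i, g_sigma_preimage coors (F i)) ->
  g_sigma_preimage coors (\bigcup_i (F i)).
Proof. exact: sigma_algebra_bigcup. Qed.

HB.instance Definition _ :=
  @isMeasurable.Build (rV_display R) 'rV[R]_d
    (g_sigma_preimage coors) rV_set0 rV_setC rV_bigcup.

Lemma measurable_coord (i : 'I_d) :
  measurable_fun [set: 'rV[R]_d]
    (fun x : 'rV[R]_d => x ord0 i : measurableTypeR R).
Proof.
move=> _ Y mY; rewrite setTI; apply: sub_sigma_algebra => /=.
rewrite -bigcup_seq/=; exists i => /=; first by rewrite mem_index_enum.
by exists Y => //; rewrite setTI.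
Qed.

Lemma measurable_fun_rVP d1 (T : measurableType d1) (f : T -> 'rV[R]_d) :
  (forall i, measurable_fun [set: T]
     (fun x => f x ord0 i : measurableTypeR R)) ->
  measurable_fun [set: T] f.
Proof.
move=> mf; apply: (@measurability _ _ _ _ setT f
  (\big[setU/set0]_(i < d) preimage_set_system setT (coors i) measurable)) => //.
move=> _ [A + <-]; rewrite -bigcup_seq/= => -[i _ [B mB <-]].
rewrite !setTI; have := mf i measurableT B mB.
by rewrite setTI.
Qed.

End MeasurableRV.

Section LebesgueRV.
Context {R : realType}.

Definition rV_cons (d : nat) (p : measurableTypeR R * 'rV[R]_d) : 'rV[R]_d.+1 :=
  \row_i (if unlift ord0 i is Some j then p.2 ord0 j else p.1).

Definition rV_uncons (d : nat) (x : 'rV[R]_d.+1) :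
    measurableTypeR R * 'rV[R]_d :=
  (x ord0 ord0, \row_j x ord0 (lift ord0 j)).

Lemma rV_unconsK d : cancel (@rV_uncons d) (@rV_cons d).
Proof.
move=> x; apply/rowP => i; rewrite !mxE.
by case: unliftP => [j ->|->]/=; rewrite ?mxE.
Qed.

Lemma rV_consK d : cancel (@rV_cons d) (@rV_uncons d).
Proof.
move=> [a y]; congr pair; first by rewrite mxE unlift_none.
by apply/rowP => i; rewrite !mxE liftK.
Qed.

Lemma measurable_rV_cons d : measurable_fun setT (@rV_cons d).
Proof.
apply: measurable_fun_rVP => i.
under eq_fun do rewrite mxE.
case: unliftP => [j _|_]; last exact: measurable_fst.
by apply: (measurableT_comp (measurable_coord j)); exact: measurable_snd.
Qed.

Lemma measurable_rV_uncons d : measurable_fun setT (@rV_uncons d).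
Proof.
apply/measurable_fun_pairP; split; first exact: measurable_coord.
apply: measurable_fun_rVP => i.
under eq_fun do rewrite /= mxE.
exact: measurable_coord.
Qed.

Section Step.
Context (d : nat) (mu : {sigma_finite_measure set 'rV[R]_d -> \bar R}).

Definition rV_lift_measure : set 'rV[R]_d.+1 -> \bar R :=
  pushforward (lebesgue_measure \x mu)%E (@rV_cons d).

Let lift0 : rV_lift_measure set0 = 0%E.
Proof. by rewrite /rV_lift_measure /pushforward preimage_set0 measure0. Qed.

Let lift_ge0 A : (0 <= rV_lift_measure A)%E.
Proof. by rewrite /rV_lift_measure /pushforward measure_ge0. Qed.

Let lift_sigma_additive : semi_sigma_additive rV_lift_measure.
Proof.
move=> F mF tF mUF; rewrite /rV_lift_measure /pushforward preimage_bigcup.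
have mcons A : measurable A -> measurable (@rV_cons d @^-1` A).
  by move=> mA; rewrite -[X in measurable X]setTI; exact: measurable_rV_cons.
apply: measure_semi_sigma_additive.
- by move=> n; exact: mcons.
- apply/trivIsetP => /= i j _ _ ij; rewrite -preimage_setI.
  by move/trivIsetP : tF => /(_ _ _ _ _ ij) ->//; rewrite preimage_set0.
- by rewrite -preimage_bigcup; exact: mcons.
Qed.

HB.instance Definition _ := isMeasure.Build _ _ _
  rV_lift_measure lift0 lift_ge0 lift_sigma_additive.

Let lift_sigma_finite : sigma_finite setT rV_lift_measure.
Proof.
have /sigma_finiteP[F [TF ndF Foo]] := sigma_finiteT (@lebesgue_measure R).
have /sigma_finiteP[G [TG ndG Goo]] := sigma_finiteT mu.
exists (fun n => @rV_uncons d @^-1` (F n `*` G n)).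
  rewrite -preimage_bigcup (_ : \bigcup_n _ = setT) ?preimage_setT//.
  rewrite -setXTT TF TG predeqE => -[x y]; split.
    by move=> [n _ []/= ? ?]; split; exists n.
  move=> [/= [n _ Fnx] [k _ Gky]]; exists (maxn n k) => //; split.
  - by move: x Fnx; exact/subsetPset/ndF/leq_maxl.
  - by move: y Gky; exact/subsetPset/ndG/leq_maxr.
move=> n; have [mF Fn_oo] := Foo n; have [mG Gn_oo] := Goo n; split.
  rewrite -[X in measurable X]setTI; apply: measurable_rV_uncons => //.
  exact: measurableX.
rewrite /rV_lift_measure /pushforward -comp_preimage.
rewrite (_ : _ \o _ = id) ?preimage_id; last first.
  by apply/funext => p /=; rewrite rV_consK.
by rewrite product_measure1E// lte_mul_pinfty// ge0_fin_numE.
Qed.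

HB.instance Definition _ := Measure_isSigmaFinite.Build _ _ _
  rV_lift_measure lift_sigma_finite.

End Step.

(** The [d]-fold product of the Lebesgue measure of [R]; on [R^0] it is the
    Dirac mass at the only point. *)
Fixpoint lebesgue_rV (d : nat) : {sigma_finite_measure set 'rV[R]_d -> \bar R} :=
  match d with
  | 0 => \d_(0 : 'rV[R]_0)
  | d'.+1 => rV_lift_measure (lebesgue_rV d')
  end.

End LebesgueRV.

(** * L^2 on the unit cube *)

Definition cube {R : realType} {d : nat} : set 'rV[R]_d :=
  [set x | forall i, 0 < x ord0 i < 1].

(** [u] is square integrable on the cube.  The library's measurable functions
    are the Borel ones; Lebesgue measurability is being almost everywhere equal
    to a Borel function. *)
Definition isL2 (R : realType) (d : nat) (u : 'rV[R]_d -> R) : Prop :=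
  exists g : 'rV[R]_d -> R,
    [/\ measurable_fun cube g,
        ae_eq (lebesgue_rV d) cube u g &
        (\int[lebesgue_rV d]_(x in cube) ((g x) ^+ 2)%:E < +oo)%E].

Definition sqnormL2 (R : realType) (d : nat) (u : 'rV[R]_d -> R) : R :=
  \int[lebesgue_rV d]_(x in cube) ((u x) ^+ 2).

(** * Weak derivatives *)

Definition partial (R : realType) (d : nat) (i : 'I_d) (f : 'rV[R]_d -> R) :
  'rV[R]_d -> R := fun x => 'D_(delta_mx ord0 i) f x.

Definition multi_partial (R : realType) (d : nat) (q : 'I_d -> nat)
    (f : 'rV[R]_d -> R) : 'rV[R]_d -> R :=
  foldr (fun i g => iter (q i) (partial i) g) f (enum 'I_d).

Definition smooth (R : realType) (d : nat) (f : 'rV[R]_d -> R) : Prop :=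
  forall s : seq 'I_d, let g := foldr (@partial R d) f s in
    continuous g /\ forall i x, derivable g x (delta_mx ord0 i).

Definition test_function (R : realType) (d : nat) (phi : 'rV[R]_d -> R) : Prop :=
  smooth phi /\
  exists K : set 'rV[R]_d,
    [/\ compact K, K `<=` cube & forall x, ~ K x -> phi x = 0].

(** [w] is the weak derivative of order [q] of [v], and lies in L^2. *)
Definition is_weak_partial (R : realType) (d : nat) (q : 'I_d -> nat)
    (v w : 'rV[R]_d -> R) : Prop :=
  isL2 w /\
  forall phi, test_function phi ->
    \int[lebesgue_rV d]_(x in cube) (v x * multi_partial q phi x) =
    (-1) ^+ (\sum_i q i)%N * \int[lebesgue_rV d]_(x in cube) (w x * phi x).

Definition weak_partial (R : realType) (d : nat) (q : 'I_d -> nat)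
    (v : 'rV[R]_d -> R) : 'rV[R]_d -> R :=
  xget (fun=> 0) [set w | is_weak_partial q v w].

(** * Differential forms and the exterior derivative *)

(** An [l]-form is given by its coefficients [u_I]; only those with [#|I| = l]
    matter. *)
Definition diff_form (R : realType) (d : nat) := {set 'I_d} -> 'rV[R]_d -> R.

Definition isL2_form (R : realType) (d l : nat) (w : diff_form R d) : Prop :=
  forall I : {set 'I_d}, #|I| = l -> isL2 (w I).

Definition sqnormL2_form (R : realType) (d l : nat) (w : diff_form R d) : R :=
  \sum_(I : {set 'I_d} | #|I| == l) sqnormL2 (w I).

(** dx_j ^ dx_I = wedge_sign j I * dx_(I + j) when j is not in I. *)
Definition wedge_sign (R : realType) (d : nat) (j : 'I_d) (I : {set 'I_d}) : R :=
  (-1) ^+ #|[set i in I | (i < j)%N]|.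

(** [dw] is the weak exterior derivative of the [l]-form [w], and lies in L^2:
    its coefficient on dx_J is the distribution
    sum_(j in J) wedge_sign j (J - j) * d_j (w (J - j)).  The terms of this sum
    are not required to lie in L^2 individually. *)
Definition is_weak_extd (R : realType) (d l : nat) (w dw : diff_form R d) : Prop :=
  isL2_form l.+1 dw /\
  forall (J : {set 'I_d}), #|J| = l.+1 ->
  forall phi, test_function phi ->
    \int[lebesgue_rV d]_(x in cube) (dw J x * phi x) =
    - \sum_(j in J) wedge_sign R j (J :\ j) *
        \int[lebesgue_rV d]_(x in cube) (w (J :\ j) x * partial j phi x).

Definition weak_extd (R : realType) (d l : nat) (w : diff_form R d) : diff_form R d :=
  xget (fun _ _ => 0) [set dw | is_weak_extd l w dw].

Definition in_Hd (R : realType) (d l : nat) (w : diff_form R d) : Prop :=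
  isL2_form l w /\ exists dw, is_weak_extd l w dw.

(** Meaningful for [w] satisfying [in_Hd l w]. *)
Definition norm_Hd (R : realType) (d l : nat) (w : diff_form R d) : R :=
  Num.sqrt (sqnormL2_form l w + sqnormL2_form l.+1 (weak_extd l w)).

(** * Mixed regularity *)

Definition reg_order (d k : nat) (I : {set 'I_d}) (s : 'I_d) : nat :=
  if s \in I then k.+1 else k.+2.

Definition in_X_coef (R : realType) (d k : nat) (I : {set 'I_d})
    (v : 'rV[R]_d -> R) : Prop :=
  isL2 v /\
  forall q : 'I_d -> nat, (forall s, (q s <= reg_order k I s)%N) ->
    exists w, is_weak_partial q v w.

(** The entries of an admissible [q] are at most [k.+2], hence [q] ranges over
    a finite type. *)
Definition sqnorm_X_coef (R : realType) (d k : nat) (I : {set 'I_d})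
    (v : 'rV[R]_d -> R) : R :=
  \sum_(q : {ffun 'I_d -> 'I_k.+3} | [forall s, (q s <= reg_order k I s)%N])
    sqnormL2 (weak_partial (fun s => q s : nat) v).

Definition in_X (R : realType) (d k l : nat) (w : diff_form R d) : Prop :=
  forall I : {set 'I_d}, #|I| = l -> in_X_coef k I (w I).

(** Meaningful for [w] satisfying [in_X k l w]. *)
Definition norm_X (R : realType) (d k l : nat) (w : diff_form R d) : R :=
  Num.sqrt (\sum_(I : {set 'I_d} | #|I| == l) sqnorm_X_coef k I (w I)).

(** * One-dimensional interpolants *)

Definition node (R : realType) (m i : nat) : R := i%:R / 2 ^+ m.

(** [{poly R}] elements of degree at most [r] are those of [size] at most
    [r.+1]. *)
Definition S_space (R : realType) (k m : nat) : set (R -> R) :=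
  [set v : R -> R | {within `[0, 1 : R], continuous v} /\
    forall i, (i < 2 ^ m)%N ->
      exists2 p : {poly R}, (size p <= k.+2)%N &
        {in `[node R m i, node R m i.+1], forall x, v x = p.[x]}].

(** Half-open cells fix one representative of each class on [0, 1). *)
Definition Q_space (R : realType) (k m : nat) : set (R -> R) :=
  [set v : R -> R | forall i, (i < 2 ^ m)%N ->
      exists2 p : {poly R}, (size p <= k.+1)%N &
        {in `[node R m i, node R m i.+1[, forall x, v x = p.[x]}].

(** As [v] stands for a class in H^1(0,1), its values at the nodes are those of
    its continuous representative [v']. *)
Definition is_Pi0 (R : realType) (k m : nat) (v p : R -> R) : Prop :=
  [/\ S_space k m p,
      exists v' : R -> R,
        [/\ {within `[0, 1 : R], continuous v'},
            ae_eq (@lebesgue_measure R) `]0, 1[%classic v v' &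
            forall i, (i <= 2 ^ m)%N -> p (node R m i) = v' (node R m i)] &
      forall i, (i < 2 ^ m)%N -> forall w : {poly R}, (size w <= k)%N ->
        \int[lebesgue_measure]_(x in `]node R m i, node R m i.+1[)
          ((p x - v x) * w.[x]) = 0].

Definition is_Pi1 (R : realType) (k m : nat) (v p : R -> R) : Prop :=
  Q_space k m p /\
  forall w, Q_space k m w ->
    \int[lebesgue_measure]_(x in `]0%R, 1%R[) ((p x - v x) * w x) = 0.

(** [Pi1d k true] is Pi^1 and [Pi1d k false] is Pi^0. *)
Definition Pi1d (R : realType) (k : nat) (r : bool) (m : nat) (v : R -> R) :
    R -> R :=
  xget (fun=> 0) [set p | if r then is_Pi1 k m v p else is_Pi0 k m v p].

Definition Delta1d (R : realType) (k : nat) (r : bool) (m : nat) (v : R -> R) :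
    R -> R :=
  fun t => Pi1d k r m v t - (if m is m'.+1 then Pi1d k r m' v t else 0).

(** * Sparse interpolant *)

Definition set_coord (R : realType) (d : nat) (x : 'rV[R]_d) (s : 'I_d) (t : R) :
  'rV[R]_d := \row_j (if j == s then t else x ord0 j).

(** The operator [T] acting in the variable [x_s], the other ones being
    parameters. *)
Definition in_var (R : realType) (d : nat) (s : 'I_d)
    (T : (R -> R) -> (R -> R)) (u : 'rV[R]_d -> R) : 'rV[R]_d -> R :=
  fun x => T (fun t => u (set_coord x s t)) (x ord0 s).

(** The product over the indices [s] in [J] of the commuting operators
    [Delta_{s,m_s}^r]. *)
Definition Delta_prod (R : realType) (d k : nat) (r : bool) (J : {set 'I_d})
    (m : 'I_d -> nat) (u : 'rV[R]_d -> R) : 'rV[R]_d -> R :=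
  foldr (fun s => in_var s (@Delta1d R k r (m s))) u (enum J).

Definition hier_surplus (R : realType) (d k : nat) (I : {set 'I_d})
    (m : 'I_d -> nat) (u : 'rV[R]_d -> R) : 'rV[R]_d -> R :=
  Delta_prod k true I m (Delta_prod k false (~: I) m u).

(** For [0 < d] the entries of a multi-index of sum at most [n + d - 1] are
    less than [n + d], hence [m] ranges over a finite type. *)
Definition sparse_interp_coef (R : realType) (d k n : nat) (I : {set 'I_d})
    (u : 'rV[R]_d -> R) : 'rV[R]_d -> R :=
  fun x => \sum_(m : {ffun 'I_d -> 'I_(n + d)} | (\sum_i m i <= n + d - 1)%N)
    hier_surplus k I (fun i => m i : nat) u x.

Definition sparse_interp (R : realType) (d k n : nat) (w : diff_form R d) : diff_form R d :=
  fun I => sparse_interp_coef k n I (w I).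

Definition E_rate (R : realType) (j k d n : nat) : R :=
  if j is j'.+1 then (2 ^+ (k.+1 * n))^-1 * n.+1%:R ^+ j'
  else (2 ^+ (k.+2 * n))^-1 * n.+1%:R ^+ d.-1.

(* Main.v *)
Require Import Defs.
From HB Require Import structures.
From mathcomp Require Import all_boot all_order all_algebra.
From mathcomp Require Import all_classical all_reals all_analysis.
From mathcomp Require Import measurable_realfun.
From mathcomp Require Import ring lra.

Set Implicit Arguments.
Unset Strict Implicit.
Unset Printing Implicit Defensive.

Import Order.TTheory GRing.Theory Num.Theory.
Import numFieldNormedType.Exports.

Local Open Scope classical_set_scope.
Local Open Scope ring_scope.

(** On a line in the variable x_s, the error of either interpolant is, cell by cell, a primitive
    vanishing at the nodes or an L^2 projection error, hence is O(2^(-a m)) times the derivative of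
    order a (a = k+1 in the variables of I, k+2 in the others); integrating over lines gives the
    same bound in d variables, and the increments Delta_(s,m) are O(2^(-a m)).  Peeling off one
    variable at a time, U - I_N U = (U - Pi_(s,N) U) + sum_(m <= N) Delta_(s,m) (U - I'_(N-m) U),
    where I' is the sparse interpolant in the remaining variables.  The |I| slow variables are peeled
    off first; if there is one, its geometric lag behind the fast variables absorbs all their
    powers of N, and only the number of slow variables contributes to the power of N.  Since
    d_j Pi^0 = Pi^1 d_j and operators in different variables commute, the interpolant commutes
    with d, and the bound for dw also controls the derivative of the error. *)

(** * Integrals of almost everywhere equal functions *)

(** The obstacle is that Pi^0 uses point values and is not defined on L^2, while all derivatives are
    weak. It is therefore rewritten with two operators bounded on L^2, one applied to the function
    and one to its derivative in the same variable: a constant of integration, plus the primitive of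
    the L^2 projection of the derivative. For this reason a function travels together with all its
    mixed weak derivatives, and an operator in one variable uses up the derivatives in that
    variable. Operators in one variable are known through their transposes on tensor products of
    bounded measurable functions; linearity, commutation and compatibility with weak derivatives
    become identities between integrals. The coefficients of the forms are only almost everywhere
    equal to Borel functions, and the interpolants of the statement are chosen by [xget] line by
    line, so every identity holds almost everywhere, and Fubini carries null sets to lines. Smooth
    functions of d variables occur at the two ends only: products of one-variable functions exploit
    the hypotheses, and arbitrary ones test the exterior derivative of the error. *)

Section AlmostEverywhere.
Context d (T : measurableType d) (R : realType).
Implicit Type mu : {measure set T -> \bar R}.

Section NonMeasurable.
Import HBNNSimple.

(** The integral of a nonnegative function is a supremum over the simple functions below it, whether
    or not it is measurable. A simple function below f, set to 0 on the null set, lies below g and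
    keeps its integral. This gives access to coefficients that are merely equal to a Borel function
    almost everywhere. *)
Lemma le_ge0_integral_off_null mu (N : set T) (f g : T -> \bar R) :
  measurable N -> mu N = 0%E -> (forall x, 0 <= f x)%E -> (forall x, 0 <= g x)%E ->
  (forall x, ~ N x -> f x = g x) ->
  (\int[mu]_x f x <= \int[mu]_x g x)%E.
Proof.
move=> mN N0 f0 g0 fg.
rewrite ge0_integralTE// ge0_integralTE//.
apply: ge_ereal_sup => _ [h /= hf <-].
have [p pE] : exists p : {nnsfun T >-> R}, forall x, p x = (h \_ (~` N)) x.
  exists (proj_nnsfun h (measurableC mN)) => x.
  by rewrite -(mrestrict h (measurableC mN)).
have sE (k : {nnsfun T >-> R}) : sintegral mu k = (\int[mu]_x (k x)%:E)%E.
  by rewrite integral_nnsfun// patch_setT.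
have -> : sintegral mu h = sintegral mu p.
  rewrite !sE; apply: ge0_ae_eq_integral => //.
  - exact/measurable_EFinP.
  - exact/measurable_EFinP.
  - by move=> x _; rewrite lee_fin; exact: fun_ge0.
  - by move=> x _; rewrite lee_fin; exact: fun_ge0.
  - exists N; split => // x /= /not_implyP[_].
    rewrite pE patchE; case: ifPn => //.
    by rewrite notin_setE /= => /contrapT.
apply: ereal_sup_ubound => /=; exists p => //= x.
rewrite pE patchE; case: ifPn => [|_]; last exact: g0.
by rewrite inE => /= /fg <-.
Qed.

End NonMeasurable.

Lemma ae_eq_integral_nonmeas mu (D : set T) (f g : T -> \bar R) :
  ae_eq mu D f g -> (\int[mu]_(x in D) f x = \int[mu]_(x in D) g x)%E.
Proof.
move=> [N [mN N0 fgN]].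
have fg x : ~ N x -> (f \_ D) x = (g \_ D) x.
  move=> Nx; rewrite !patchE; case: ifPn => //; rewrite inE => Dx.
  by apply: contrapT => h; apply/Nx/fgN => /= /(_ Dx).
rewrite integral_mkcond [RHS]integral_mkcond integralE [RHS]integralE.
congr (_ - _)%E; apply/eqP; rewrite eq_le; apply/andP; split;
  apply: (le_ge0_integral_off_null mN N0) => // x /fg.
- by rewrite !funeposE => ->.
- by rewrite !funeposE => ->.
- by rewrite !funenegE => ->.
- by rewrite !funenegE => ->.
Qed.

Lemma ae_eq_Rintegral mu (D : set T) (f g : T -> R) :
  ae_eq mu D f g -> \int[mu]_(x in D) f x = \int[mu]_(x in D) g x.
Proof.
move=> fg; congr fine; apply: ae_eq_integral_nonmeas.
by apply: filterS fg => x /[apply] ->.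
Qed.

Lemma ae_eqT mu (f g : T -> R) : (\forall x \ae mu, f x = g x) -> ae_eq mu setT f g.
Proof. by apply: filterS. Qed.

Context mu (D : set T) (mD : measurable D).

Lemma negligible_mrestr (N : set T) :
  (mrestr mu mD).-negligible N <-> mu.-negligible (N `&` D).
Proof.
split=> [[A [mA A0 NA]]|[A [mA A0 NA]]].
  by exists (A `&` D); split; [exact: measurableI|exact: A0|exact: setSI].
exists (A `|` ~` D); split; first by apply: measurableU => //; exact: measurableC.
  rewrite /mrestr setIUl [X in _ `|` X]setICl setU0; apply/eqP.
  by rewrite -measure_le0 -A0; apply: le_measure; rewrite ?inE//; exact: measurableI.
move=> x Nx; have [Dx|Dx] := pselect (D x); [left; exact: NA|by right].
Qed.

Lemma ae_mrestr (Q : T -> Prop) :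
  {ae mrestr mu mD, forall x, Q x} <-> {ae mu, forall x, D x -> Q x}.
Proof.
rewrite /almost_everywhere /= /prop_near1 /= /nbhs /=.
split=> [/negligible_mrestr|h]; last apply/negligible_mrestr.
  by apply: negligibleS => x /= /not_implyP[].
by apply: negligibleS h => x /= [nQ Dx] /(_ Dx).
Qed.

Lemma integral_mrestr (f : T -> \bar R) :
  (\int[mrestr mu mD]_x f x = \int[mu]_(x in D) f x)%E.
Proof.
rewrite -(@eq_measure_integral _ _ _ D mu (mrestr mu mD)); last first.
  by move=> A mA AD; rewrite /= /mrestr setIidl.
rewrite [RHS]integral_mkcond; apply: (@ae_eq_integral_nonmeas (mrestr mu mD)).
apply/ae_mrestr; apply: aeW => x Dx _.
by rewrite patchE mem_set.
Qed.

Lemma Rintegral_mrestr (f : T -> R) :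
  \int[mrestr mu mD]_x f x = \int[mu]_(x in D) f x.
Proof. by rewrite /Rintegral integral_mrestr. Qed.

End AlmostEverywhere.

(** * Square-integrable functions on a probability space *)

Section SquareIntegrable.
Context d (T : measurableType d) (R : realType) (P : probability T R).
Implicit Types f g : T -> R.

Definition rintegrable f := P.-integrable setT (EFin \o f).
Definition sqintegrable f := measurable_fun setT f /\ rintegrable (fun x => f x ^+ 2).
Definition nrm f : R := Num.sqrt (\int[P]_x (f x ^+ 2)).

Lemma rintegrable_meas f : rintegrable f -> measurable_fun setT f.
Proof. by case/integrableP => /measurable_EFinP. Qed.

Lemma rintegrable_dom f g : measurable_fun setT f -> rintegrable g ->
  (forall x, `|f x| <= g x) -> rintegrable f.
Proof.
move=> mf ig fg; apply: le_integrable ig => //; first exact/measurable_EFinP.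
by move=> x _ /=; rewrite lee_fin (le_trans (fg x))// ler_norm.
Qed.

Lemma rintegrableD f g : rintegrable f -> rintegrable g ->
  rintegrable (fun x => f x + g x).
Proof. move=> fi gi; exact: (integrableD _ fi gi). Qed.

Lemma rintegrableZ k f : rintegrable f -> rintegrable (fun x => k * f x).
Proof. move=> fi; exact: (integrableZl _ k fi). Qed.

Lemma rintegrableN f : rintegrable f -> rintegrable (fun x => - f x).
Proof. move=> fi; exact: (integrableN fi). Qed.

Lemma rintegrableB f g : rintegrable f -> rintegrable g ->
  rintegrable (fun x => f x - g x).
Proof. move=> fi gi; exact: (integrableB _ fi gi). Qed.

Lemma rintegrable_cst (k : R) : rintegrable (fun=> k).
Proof. exact: finite_measure_integrable_cst. Qed.

Lemma rintegrable0 : rintegrable (fun=> 0).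
Proof. exact: rintegrable_cst. Qed.

Lemma rintegrable_sum I (s : seq I) (Q : pred I) (F : I -> T -> R) :
  (forall i, Q i -> rintegrable (F i)) -> rintegrable (fun x => \sum_(i <- s | Q i) F i x).
Proof.
move=> FP; elim: s => [|i s IH].
  by under [X in rintegrable X]eq_fun do rewrite big_nil; exact: rintegrable0.
under [X in rintegrable X]eq_fun do rewrite big_cons.
by case: (boolP (Q i)) => // /FP Fi; apply: rintegrableD.
Qed.

Lemma rintegrable_norm f : rintegrable f -> rintegrable (fun x => `|f x|).
Proof. exact: integrable_norm. Qed.

Lemma rintegrable_bounded f M : measurable_fun setT f -> (forall x, `|f x| <= M) ->
  rintegrable f.
Proof. by move=> mf fM; apply: rintegrable_dom (rintegrable_cst M) _. Qed.

Lemma RintegralDT f g : rintegrable f -> rintegrable g ->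
  \int[P]_x (f x + g x) = \int[P]_x f x + \int[P]_x g x.
Proof. exact: RintegralD. Qed.

Lemma RintegralBT f g : rintegrable f -> rintegrable g ->
  \int[P]_x (f x - g x) = \int[P]_x f x - \int[P]_x g x.
Proof. exact: RintegralB. Qed.

Lemma RintegralZT k f : rintegrable f -> \int[P]_x (k * f x) = k * \int[P]_x f x.
Proof. exact: RintegralZl. Qed.

Lemma Rintegral_cstT (k : R) : \int[P]_x k = k.
Proof. by rewrite Rintegral_cst//= probability_setT mulr1. Qed.

Lemma Rintegral0T : \int[P]_x (0 : R) = 0.
Proof. exact: Rintegral_cstT. Qed.

Lemma RintegralNT f : rintegrable f -> \int[P]_x (- f x) = - \int[P]_x f x.
Proof.
by move=> fi; rewrite -mulN1r -RintegralZT//; under [RHS]eq_Rintegral do rewrite mulN1r.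
Qed.

Lemma Rintegral_sumT I (s : seq I) (Q : pred I) (F : I -> T -> R) :
  (forall i, Q i -> rintegrable (F i)) ->
  \int[P]_x (\sum_(i <- s | Q i) F i x) = \sum_(i <- s | Q i) \int[P]_x F i x.
Proof.
move=> FP; elim: s => [|i s IH].
  rewrite big_nil; under eq_Rintegral do rewrite big_nil; exact: Rintegral0T.
under eq_Rintegral do rewrite big_cons; rewrite big_cons.
case: (boolP (Q i)) => // Qi.
by rewrite RintegralDT ?IH//; [exact: FP|exact: rintegrable_sum].
Qed.

Lemma le_RintegralT f g : rintegrable f -> rintegrable g ->
  (forall x, f x <= g x) -> \int[P]_x f x <= \int[P]_x g x.
Proof. by move=> fi gi fg; apply: le_Rintegral. Qed.

Lemma ae_le_Rintegral f g : rintegrable f -> rintegrable g ->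
  {ae P, forall x, f x <= g x} -> \int[P]_x f x <= \int[P]_x g x.
Proof.
move=> fi gi fg.
have mf := rintegrable_meas fi; have mg := rintegrable_meas gi.
(* Replacing g by the maximum changes it on a null set only and makes the inequality hold
   everywhere. *)
pose h x := Num.max (f x) (g x).
have hi : rintegrable h.
  apply: (@rintegrable_dom _ (fun x => `|f x| + `|g x|)).
  - exact: measurable_maxr.
  - by apply: rintegrableD; exact: rintegrable_norm.
  - by move=> x; rewrite /h; case: (leP (f x) (g x)) => _; rewrite ?lerDl ?lerDr.
have -> : \int[P]_x g x = \int[P]_x h x.
  apply: ae_eq_Rintegral; apply: ae_eqT; apply: filterS fg => x fgx.
  by rewrite /h max_r.
by apply: le_RintegralT => // x; rewrite /h le_max lexx.
Qed.

Lemma sq_ge0_Rintegral f : 0 <= \int[P]_x (f x ^+ 2).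
Proof. by apply: Rintegral_ge0 => x _; exact: sqr_ge0. Qed.

Lemma nrm_ge0 f : 0 <= nrm f.
Proof. exact: sqrtr_ge0. Qed.

Lemma sqr_nrm f : nrm f ^+ 2 = \int[P]_x (f x ^+ 2).
Proof. by rewrite sqr_sqrtr// sq_ge0_Rintegral. Qed.

Lemma ae_eq_nrm f g : {ae P, forall x, f x = g x} -> nrm f = nrm g.
Proof.
move=> fg; congr Num.sqrt; apply: ae_eq_Rintegral; apply: ae_eqT.
by apply: filterS fg => x ->.
Qed.

Lemma sqintegrable_mul f g : sqintegrable f -> sqintegrable g ->
  rintegrable (fun x => f x * g x).
Proof.
move=> [mf fi] [mg gi].
apply: rintegrable_dom (rintegrableD fi gi) _; first exact: measurable_funM.
by move=> x; rewrite ler_norml; nra.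
Qed.

Lemma sqintegrable_bounded f M : measurable_fun setT f -> (forall x, `|f x| <= M) ->
  sqintegrable f.
Proof.
move=> mf fM; split => //; apply: (@rintegrable_bounded _ (M ^+ 2)).
  exact: measurable_funX.
by move=> x; rewrite normrX lerXn2r// nnegrE (le_trans _ (fM x)).
Qed.

Lemma sqintegrable_cst (k : R) : sqintegrable (fun=> k).
Proof. exact: (@sqintegrable_bounded _ `|k|). Qed.

Lemma sqintegrable_int f : sqintegrable f -> rintegrable f.
Proof.
move=> fi; have := sqintegrable_mul fi (sqintegrable_cst 1).
by under [X in rintegrable X]eq_fun do rewrite mulr1.
Qed.

Lemma sqintegrable_dom f g : measurable_fun setT f -> sqintegrable g ->
  (forall x, `|f x| <= `|g x|) -> sqintegrable f.
Proof.
move=> mf [mg gi] fg; split => //; apply: rintegrable_dom gi _.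
  exact: measurable_funX.
by move=> x; rewrite normrX -[leRHS]real_normK ?num_real// lerXn2r// ?nnegrE.
Qed.

Lemma sqintegrableZ k f : sqintegrable f -> sqintegrable (fun x => k * f x).
Proof.
move=> [mf fi]; split; first exact: measurable_funM.
under [X in rintegrable X]eq_fun do rewrite exprMn.
exact: rintegrableZ.
Qed.

Lemma sqintegrableD f g : sqintegrable f -> sqintegrable g ->
  sqintegrable (fun x => f x + g x).
Proof.
move=> fi gi; have [[mf fi2] [mg gi2]] := (fi, gi).
split; first exact: measurable_funD.
under [X in rintegrable X]eq_fun do rewrite sqrrD -mulr_natl.
by do 2?apply: rintegrableD => //; apply: rintegrableZ; exact: sqintegrable_mul.
Qed.

Lemma sqintegrableN f : sqintegrable f -> sqintegrable (fun x => - f x).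
Proof.
move/(sqintegrableZ (-1)).
by under [X in sqintegrable X]eq_fun do rewrite mulN1r.
Qed.

Lemma sqintegrableB f g : sqintegrable f -> sqintegrable g ->
  sqintegrable (fun x => f x - g x).
Proof. by move=> fi /sqintegrableN; exact: sqintegrableD. Qed.

Lemma sqintegrable_sum I (s : seq I) (Q : pred I) (F : I -> T -> R) :
  (forall i, Q i -> sqintegrable (F i)) -> sqintegrable (fun x => \sum_(i <- s | Q i) F i x).
Proof.
move=> FP; elim: s => [|i s IH].
  by under [X in sqintegrable X]eq_fun do rewrite big_nil; exact: sqintegrable_cst.
under [X in sqintegrable X]eq_fun do rewrite big_cons.
by case: (boolP (Q i)) => // /FP Fi; apply: sqintegrableD.
Qed.

Lemma sqintegrableM_bounded f g (M : R) : sqintegrable f -> measurable_fun setT g ->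
  (forall x, `|g x| <= M) -> sqintegrable (fun x => g x * f x).
Proof.
move=> [mf fi] mg gM; have := sqintegrableZ M (conj mf fi).
move/sqintegrable_dom; apply; first exact: measurable_funM.
by move=> x; rewrite !normrM ler_wpM2r// (le_trans (gM x)) ?ler_norm.
Qed.

Lemma Rintegral_sqr_comb (s t : R) f g : sqintegrable f -> sqintegrable g ->
  \int[P]_x ((s * f x + t * g x) ^+ 2) =
  s ^+ 2 * \int[P]_x (f x ^+ 2) + s * t * 2 * \int[P]_x (f x * g x) +
  t ^+ 2 * \int[P]_x (g x ^+ 2).
Proof.
move=> fi gi; have fg := sqintegrable_mul fi gi.
rewrite -!RintegralZT// -?RintegralDT; last first.
- by case: fi.
- by case: gi.
- exact: rintegrableZ.
- by apply: rintegrableZ; case: fi.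
- by apply: rintegrableZ; case: gi.
- by apply: rintegrableD; apply: rintegrableZ => //; case: fi.
- by apply: eq_Rintegral => x _; ring.
Qed.

Lemma sqr_Rintegral_mul_le f g : sqintegrable f -> sqintegrable g ->
  (\int[P]_x (f x * g x)) ^+ 2 <= (\int[P]_x (f x ^+ 2)) * (\int[P]_x (g x ^+ 2)).
Proof.
move=> fi gi; set a := \int[P]_x (f x ^+ 2); set b := \int[P]_x (g x ^+ 2).
set c := \int[P]_x (f x * g x).
have E s t : 0 <= s ^+ 2 * a + s * t * 2 * c + t ^+ 2 * b.
  rewrite -Rintegral_sqr_comb//; exact: sq_ge0_Rintegral.
have a0 : 0 <= a := sq_ge0_Rintegral f.
have b0 : 0 <= b := sq_ge0_Rintegral g.
(* Discriminant argument: at (b, -c) the quadratic form equals b (a b - c^2), and at (-c, a) it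
   equals a (a b - c^2). If a = b = 0, the values at (1, 1) and (1, -1) give c = 0. *)
have [b00|bn0] := eqVneq b 0; last first.
  have {b0 bn0} b0 : 0 < b by rewrite lt_def bn0.
  rewrite -subr_ge0 -(pmulr_rge0 _ b0); apply: le_trans (E b (- c)) _.
  by rewrite le_eqVlt; apply/orP; left; apply/eqP; ring.
have [a00|an0] := eqVneq a 0; last first.
  have {a0 an0} a0 : 0 < a by rewrite lt_def an0.
  rewrite -subr_ge0 -(pmulr_rge0 _ a0); apply: le_trans (E (- c) a) _.
  by rewrite le_eqVlt; apply/orP; left; apply/eqP; ring.
by have := E 1 1; have := E 1 (-1); rewrite a00 b00; nra.
Qed.

Lemma sqr_Rintegral_le f : sqintegrable f ->
  (\int[P]_x f x) ^+ 2 <= \int[P]_x (f x ^+ 2).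
Proof.
move=> fi; have := sqr_Rintegral_mul_le fi (sqintegrable_cst 1).
under eq_Rintegral do rewrite mulr1.
by rewrite Rintegral_cstT expr1n mulr1.
Qed.

Lemma nrmD f g : sqintegrable f -> sqintegrable g ->
  nrm (fun x => f x + g x) <= nrm f + nrm g.
Proof.
move=> fi gi; rewrite -(ler_pXn2r (ltn0Sn 1)) ?nnegrE ?addr_ge0 ?nrm_ge0//.
have := sqr_Rintegral_mul_le fi gi; rewrite -!sqr_nrm -exprMn => CS.
rewrite [leLHS]sqr_nrm sqrrD !sqr_nrm.
have := Rintegral_sqr_comb 1 1 fi gi; under eq_Rintegral do rewrite !mul1r.
move=> ->; rewrite expr1n !mul1r.
rewrite lerD2r lerD2l -[leRHS]mulr_natl ler_pM2l ?ltr0n//.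
have : `|\int[P]_x (f x * g x)| <= `|nrm f * nrm g|.
  by rewrite -(ler_pXn2r (ltn0Sn 1)) ?nnegrE// !real_normK ?num_real.
rewrite [leRHS]ger0_norm ?mulr_ge0 ?nrm_ge0//.
by apply: le_trans; exact: ler_norm.
Qed.

Lemma nrmZ k f : sqintegrable f -> nrm (fun x => k * f x) = `|k| * nrm f.
Proof.
move=> [mf fi]; rewrite /nrm; under eq_Rintegral do rewrite exprMn.
by rewrite RintegralZT// sqrtrM ?sqr_ge0// sqrtr_sqr.
Qed.

Lemma nrmN f : nrm (fun x => - f x) = nrm f.
Proof. by rewrite /nrm; under eq_Rintegral do rewrite sqrrN. Qed.

Lemma nrmB f g : sqintegrable f -> sqintegrable g ->
  nrm (fun x => f x - g x) <= nrm f + nrm g.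
Proof. by move=> fi gi; rewrite -[nrm g]nrmN; apply: nrmD => //; exact: sqintegrableN. Qed.

Lemma nrm0 : nrm (fun=> 0) = 0.
Proof. by rewrite /nrm expr0n /= Rintegral_cstT sqrtr0. Qed.

Lemma nrm_sum I (s : seq I) (Q : pred I) (F : I -> T -> R) :
  (forall i, Q i -> sqintegrable (F i)) ->
  nrm (fun x => \sum_(i <- s | Q i) F i x) <= \sum_(i <- s | Q i) nrm (F i).
Proof.
move=> FP; elim: s => [|i s IH].
  by under [X in nrm X]eq_fun do rewrite big_nil; rewrite big_nil nrm0.
under [X in nrm X]eq_fun do rewrite big_cons; rewrite big_cons.
case: (boolP (Q i)) => // Qi; apply: le_trans (nrmD (FP _ Qi) _) _.
  exact: sqintegrable_sum.
by rewrite lerD2l.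
Qed.

Lemma nrm_le_sqr f g : \int[P]_x (f x ^+ 2) <= \int[P]_x (g x ^+ 2) -> nrm f <= nrm g.
Proof. by move=> fg; rewrite ler_wsqrtr. Qed.

End SquareIntegrable.

(** The measurable sets over which f integrates to 0 form a Dynkin system, closed under complement
    because the total integral is 0. It contains the pi-system G, hence every measurable set. It is
    applied to half-lines and to boxes. *)
Lemma ae_eq0_pi_system d (T : measurableType d) (R : realType)
    (P : probability T R) (G : set (set T)) (f : T -> R) :
  measurable = <<s G >> -> setI_closed G -> rintegrable P f ->
  \int[P]_x f x = 0 -> (forall A, G A -> \int[P]_(x in A) f x = 0) ->
  {ae P, forall x, f x = 0}.
Proof.
move=> mG GI fi f0 fG.
have mGm A : <<s G >> A -> measurable A by rewrite mG.
have fiA A : measurable A -> P.-integrable A (EFin \o f).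
  by move=> mA; apply: integrableS fi.
have finA A : measurable A -> (\int[P]_(x in A) (f x)%:E)%E \is a fin_num.
  by move=> mA; apply: integrable_fin_num => //; exact: fiA.
pose H := [set A | measurable A /\ (\int[P]_(x in A) (f x)%:E = 0)%E].
have HE A : measurable A -> \int[P]_(x in A) f x = 0 ->
    (\int[P]_(x in A) (f x)%:E = 0)%E.
  by move=> mA A0; rewrite -[LHS]fineK ?finA// -[fine _]/(Rintegral P A f) A0.
have dH : dynkin H.
  split.
  - by split => //; apply: HE.
  - move=> A [mA A0]; split; first exact: measurableC.
    have := @integral_setU_EFin _ _ _ P A (~` A) f mA (measurableC mA).
    rewrite setUv A0 add0e => <-; last 2 first.
    + by case/integrableP : fi => /measurable_EFinP.
    + by apply/disj_setPS; rewrite setICr.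
    by apply: HE.
  - move=> F tF HF; split; first by apply: bigcupT_measurable => k; have [] := HF k.
    rewrite integral_bigcup//.
    + by apply: eseries0 => k _ _; have [] := HF k.
    + by move=> k; have [] := HF k.
    + apply: fiA; apply: bigcupT_measurable => k; have [] := HF k => //.
have GH : G `<=` H.
  move=> A GA; have mA : measurable A by rewrite mG; exact: sub_sigma_algebra.
  by split => //; apply: HE => //; exact: fG.
have sub : <<s G >> `<=` H.
  by apply: lambda_system_subset => //; exact/dynkin_lambda_system.
have := @integral_ae_eq _ _ _ P setT measurableT (cst 0%E) (EFin \o f) fi.
move=> /(_ (measurable_cst _)) h.
have {h} : ae_eq P setT (EFin \o f) (cst 0%E).
  apply: h => E _ mE; rewrite integral0.
  by have [] : H E by apply: sub; rewrite -mG.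
by apply: filterS => x /(_ Logic.I) [].
Qed.

(** * Fubini's theorem for products of probability measures *)

Section Fubini.
Context d1 d2 (T1 : measurableType d1) (T2 : measurableType d2) (R : realType).
Variables (P1 : probability T1 R) (P2 : probability T2 R).

Lemma ae_rintegrable_section (f : T1 * T2 -> R) : rintegrable (P1 \x P2)%E f ->
  {ae P1, forall x, rintegrable P2 (fun y => f (x, y))}.
Proof. by move=> /ae_integrable1. Qed.

Lemma fubini_EFin (f : T1 * T2 -> R) : rintegrable (P1 \x P2)%E f ->
  {ae P1, forall x, (\int[P2]_y (f (x, y))%:E)%E = (\int[P2]_y f (x, y))%:E}.
Proof.
move=> /ae_rintegrable_section; apply: filterS => x fi.
by rewrite fineK//; apply: integrable_fin_num.
Qed.

Lemma measurable_Rfubini (f : T1 * T2 -> R) : rintegrable (P1 \x P2)%E f ->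
  measurable_fun setT (fun x => \int[P2]_y f (x, y)).
Proof.
move=> fi; have := measurable_fubini_F fi => mF.
exact: (measurableT_comp _ mF).
Qed.

Lemma rintegrable_fubini (f : T1 * T2 -> R) : rintegrable (P1 \x P2)%E f ->
  rintegrable P1 (fun x => \int[P2]_y f (x, y)).
Proof.
move=> fi; have Fi := integrable_fubini_F fi.
have := fubini_EFin fi => h.
apply/integrableP; split; first exact/measurable_EFinP/measurable_Rfubini.
have /integrableP[_] := Fi; apply: le_lt_trans.
rewrite le_eqVlt; apply/orP; left; apply/eqP.
apply: ae_eq_integral_nonmeas; apply: filterS h => x h _ /=.
by rewrite /fubini_F /= h.
Qed.

Lemma Rfubini (f : T1 * T2 -> R) : rintegrable (P1 \x P2)%E f ->
  \int[(P1 \x P2)%E]_z f z = \int[P1]_x \int[P2]_y f (x, y).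
Proof.
move=> fi; rewrite /Rintegral -integral12_prod_meas1//; congr fine.
apply: ae_eq_integral_nonmeas; apply: filterS (fubini_EFin fi) => x h _ /=.
by rewrite /fubini_F /= h.
Qed.

Lemma Rfubini_swap (f : T1 * T2 -> R) : rintegrable (P1 \x P2)%E f ->
  \int[P1]_x \int[P2]_y f (x, y) = \int[P2]_y \int[P1]_x f (x, y).
Proof.
move=> fi; rewrite -Rfubini// /Rintegral -integral21_prod_meas1//; congr fine.
apply: ae_eq_integral_nonmeas; apply: filterS (ae_integrable2 fi) => y h _ /=.
by rewrite /fubini_G /= fineK//; apply: integrable_fin_num.
Qed.

Lemma ae_ae_section (Q : T1 * T2 -> Prop) : {ae (P1 \x P2)%E, forall z, Q z} ->
  {ae P1, forall x, {ae P2, forall y, Q (x, y)}}.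
Proof.
move=> [N [mN N0 QN]].
have : (\int[P1]_x P2 (xsection N x))%E = 0%E by exact: N0.
move=> h.
have : ae_eq P1 setT (fun x => P2 (xsection N x)) (cst 0%E).
  apply/ae_eq_integral_abs => //; first exact: measurable_fun_xsection.
  by rewrite -[RHS]h; apply: eq_integral => x _; rewrite gee0_abs.
apply: filterS => x /(_ Logic.I) /= Nx.
exists (xsection N x); split => //; first exact: measurable_xsection.
by move=> y /= /QN; rewrite /xsection /= inE.
Qed.

End Fubini.

(** * The cube and its lines *)

Section Cube.
Context {R : realType}.
Local Notation leb := (@lebesgue_measure R).

(** Lebesgue measure of the unit interval, kept on the whole line so that functions on R need no
    restriction. Being a probability, it makes bounded measurable functions integrable and
    introduces no constant in Cauchy-Schwarz. *)
Definition lam : set (measurableTypeR R) -> \bar R :=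
  mrestr leb (measurable_itv `]0, 1[).

HB.instance Definition _ := Measure.on lam.

Lemma lam_setT : lam setT = 1%E.
Proof. by rewrite /lam /mrestr setTI lebesgue_measure_itv/= lte01 sube0. Qed.

HB.instance Definition _ := Measure_isProbability.Build _ _ _ lam lam_setT.

Definition rectangle d (B : 'I_d -> set (measurableTypeR R)) : set 'rV[R]_d :=
  [set x | forall i, B i (x ord0 i)].

Lemma measurable_rectangle d (B : 'I_d -> set (measurableTypeR R)) :
  (forall i, measurable (B i)) -> measurable (rectangle B).
Proof.
move=> mB; have -> : rectangle B =
    \bigcap_(i in [set: 'I_d]) ((fun x : 'rV[R]_d => x ord0 i : measurableTypeR R) @^-1` B i).
  by apply/seteqP; split => x h i //=; exact: h.
apply: fin_bigcap_measurable => // i _.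
by rewrite -[X in measurable X]setTI; exact: measurable_coord.
Qed.

Lemma cube_rectangle d : @cube R d = rectangle (fun=> `]0, 1[%classic).
Proof. by apply/seteqP; split => x h i; have := h i; rewrite /= in_itv. Qed.

Lemma measurable_cube d : measurable (@cube R d).
Proof. by rewrite cube_rectangle; apply: measurable_rectangle. Qed.

Lemma lebesgue_rV_rectangle d (B : 'I_d -> set (measurableTypeR R)) :
  (forall i, measurable (B i)) ->
  (lebesgue_rV d (rectangle B) = \prod_(i < d) leb (B i))%E.
Proof.
elim: d B => [|d IH] B mB.
  by rewrite big_ord0 /= diracE mem_set// => -[].
rewrite big_ord_recl /=.
rewrite /rV_lift_measure /pushforward.
have -> : @rV_cons R d @^-1` rectangle B =
    B ord0 `*` rectangle (fun i => B (lift ord0 i)).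
  apply/seteqP; split => [[a x] /= h|[a x] /= [h0 h] i].
    split => /=; first by have := h ord0; rewrite mxE unlift_none.
    by move=> i; have := h (lift ord0 i); rewrite mxE liftK.
  by rewrite mxE; case: unliftP => [j ->|->] //=; exact: h.
rewrite product_measure1E//; last exact: measurable_rectangle.
by congr (_ * _)%E; exact: IH.
Qed.

Definition cubeP d : set 'rV[R]_d -> \bar R :=
  mrestr (lebesgue_rV d) (@measurable_cube d).

HB.instance Definition _ d := Measure.on (@cubeP d).

Lemma cubeP_rectangle d (B : 'I_d -> set (measurableTypeR R)) :
  (forall i, measurable (B i)) ->
  (cubeP (rectangle B) = \prod_(i < d) lam (B i))%E.
Proof.
move=> mB; rewrite /cubeP /mrestr cube_rectangle.
have -> : rectangle B `&` rectangle (fun=> `]0, 1[%classic) =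
    rectangle (fun i => B i `&` `]0, 1[%classic).
  by apply/seteqP; split => [x [h1 h2] i|x h]; [split|split => i; have [] := h i].
by rewrite lebesgue_rV_rectangle// => i; exact: measurableI.
Qed.

Lemma rectangleT d : rectangle (fun _ : 'I_d => setT) = setT.
Proof. by apply/seteqP; split. Qed.

Lemma cubeP_setT d : @cubeP d setT = 1%E.
Proof.
rewrite -rectangleT cubeP_rectangle// big1// => i _; exact: lam_setT.
Qed.

HB.instance Definition _ d := Measure_isProbability.Build _ _ _ (@cubeP d) (cubeP_setT d).

Definition rectangles d : set (set 'rV[R]_d) :=
  [set A | exists2 B, (forall i, measurable (B i)) & A = rectangle B].

Lemma rectangles_setI d : setI_closed (@rectangles d).
Proof.
move=> _ _ [B mB ->] [C mC ->]; exists (fun i => B i `&` C i).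
  by move=> i; exact: measurableI.
by apply/seteqP; split => [x [h1 h2] i|x h]; [split|split => i; have [] := h i].
Qed.

Lemma rectangles_generate d : measurable = <<s @rectangles d >>.
Proof.
apply/seteqP; split.
  apply: smallest_sub; first exact: smallest_sigma_algebra.
  move=> A; rewrite -bigcup_seq/= => -[i _ [B mB <-]]; apply: sub_sigma_algebra.
  exists (fun j => if j == i then B else setT).
    by move=> j; case: ifP.
  apply/seteqP; split => [x [_ /= Bx] j|x /(_ i) /=]; last by rewrite eqxx.
  by case: eqP => // ->.
apply: smallest_sub; first exact: sigma_algebra_measurable.
by move=> _ [B mB ->]; exact: measurable_rectangle.
Qed.

Lemma eq_measure_rectangles d (m1 m2 : {measure set 'rV[R]_d -> \bar R}) :
  (m1 setT < +oo)%E ->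
  (forall B, (forall i, measurable (B i)) -> m1 (rectangle B) = m2 (rectangle B)) ->
  forall A, measurable A -> m1 A = m2 A.
Proof.
move=> fin1 m12 A mA.
apply: (measure_unique (@rectangles d) (fun=> setT)) => //.
- exact: rectangles_generate.
- exact: rectangles_setI.
- by move=> _; exists (fun=> setT) => //; rewrite rectangleT.
- by rewrite bigcup_const//; exists 0%N.
- by move=> _ [B mB ->]; exact: m12.
Qed.

Lemma set_coordE d (x : 'rV[R]_d) s t j :
  set_coord x s t ord0 j = if j == s then t else x ord0 j.
Proof. by rewrite mxE. Qed.

Lemma set_coord_id d (x : 'rV[R]_d) s : set_coord x s (x ord0 s) = x.
Proof. by apply/rowP => j; rewrite mxE; case: eqP => // ->. Qed.

Lemma set_coord_set d (x : 'rV[R]_d) s t u :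
  set_coord (set_coord x s t) s u = set_coord x s u.
Proof. by apply/rowP => j; rewrite !mxE; case: eqP. Qed.

Lemma measurable_set_coord d (s : 'I_d) :
  measurable_fun setT (fun p : 'rV[R]_d * measurableTypeR R => set_coord p.1 s p.2).
Proof.
apply: measurable_fun_rVP => i; under eq_fun do rewrite mxE.
case: (i == s); first exact: measurable_snd.
by apply: (measurableT_comp (measurable_coord i)); exact: measurable_fst.
Qed.

Lemma measurable_set_coord1 d (s : 'I_d) (x : 'rV[R]_d) :
  measurable_fun setT (fun t : measurableTypeR R => set_coord x s t).
Proof.
apply: measurable_fun_rVP => i; under eq_fun do rewrite mxE.
by case: (i == s); [exact: measurable_id|exact: measurable_cst].
Qed.

(* This is how Fubini's theorem is applied in the variable [x_s] alone, without splitting ['rV_d]. *)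
Lemma cubeP_resample d (s : 'I_d) (A : set 'rV[R]_d) : measurable A ->
  cubeP A = pushforward (@cubeP d \x lam)%E
    (fun p : 'rV[R]_d * measurableTypeR R => set_coord p.1 s p.2) A.
Proof.
pose phi := fun p : 'rV[R]_d * measurableTypeR R => set_coord p.1 s p.2.
pose phiM : {mfun _ >-> _} := HB.pack phi (isMeasurableFun.Build _ _ _ _ phi (measurable_set_coord s)).
move: A; apply: (@eq_measure_rectangles d (@cubeP d) (pushforward (@cubeP d \x lam)%E phiM)).
  by rewrite [X in (X < _)%E](cubeP_setT d) ltry.
move=> B mB /=; rewrite /pushforward.
pose B' i := if i == s then setT else B i.
have -> : phiM @^-1` rectangle B = rectangle B' `*` B s.
  apply/seteqP; split => [[x t] /= h|[x t] /= [h1 h2] i].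
    split => /=.
      by move=> i; rewrite /B'; case: eqP => // /eqP i_s; have := h i;
         rewrite /phi mxE (negbTE i_s).
    by have := h s; rewrite /phi mxE eqxx.
  rewrite /phi mxE; case: eqP => [->//|/eqP i_s].
  by have := h1 i; rewrite /B' (negbTE i_s).
have mB' i : measurable (B' i) by rewrite /B'; case: ifP.
rewrite product_measure1E//; last exact: measurable_rectangle.
rewrite !cubeP_rectangle// (bigD1 s)//= muleC; congr (_ * _)%E.
rewrite [RHS](cubeP_rectangle mB') [RHS](bigD1 s)//=.
rewrite {1}/B' eqxx [lam setT]lam_setT mul1e.
by apply: eq_bigr => i /negbTE i_s; rewrite /B' i_s.
Qed.

End Cube.

(** * Integration along lines parallel to a coordinate axis *)

Section Resample.
Context {R : realType} {d : nat} (s : 'I_d).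
Implicit Types (f : 'rV[R]_d -> R).
Local Notation P := (@cubeP R d).
Local Notation shuffle := (fun p : 'rV[R]_d * measurableTypeR R => set_coord p.1 s p.2).

Let shuffleM : {mfun _ >-> _} :=
  HB.pack shuffle (isMeasurableFun.Build _ _ _ _ shuffle (measurable_set_coord s)).

Let integral_shuffle (f : 'rV[R]_d -> \bar R) :
  (\int[P]_x f x = \int[pushforward (P \x lam)%E shuffleM]_x f x)%E.
Proof. by apply: eq_measure_integral => A mA _; exact: (@cubeP_resample R d s A). Qed.

Lemma rintegrable_shuffle f : rintegrable P f ->
  rintegrable (P \x lam)%E (fun p => f (set_coord p.1 s p.2)).
Proof.
move=> fi; have mf := rintegrable_meas fi.
have mfs : measurable_fun setT (f \o shuffle).
  exact: measurableT_comp (measurable_set_coord s).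
apply/integrableP; split; first exact/measurable_EFinP.
case/integrableP: fi => _; rewrite integral_shuffle ge0_integral_pushforward//.
by do 2 apply: measurableT_comp => //; exact/measurable_EFinP.
Qed.

Lemma Rintegral_shuffle f : rintegrable P f ->
  \int[P]_x f x = \int[(P \x lam)%E]_p f (set_coord p.1 s p.2).
Proof.
move=> fi; rewrite /Rintegral integral_shuffle integral_pushforward//.
  by apply/measurable_EFinP; exact: rintegrable_meas fi.
exact: (rintegrable_shuffle fi).
Qed.

Lemma Rintegral_resample f : rintegrable P f ->
  \int[P]_x f x = \int[P]_x \int[lam]_t f (set_coord x s t).
Proof.
by move=> fi; rewrite Rintegral_shuffle// Rfubini//; exact: rintegrable_shuffle.
Qed.

Lemma rintegrable_resample f : rintegrable P f ->
  rintegrable P (fun x => \int[lam]_t f (set_coord x s t)).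
Proof. by move/rintegrable_shuffle => /rintegrable_fubini. Qed.

Lemma ae_rintegrable_line f : rintegrable P f ->
  {ae P, forall x, rintegrable lam (fun t => f (set_coord x s t))}.
Proof. by move/rintegrable_shuffle => /ae_rintegrable_section. Qed.

Lemma measurable_line f (x : 'rV[R]_d) : measurable_fun setT f ->
  measurable_fun setT (fun t : measurableTypeR R => f (set_coord x s t)).
Proof. by move=> mf; apply: measurableT_comp mf _; exact: measurable_set_coord1. Qed.

Lemma ae_sqintegrable_line f : sqintegrable P f ->
  {ae P, forall x, sqintegrable lam (fun t => f (set_coord x s t))}.
Proof.
move=> [mf /ae_rintegrable_line]; apply: filterS => x h.
by split => //; exact: measurable_line.
Qed.

(** Resampling one coordinate preserves the measure, so the preimage of a null set is null in the
    product with the interval, and almost all its sections are null. *)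
Lemma ae_line (Q : 'rV[R]_d -> Prop) : {ae P, forall x, Q x} ->
  {ae P, forall x, {ae lam, forall t, Q (set_coord x s t)}}.
Proof.
move=> [N [mN N0 QN]].
apply: (@ae_ae_section _ _ _ _ _ P lam (fun p => Q (shuffle p))).
exists (shuffle @^-1` N); split.
- by rewrite -[X in measurable X]setTI; exact: measurable_set_coord.
- by rewrite -N0 [RHS](cubeP_resample s mN).
- by move=> p /= /QN.
Qed.

Lemma eq_Rintegral_lines f g : rintegrable P f -> rintegrable P g ->
  {ae P, forall x, \int[lam]_t f (set_coord x s t) = \int[lam]_t g (set_coord x s t)} ->
  \int[P]_x f x = \int[P]_x g x.
Proof.
move=> fi gi fg; rewrite Rintegral_resample// [RHS]Rintegral_resample//.
by apply: ae_eq_Rintegral; exact: ae_eqT.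
Qed.

Lemma le_Rintegral_lines f g : rintegrable P f -> rintegrable P g ->
  {ae P, forall x, \int[lam]_t f (set_coord x s t) <= \int[lam]_t g (set_coord x s t)} ->
  \int[P]_x f x <= \int[P]_x g x.
Proof.
move=> fi gi fg; rewrite Rintegral_resample// [leRHS]Rintegral_resample//.
by apply: ae_le_Rintegral => //; exact: rintegrable_resample.
Qed.

End Resample.

(** * Bounded measurable functions and integral operators on the unit interval *)

Section LineOperators.
Context {R : realType}.
Implicit Types (K : R -> R -> R) (v : R -> R).

(** The class of factors allowed in test functions: unlike smooth functions, it is stable under the
    transposes of discontinuous kernels such as the projection kernel. *)
Definition bmeas d (T : measurableType d) (f : T -> R) :=
  measurable_fun setT f /\ exists M, forall x, `|f x| <= M.

Definition bkernel K := bmeas (fun p : measurableTypeR R * measurableTypeR R => K p.1 p.2).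

Definition kint K v (t : R) := \int[lam]_u (K t u * v u).
Definition kintT K v (u : R) := \int[lam]_t (K t u * v t).

Lemma bmeas_sqintegrable d (T : measurableType d) (P : probability T R) (f : T -> R) :
  bmeas f -> sqintegrable P f.
Proof. by move=> [mf [M fM]]; exact: sqintegrable_bounded fM. Qed.

Lemma bmeas_int d (T : measurableType d) (P : probability T R) (f : T -> R) :
  bmeas f -> rintegrable P f.
Proof. by move=> /bmeas_sqintegrable fi; exact: sqintegrable_int. Qed.

Lemma bmeasM_int d (T : measurableType d) (P : probability T R) (f g : T -> R) :
  bmeas f -> rintegrable P g -> rintegrable P (fun x => f x * g x).
Proof.
move=> [mf [M fM]] gi; have mg := rintegrable_meas gi.
apply: (@rintegrable_dom _ _ _ _ _ (fun x => M * `|g x|)).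
- exact: measurable_funM.
- by apply: rintegrableZ; exact: rintegrable_norm.
- by move=> x; rewrite normrM ler_wpM2r.
Qed.

Lemma bmeasM_sq d (T : measurableType d) (P : probability T R) (f g : T -> R) :
  bmeas f -> sqintegrable P g -> sqintegrable P (fun x => f x * g x).
Proof. by move=> [mf [M fM]] gi; exact: sqintegrableM_bounded fM. Qed.

Lemma bmeas_cst d (T : measurableType d) (c : R) : bmeas (fun _ : T => c).
Proof. by split; [exact: measurable_cst|exists `|c|]. Qed.

Lemma bmeasD d (T : measurableType d) (f g : T -> R) :
  bmeas f -> bmeas g -> bmeas (fun x => f x + g x).
Proof.
move=> [mf [M fM]] [mg [N gN]]; split; first exact: measurable_funD.
by exists (M + N) => x; rewrite (le_trans (ler_normD _ _))// lerD.
Qed.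

Lemma bmeasM d (T : measurableType d) (f g : T -> R) :
  bmeas f -> bmeas g -> bmeas (fun x => f x * g x).
Proof.
move=> [mf [M fM]] [mg [N gN]]; split; first exact: measurable_funM.
by exists (M * N) => x; rewrite normrM ler_pM.
Qed.

Lemma bmeasN d (T : measurableType d) (f : T -> R) : bmeas f -> bmeas (fun x => - f x).
Proof.
move=> /(bmeasM (@bmeas_cst _ T (-1))).
by under [X in bmeas X]eq_fun do rewrite mulN1r.
Qed.

Lemma bmeasB d (T : measurableType d) (f g : T -> R) :
  bmeas f -> bmeas g -> bmeas (fun x => f x - g x).
Proof. by move=> fb /bmeasN; exact: bmeasD. Qed.

Lemma bmeas_sum d (T : measurableType d) I (r : seq I) (Q : pred I) (F : I -> T -> R) :
  (forall i, Q i -> bmeas (F i)) -> bmeas (fun x => \sum_(i <- r | Q i) F i x).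
Proof.
move=> FP; elim: r => [|i r IH].
  by under [X in bmeas X]eq_fun do rewrite big_nil; exact: bmeas_cst.
under [X in bmeas X]eq_fun do rewrite big_cons.
by case: (boolP (Q i)) => // /FP Fi; apply: bmeasD.
Qed.

Lemma bmeas_prod d (T : measurableType d) I (r : seq I) (Q : pred I) (F : I -> T -> R) :
  (forall i, Q i -> bmeas (F i)) -> bmeas (fun x => \prod_(i <- r | Q i) F i x).
Proof.
move=> FP; elim: r => [|i r IH].
  by under [X in bmeas X]eq_fun do rewrite big_nil; exact: bmeas_cst.
under [X in bmeas X]eq_fun do rewrite big_cons.
by case: (boolP (Q i)) => // /FP Fi; apply: bmeasM.
Qed.

Lemma bmeas_comp d1 d2 (T1 : measurableType d1) (T2 : measurableType d2)
    (f : T2 -> R) (g : T1 -> T2) :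
  bmeas f -> measurable_fun setT g -> bmeas (fun x => f (g x)).
Proof.
by move=> [mf [M fM]] mg; split; [exact: measurableT_comp mf mg|exists M => x].
Qed.

Lemma bkernelT K : bkernel K -> bkernel (fun t u => K u t).
Proof.
move=> Kb; apply: (@bmeas_comp _ _ _ _ _ (fun p => (p.2, p.1)) Kb).
by apply/measurable_fun_pairP; split; [exact: measurable_snd|exact: measurable_fst].
Qed.

Lemma bkernel_line K t : bkernel K -> bmeas (K t : measurableTypeR R -> R).
Proof.
move=> Kb; apply: (@bmeas_comp _ _ _ _ _ (fun u => (t, u)) Kb).
by apply/measurable_fun_pairP; split; [exact: measurable_cst|exact: measurable_id].
Qed.

Lemma bkernel_int (K : R -> R -> R) (v : R -> R) : bkernel K -> rintegrable lam v ->
  rintegrable (lam \x lam)%E (fun p => K p.1 p.2 * v p.2).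
Proof.
move=> Kb vi; apply: bmeasM_int => //; have mv := rintegrable_meas vi.
have mv2 : measurable_fun setT (fun p : measurableTypeR R * measurableTypeR R => v p.2).
  by apply: measurableT_comp mv _; exact: measurable_snd.
apply/integrableP; split; first exact/measurable_EFinP.
rewrite fubini_tonelli1//=; last by do 2 apply: measurableT_comp => //; exact/measurable_EFinP.
rewrite /fubini_F/= integral_cst//= probability_setT mule1.
by case/integrableP : vi.
Qed.

Lemma bmeas_kint K v : bkernel K -> rintegrable lam v -> bmeas (kint K v : measurableTypeR R -> R).
Proof.
move=> Kb vi; split.
  by apply: (@measurable_Rfubini _ _ _ _ _ lam lam (fun p => K p.1 p.2 * v p.2)); exact: bkernel_int.
have [_ [M KM]] := Kb; exists (M * \int[lam]_u `|v u|) => t.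
have Ki : rintegrable lam (fun u => K t u * v u) by apply: bmeasM_int => //; exact: bkernel_line.
rewrite -RintegralZT; last exact: rintegrable_norm.
apply: le_trans (le_normr_Rintegral _ Ki) _ => //.
apply: le_RintegralT; first exact: rintegrable_norm.
  by apply: rintegrableZ; exact: rintegrable_norm.
by move=> u; rewrite normrM ler_wpM2r// (KM (t, u)).
Qed.

Lemma bmeas_kintT K v : bkernel K -> rintegrable lam v ->
  bmeas (kintT K v : measurableTypeR R -> R).
Proof. by move=> /bkernelT; exact: bmeas_kint. Qed.

Lemma kint_dual K v w : bkernel K -> rintegrable lam v -> bmeas (w : measurableTypeR R -> R) ->
  \int[lam]_t (w t * kint K v t) = \int[lam]_u (kintT K w u * v u).
Proof.
move=> Kb vi wb; have wKb : bkernel (fun t u => w t * K t u).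
  by apply: bmeasM => //; apply: (bmeas_comp wb); exact: measurable_fst.
have := Rfubini_swap (bkernel_int wKb vi) => /= E.
transitivity (\int[lam]_t \int[lam]_u (w t * K t u * v u)).
  apply: eq_Rintegral => t _; rewrite -RintegralZT; last first.
    by apply: bmeasM_int => //; exact: bkernel_line.
  by apply: eq_Rintegral => u _; rewrite mulrA.
rewrite E; apply: eq_Rintegral => u _; rewrite -RintegralZr//.
  by apply: eq_Rintegral => t _; rewrite mulrC; ring.
apply: bmeas_int; apply: bmeasM => //; exact: (bkernel_line _ (bkernelT Kb)).
Qed.

End LineOperators.

Section AeLogic.
Context d (T : measurableType d) (R : realType) (mu : {measure set T -> \bar R}).

Lemma ae_imp (Q Q' : T -> Prop) : {ae mu, forall x, Q x} -> (forall x, Q x -> Q' x) ->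
  {ae mu, forall x, Q' x}.
Proof. by move=> h QQ'; apply: filterS h. Qed.

Lemma ae_imp2 (Q1 Q2 Q' : T -> Prop) : {ae mu, forall x, Q1 x} -> {ae mu, forall x, Q2 x} ->
  (forall x, Q1 x -> Q2 x -> Q' x) -> {ae mu, forall x, Q' x}.
Proof. by move=> h1 h2 QQ'; apply: filterS2 h1 h2. Qed.

Lemma ae_all (Q : T -> Prop) : (forall x, Q x) -> {ae mu, forall x, Q x}.
Proof. by move=> h; apply: aeW. Qed.

End AeLogic.

(** * Smooth functions of one variable *)

Section SmoothFunctions.
Context {R : realType}.
Implicit Types f g : R -> R.

Fixpoint nderivable n f : Prop :=
  (forall x, derivable f x 1) /\ if n is m.+1 then nderivable m (derive1 f) else True.

Definition csmooth f := forall n, nderivable n f.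

Lemma nderivable_der n f : nderivable n f -> forall x, derivable f x 1.
Proof. by case: n => [|n] []. Qed.

Lemma nderivableW n f : nderivable n.+1 f -> nderivable n f.
Proof. by elim: n f => [|n IH] f [df] => [_|/IH]. Qed.

Lemma csmooth_derivable f x : csmooth f -> derivable f x 1.
Proof. by move=> /(_ 0%N)[]. Qed.

Lemma csmooth_derive f : csmooth f -> csmooth (derive1 f).
Proof. by move=> sf n; have [] := sf n.+1. Qed.

Definition hasder f (x df : R) : Prop := @is_derive R R R x 1 f df.

Lemma hasder_derive1 f x df : hasder f x df -> derive1 f x = df.
Proof. by move=> h; rewrite derive1E (@derive_val _ _ _ _ _ _ _ h). Qed.

Lemma derive1_fun f g : (forall x, hasder f x (g x)) -> derive1 f = g.
Proof. by move=> fg; apply/funext => x; exact: hasder_derive1. Qed.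

Lemma hasder_derivable f df x : hasder f x df -> derivable f x 1.
Proof. by move=> h; exact: (@ex_derive _ _ _ _ _ _ _ h). Qed.

Lemma derivable_hasder f (x : R) : derivable f x 1 -> hasder f x (derive1 f x).
Proof. by move=> h; rewrite derive1E; exact: derivableP. Qed.

Lemma hasderD f g x df dg : hasder f x df -> hasder g x dg ->
  hasder (fun x => f x + g x) x (df + dg).
Proof. exact: is_deriveD. Qed.

Lemma hasderN f x df : hasder f x df -> hasder (fun x => - f x) x (- df).
Proof. exact: is_deriveN. Qed.

Lemma hasderM f g x df dg : hasder f x df -> hasder g x dg ->
  hasder (fun x => f x * g x) x (f x * dg + g x * df).
Proof. exact: is_deriveM. Qed.

Lemma hasder_cst (c x : R) : hasder (fun=> c) x 0.
Proof. exact: is_derive_cst. Qed.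

Lemma hasder_id (x : R) : hasder id x 1.
Proof. exact: is_derive_id. Qed.

Lemma hasder_comp f g x df dg : hasder f (g x) df -> hasder g x dg ->
  hasder (fun x => f (g x)) x (df * dg).
Proof. by move=> hf hg; exact: (@is_derive1_comp _ f g x _ _ hf hg). Qed.

Lemma hasder_affine (a b x : R) : hasder (fun x => a * x + b) x a.
Proof.
have := hasderD (hasderM (hasder_cst a x) (hasder_id x)) (hasder_cst b x).
by rewrite mulr0 mulr1 !addr0.
Qed.

Lemma hasder_near f g x df : (\forall z \near x, f z = g z) -> hasder f x df -> hasder g x df.
Proof. by move=> fg; exact: near_eq_is_derive. Qed.

Lemma csmooth_hasder f x : csmooth f -> hasder f x (derive1 f x).
Proof. by move=> sf; apply: derivable_hasder; exact: csmooth_derivable. Qed.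

Lemma nderivableS n f g : (forall x, hasder f x (g x)) -> nderivable n g -> nderivable n.+1 f.
Proof.
move=> h gn; split; first by move=> x; exact: hasder_derivable (h x).
by rewrite (derive1_fun h).
Qed.

Lemma nderivable_hasder n f x : nderivable n f -> hasder f x (derive1 f x).
Proof. by move=> fn; apply: derivable_hasder; exact: nderivable_der fn _. Qed.

Lemma nderivable0 f g : (forall x, hasder f x (g x)) -> nderivable 0 f.
Proof. by move=> h; split => // x; exact: hasder_derivable (h x). Qed.

Lemma nderivableD n f g : nderivable n f -> nderivable n g ->
  nderivable n (fun x => f x + g x).
Proof.
elim: n f g => [|n IH] f g fn gn;
  have h x := hasderD (nderivable_hasder x fn) (nderivable_hasder x gn).
  exact: nderivable0 h.
by apply: nderivableS h _; apply: IH; [case: fn|case: gn].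
Qed.

Lemma nderivableM n f g : nderivable n f -> nderivable n g ->
  nderivable n (fun x => f x * g x).
Proof.
elim: n f g => [|n IH] f g fn gn;
  have h x := hasderM (nderivable_hasder x fn) (nderivable_hasder x gn).
  exact: nderivable0 h.
apply: nderivableS h _; apply: nderivableD; apply: IH; do ?exact: nderivableW.
  by case: gn.
by case: fn.
Qed.

Lemma nderivable_cst n (c : R) : nderivable n (fun=> c).
Proof.
elim: n c => [|n IH] c; first exact: nderivable0 (hasder_cst c).
exact: nderivableS (hasder_cst c) (IH 0).
Qed.

Lemma csmoothM f g : csmooth f -> csmooth g -> csmooth (fun x => f x * g x).
Proof. by move=> fs gs n; exact: nderivableM. Qed.

Lemma csmoothZ c f : csmooth f -> csmooth (fun x => c * f x).
Proof. by move=> fs n; apply: nderivableM => //; exact: nderivable_cst. Qed.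

Lemma csmooth_affine f (a b : R) : csmooth f -> csmooth (fun x => f (a * x + b)).
Proof.
move=> fs n; elim: n f fs => [|n IH] f fs;
  have h x := @hasder_comp _ (fun x => a * x + b) _ _ _
    (csmooth_hasder (a * x + b) fs) (hasder_affine a b x).
  exact: nderivable0 h.
apply: nderivableS h _; apply: nderivableM; last exact: nderivable_cst.
by apply: IH; exact: csmooth_derive.
Qed.

Lemma csmooth_continuous f : csmooth f -> continuous f.
Proof.
move=> sf x; apply: differentiable_continuous; apply/derivable1_diffP.
exact: csmooth_derivable.
Qed.

(** The power of 1/y closes the family under differentiation: the derivative of [flat k] is
    [flat k.+2 - k * flat k.+1]. Smoothness at 0 then follows by induction for all k at once. *)
Definition flat k (y : R) : R := if 0 < y then y^-1 ^+ k * expR (- y^-1) else 0.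

Lemma flat_ge0 k y : 0 <= flat k y.
Proof.
rewrite /flat; case: ltP => // y0.
by rewrite mulr_ge0 ?expR_ge0// exprn_ge0// invr_ge0 ltW.
Qed.

(** With z = 1/y this is e^z >= z^(k+2) / (k+2)!. A quadratic bound suffices for the derivative at 0
    to exist and vanish. *)
Lemma flat_le_sqr k (y : R) : flat k y <= (k.+2)`!%:R * y ^+ 2.
Proof.
rewrite /flat; case: ltP => [y0|_]; last by rewrite mulr_ge0// sqr_ge0.
set z := y^-1; have z0 : 0 < z by rewrite invr_gt0.
have -> : y = z^-1 by rewrite invrK.
have f0 : 0 < (k.+2)`!%:R :> R by rewrite ltr0n fact_gt0.
have := expR_ge1Dxn k.+1 (ltW z0) => h.
have {h} : z ^+ k.+2 / (k.+2)`!%:R <= expR z by apply: le_trans h; rewrite lerDr.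
rewrite ler_pdivrMr// => h.
rewrite expRN -(ler_pM2r (expR_gt0 z)) mulfVK ?gt_eqF ?expR_gt0//.
rewrite -(ler_pM2r (exprn_gt0 2 z0)) -exprD addn2.
have -> : (k.+2)`!%:R * z^-1 ^+ 2 * expR z * z ^+ 2 = expR z * (k.+2)`!%:R; last by [].
by field; rewrite gt_eqF.
Qed.

Lemma hasder_quadratic_bound (f : R -> R) (C : R) :
  (forall h, `|f h| <= C * h ^+ 2) -> hasder f 0 0.
Proof.
move=> fC; have f0 : f 0 = 0.
  by apply/eqP; rewrite -normr_le0 (le_trans (fC 0))// expr0n mulr0.
have cv : (fun h : R => h^-1 *: (f (h *: (1 : R) + 0) - f 0)) @ 0^' --> (0 : R).
  apply/cvgr0Pnorm_lt => e e0; near=> h.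
  rewrite f0 subr0 addr0 [h *: _]mulr1 normrZ normfV.
  have h0 : 0 < `|h| by rewrite normr_gt0; near: h; exact: nbhs_dnbhs_neq.
  rewrite mulrC ltr_pdivrMr// (le_lt_trans (fC h))//.
  rewrite -real_normK ?num_real// expr2 mulrA ltr_pM2r//.
  apply: (@le_lt_trans _ _ ((`|C| + 1) * `|h|)).
    by rewrite ler_wpM2r// (le_trans (ler_norm _))// lerDl.
  have C1 : 0 < `|C| + 1 by rewrite ltr_wpDl.
  rewrite mulrC -ltr_pdivlMr//; near: h; apply: dnbhs0_lt.
  by rewrite divr_gt0.
apply: DeriveDef; first by apply/cvg_ex; exists 0.
exact: cvg_lim cv.
Unshelve. all: by end_near. Qed.

Lemma hasder_flat k (y : R) : hasder (flat k) y (flat k.+2 y - k%:R * flat k.+1 y).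
Proof.
have [y0|y0|->] := ltgtP y 0; last 1 first.
- rewrite /flat ltxx mulr0 subr0; apply: (@hasder_quadratic_bound _ (k.+2)`!%:R) => h.
  by rewrite ger0_norm ?flat_le_sqr// flat_ge0.
- rewrite {2 3}/flat ltNge (ltW y0)/= mulr0 subr0.
  apply: (@hasder_near (fun=> 0)); last exact: hasder_cst.
  near=> z; rewrite /flat ltNge; have -> //: z <= 0.
  by apply/ltW; near: z; exact: lt_nbhsl.
- apply: (@hasder_near (fun z => z^-1 ^+ k * expR (- z^-1))).
    near=> z; rewrite /flat; have -> //: 0 < z.
    by near: z; exact: lt_nbhsr.
  rewrite /flat y0.
  have yn0 : y != 0 by rewrite gt_eqF.
  have dV : hasder (fun z : R => z^-1) y (- y^-1 ^+ 2).
    have := @is_deriveV R id y 1 1 yn0 (is_derive_id _ _).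
    by rewrite /hasder [_ *: _]mulr1 exprVn.
  have dE : hasder (fun z : R => expR (- z^-1)) y (y^-1 ^+ 2 * expR (- y^-1)).
    have := @hasder_comp _ (fun z : R => - z^-1) _ _ _
      (is_derive_expR _ : hasder expR (- y^-1) _) (hasderN dV).
    by rewrite opprK mulrC.
  have dX j : hasder (fun z : R => z^-1 ^+ j) y (- (j%:R * y^-1 ^+ j.+1)).
    elim: j => [|j IH]; first by rewrite mul0r oppr0; exact: hasder_cst.
    have := hasderM dV IH; congr (hasder _ y _).
      by apply/funext => z; rewrite exprS.
    by rewrite -natr1 !exprS; ring.
  have := hasderM (dX k) dE; congr (hasder _ y _).
  by rewrite !exprS; ring.
Unshelve. all: by end_near. Qed.

Lemma csmooth_flat k : csmooth (flat k).
Proof.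
move=> n; elim: n k => [|n IH] k; first exact: nderivable0 (hasder_flat k).
apply: nderivableS (hasder_flat k) _.
under [X in nderivable n X]eq_fun do rewrite -mulNr.
apply: nderivableD; first exact: IH.
by apply: nderivableM; [exact: nderivable_cst|exact: IH].
Qed.

Lemma flat0_le1 y : flat 0 y <= 1.
Proof.
rewrite /flat; case: ltP => // y0.
by rewrite expr0 mul1r expR_le1 oppr_le0 invr_ge0 ltW.
Qed.

Lemma cvg_flat0 (y : R) : 0 < y -> flat 0 (n.+1%:R * y - 1) @[n --> \oo] --> (1 : R).
Proof.
move=> y0; apply/cvgrPdist_le => e e0; near=> n.
set u := n.+1%:R * y - 1.
have ue : e^-1 <= u.
  rewrite /u lerBrDr -ler_pdivrMr// (@le_trans _ _ n%:R) ?ler_nat//.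
  by near: n; exact: nbhs_infty_ger.
have u0 : 0 < u by rewrite (lt_le_trans _ ue)// invr_gt0.
rewrite /flat u0 expr0 mul1r ger0_norm; last first.
  by rewrite subr_ge0 expR_le1 oppr_le0 invr_ge0 ltW.
rewrite lerBlDr -lerBlDl (@le_trans _ _ (1 - u^-1))//; last exact: expR_ge1Dx.
by rewrite lerD2l lerN2 -[e]invrK lef_pV2// posrE invr_gt0.
Unshelve. all: by end_near. Qed.

Definition Ccinf f := csmooth f /\ exists a b, [/\ 0 < a, b < 1 &
  forall x, ~~ (a <= x <= b) -> f x = 0].

Lemma Ccinf_derive f : Ccinf f -> Ccinf (derive1 f).
Proof.
move=> [sf [a [b [a0 b1 fab]]]]; split; first exact: csmooth_derive.
exists a, b; split => // x xab; apply: hasder_derive1.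
apply: (@hasder_near (fun=> 0)); last exact: hasder_cst.
move: xab; rewrite negb_and -!ltNge => /orP[xa|bx]; near=> z; rewrite fab// negb_and -!ltNge.
  by apply/orP; left; near: z; exact: lt_nbhsl.
by apply/orP; right; near: z; exact: lt_nbhsr.
Unshelve. all: by end_near. Qed.

Lemma CcinfZ c f : Ccinf f -> Ccinf (fun x => c * f x).
Proof.
move=> [sf [a [b [a0 b1 fab]]]]; split; first exact: csmoothZ.
by exists a, b; split => // x /fab ->; rewrite mulr0.
Qed.

Lemma Ccinf_continuous f : Ccinf f -> continuous f.
Proof. by move=> [/csmooth_continuous]. Qed.

Lemma Ccinf_meas f : Ccinf f -> measurable_fun setT f.
Proof. by move=> /Ccinf_continuous; exact: continuous_measurable_fun. Qed.

Lemma Ccinf_out f x : Ccinf f -> ~~ (0 < x < 1) -> f x = 0.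
Proof.
move=> [_ [a [b [a0 b1 fab]]]] h; apply: fab; apply: contra h => /andP[ax xb].
by rewrite (lt_le_trans a0 ax) (le_lt_trans xb b1).
Qed.

Lemma Ccinf_bmeas f : Ccinf f -> bmeas (f : measurableTypeR R -> R).
Proof.
move=> Cf; split; first exact: Ccinf_meas.
have cf : {within `[0, 1], continuous (fun x => `|f x|)}.
  apply: continuous_subspaceT => x; apply: continuous_comp; last exact: norm_continuous.
  exact: Ccinf_continuous.
have [c _ fc] := EVT_max ler01 cf; exists `|f c| => x.
have [x01|x01] := boolP (x \in `[0, 1]); first exact: fc.
rewrite (Ccinf_out Cf) ?normr0//; apply: contra x01 => /andP[x0 x1].
by rewrite in_itv/= !ltW.
Qed.

(** A smooth function with values in [0, 1], zero outside [a + 1/(n+1), b - 1/(n+1)], which tends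
    pointwise to the indicator of the open interval from a to b. *)
Definition cutoff a b n (x : R) :=
  flat 0 (n.+1%:R * (x - a) - 1) * flat 0 (n.+1%:R * (b - x) - 1).

Lemma Ccinf_cutoff (a b : R) n : 0 <= a -> b <= 1 -> Ccinf (cutoff a b n).
Proof.
move=> a0 b1; split.
  have -> : cutoff a b n = (fun x => flat 0 (n.+1%:R * x + (- (n.+1%:R * a) - 1)) *
      flat 0 (- n.+1%:R * x + (n.+1%:R * b - 1))).
    by apply/funext => x; rewrite /cutoff; congr (flat _ _ * flat _ _); ring.
  have sf := csmooth_flat 0.
  exact: (csmoothM (csmooth_affine _ _ sf) (csmooth_affine _ _ sf)).
have n0 : 0 < n.+1%:R^-1 :> R by rewrite invr_gt0 ltr0n.
exists (a + n.+1%:R^-1), (b - n.+1%:R^-1); split.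
- by rewrite ltr_wpDl.
- by rewrite ltrBlDr (le_lt_trans b1)// ltrDl.
- move=> x; rewrite negb_and -!ltNge => /orP[h|h]; rewrite /cutoff.
    rewrite /flat ltNge (_ : _ <= 0) ?mul0r//.
    rewrite subr_le0 mulrC -ler_pdivlMr ?ltr0n// div1r lerBlDl; exact: ltW.
  rewrite mulrC /flat ltNge (_ : _ <= 0) ?mul0r//.
  by rewrite subr_le0 mulrC -ler_pdivlMr ?ltr0n// div1r lerBlDr -lerBlDl ltW.
Qed.

Lemma cutoff_ge0 a b n x : 0 <= cutoff a b n x.
Proof. by rewrite mulr_ge0// flat_ge0. Qed.

Lemma cutoff_le1 a b n x : cutoff a b n x <= 1.
Proof. by rewrite -[leRHS]mulr1 ler_pM ?flat_ge0 ?flat0_le1. Qed.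

Lemma cvg_cutoff (a b x : R) : cutoff a b n x @[n --> \oo] --> ((a < x < b)%R%:R : R).
Proof.
have [/andP[ax xb]|] := boolP (a < x < b).
  rewrite -[1%:R]mulr1; apply: cvgM; apply: cvg_flat0; by rewrite subr_gt0.
rewrite negb_and -!leNgt => /orP h.
have -> : (fun n => cutoff a b n x) = (fun=> 0); last exact: cvg_cst.
apply/funext => n; rewrite /cutoff.
have fl0 y : y <= 0 -> flat 0 (n.+1%:R * y - 1) = 0.
  move=> y0; rewrite /flat ltNge (_ : _ <= 0)// subr_le0.
  by rewrite (@le_trans _ _ 0)// mulr_ge0_le0.
by case: h => h; [rewrite [X in X * _]fl0 ?mul0r|rewrite [X in _ * X]fl0 ?mulr0];
  rewrite ?subr_le0.
Qed.

End SmoothFunctions.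

Lemma cvg_Rintegral_dominated d (T : measurableType d) (R : realType) (P : probability T R)
    (f_ : (T -> R)^nat) (f g : T -> R) :
  (forall n, measurable_fun setT (f_ n)) -> measurable_fun setT f ->
  (forall x, f_ n x @[n --> \oo] --> f x) -> rintegrable P g ->
  (forall n x, `|f_ n x| <= g x) ->
  \int[P]_x f_ n x @[n --> \oo] --> \int[P]_x f x.
Proof.
move=> mf_ mf ff ig fg.
have mE (h : T -> R) : measurable_fun setT h -> measurable_fun setT (EFin \o h).
  by move=> mh; exact/measurable_EFinP.
have := @dominated_convergence _ _ _ P setT measurableT (fun n => EFin \o f_ n) (EFin \o f)
  (EFin \o g) (fun n => mE _ (mf_ n)) (mE _ mf).
move=> /(_ _ ig)[].
- by apply: aeW => x _; apply: cvg_EFin; [exact: nearW|exact: ff].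
- by apply: aeW => x n _ /=; rewrite lee_fin.
move=> fi _ cv; apply: fine_cvg; rewrite fineK//.
exact: integrable_fin_num.
Qed.

(** * The fundamental lemma of the calculus of variations in one variable *)

Section FundamentalLemma.
Context {R : realType}.

Lemma cvg_Rintegral_cutoff (F : R -> R) (a b : R) : rintegrable lam F -> 0 <= a -> b <= 1 ->
  \int[lam]_t (F t * cutoff a b n t) @[n --> \oo] -->
  \int[lam]_t (F t * (a < t < b)%R%:R).
Proof.
move=> Fi a0 b1; have mF := rintegrable_meas Fi.
have mc n : measurable_fun setT (fun t => F t * cutoff a b n t).
  by apply: measurable_funM => //; apply: Ccinf_meas; exact: Ccinf_cutoff.
have cv t : F t * cutoff a b n t @[n --> \oo] --> F t * (a < t < b)%R%:R.
  by apply: cvgM; [exact: cvg_cst|exact: cvg_cutoff].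
apply: (@cvg_Rintegral_dominated _ (measurableTypeR R) R lam _ _ (fun t => `|F t|)) => //.
- exact: (measurable_fun_cvg (fun n => mc n)).
- exact: rintegrable_norm.
- move=> n t; rewrite normrM ler_piMr// ger0_norm ?cutoff_ge0//.
  exact: cutoff_le1.
Qed.

Lemma ae_lam_itv : {ae (@lam R), forall t, 0 < t < 1}.
Proof. by apply/ae_mrestr; apply: aeW => t /=; rewrite in_itv. Qed.

(** Dominated convergence along the cutoffs shows that F integrates to 0 over every open subinterval
    of the unit interval; up to null sets these include the traces of the half-lines, a generating
    pi-system. *)
Lemma ae_eq0_Ccinf (F : R -> R) : rintegrable lam F ->
  (forall phi, Ccinf phi -> \int[lam]_t (F t * phi t) = 0) ->
  {ae (@lam R), forall t, F t = 0}.
Proof.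
move=> Fi F0.
have I0 (a b : R) : 0 <= a -> b <= 1 -> \int[lam]_t (F t * (a < t < b)%R%:R) = 0.
  move=> a0 b1; have := cvg_Rintegral_cutoff Fi a0 b1.
  have -> : (fun n => \int[lam]_t (F t * cutoff a b n t)) = (fun=> 0).
    by apply/funext => n; rewrite F0//; exact: Ccinf_cutoff.
  by move=> h; apply/esym; apply: (cvg_unique _ (cvg_cst _) h).
apply: (@ae_eq0_pi_system _ (measurableTypeR R) R lam (@RGenOInfty.G R) F) => //.
- exact: (RGenOInfty.measurableE R).
- move=> _ _ [x ->] [y ->]; exists (Num.max x y).
  by apply/seteqP; split => z; rewrite /= !in_itv/= !andbT gt_max => /andP.
- rewrite -[RHS](I0 0 1)//; apply: ae_eq_Rintegral; apply: ae_eqT.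
  by apply: (ae_imp ae_lam_itv) => t ->; rewrite mulr1.
- move=> _ [x ->]; rewrite Rintegral_mkcond -(I0 (Num.max x 0) 1) ?le_max ?lexx ?orbT//.
  apply: ae_eq_Rintegral; apply: ae_eqT; apply: (ae_imp ae_lam_itv) => t /andP[t0 t1].
  rewrite patchE; case: ifPn => [|].
    by rewrite inE/= in_itv/= andbT => xt; rewrite gt_max xt t0 t1 mulr1.
  rewrite notin_setE/= in_itv/= andbT gt_max => /negP/negbTE ->.
  by rewrite mulr0.
Qed.

Section Swap.
Context {d : nat} (s : 'I_d).
Local Notation P := (@cubeP R d).

(** F is the marginal of G: its integral over all the variables except x_s. Testing G with a
    function of x_s becomes a one-variable question. *)
Lemma Rintegral_coord (G : 'rV[R]_d -> R) : rintegrable P G ->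
  exists2 F, rintegrable lam F & forall phi : R -> R, bmeas (phi : measurableTypeR R -> R) ->
    \int[P]_x (G x * phi (x ord0 s)) = \int[lam]_t (F t * phi t).
Proof.
move=> Gi; have fi := rintegrable_shuffle s Gi.
set f := (fun p : 'rV[R]_d * measurableTypeR R => _) in fi.
exists (fun t => \int[P]_x f (x, t)); last first.
  move=> phi phib; have phi2 : bmeas (fun p : 'rV[R]_d * measurableTypeR R => phi p.2).
    by apply: (bmeas_comp phib); exact: measurable_snd.
  have phic : bmeas (fun x : 'rV[R]_d => phi (x ord0 s)).
    by apply: (bmeas_comp phib); exact: measurable_coord.
  have Gphi : rintegrable P (fun x => G x * phi (x ord0 s)).
    by under [X in rintegrable _ X]eq_fun do rewrite mulrC; exact: bmeasM_int.
  have fphi : rintegrable (P \x lam)%E (fun p => f p * phi p.2).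
    by under [X in rintegrable _ X]eq_fun do rewrite mulrC; exact: bmeasM_int.
  rewrite (Rintegral_shuffle s)//.
  transitivity (\int[(P \x lam)%E]_p (f p * phi p.2)).
    by apply: eq_Rintegral => p _; rewrite set_coordE eqxx.
  rewrite (Rfubini fphi) (Rfubini_swap fphi); apply: ae_eq_Rintegral; apply: ae_eqT.
  apply: (ae_imp (ae_integrable2 fi)) => t ft /=.
  by rewrite RintegralZr.
apply/integrableP; split.
  apply/measurable_EFinP; exact: measurableT_comp (measurable_fubini_G fi).
have /(integrable21ltyP P lam (measurable_int _ fi)) := fi.
apply: le_lt_trans.
have mG := measurable_fubini_G fi.
rewrite [leLHS](_ : _ = \int[lam]_t `|fubini_G P (EFin \o f) t|)%E; last first.
  apply: ae_eq_integral_nonmeas; apply: (ae_imp (ae_integrable2 fi)) => t ft _ /=.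
  rewrite /fubini_G/= -[in RHS](fineK (integrable_fin_num _ ft))//.
apply: ge0_le_integral => //.
- exact: measurableT_comp.
- apply: (measurable_fun_fubini_tonelli_G (abse \o (EFin \o f))) => //=.
  by apply: measurableT_comp => //; exact: measurable_int fi.
- by move=> t _; apply: le_abse_integral => //; apply/measurable_EFinP;
    exact: measurableT_comp (rintegrable_meas fi) _.
Qed.

Lemma eq0_bmeas_coord (G : 'rV[R]_d -> R) : rintegrable P G ->
  (forall phi, Ccinf phi -> \int[P]_x (G x * phi (x ord0 s)) = 0) ->
  forall phi, bmeas (phi : measurableTypeR R -> R) -> \int[P]_x (G x * phi (x ord0 s)) = 0.
Proof.
move=> /Rintegral_coord[F Fi GF] G0 phi phib; rewrite GF//.
have : {ae (@lam R), forall t, F t = 0}.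
  by apply: ae_eq0_Ccinf => // eta Ceta; rewrite -GF ?G0//; exact: Ccinf_bmeas.
move=> F0; rewrite -[RHS](Rintegral0T lam); apply: ae_eq_Rintegral; apply: ae_eqT.
by apply: (ae_imp F0) => t ->; rewrite mul0r.
Qed.

End Swap.
End FundamentalLemma.

(** * Weak derivatives tested on tensor products *)

Section Brackets.
Context {R : realType} {d : nat}.
Local Notation P := (@cubeP R d).
Implicit Types (f g : 'rV[R]_d -> R) (psi : 'I_d -> R -> R) (s : 'I_d).

Definition tensor psi (x : 'rV[R]_d) := \prod_i psi i (x ord0 i).

Definition upd psi s (phi : R -> R) : 'I_d -> R -> R :=
  fun i => if i == s then phi else psi i.

Definition bracket f psi := \int[P]_x (f x * tensor psi x).

Definition allbmeas psi := forall i, bmeas (psi i : measurableTypeR R -> R).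

Lemma upd_id psi s : upd psi s (psi s) = psi.
Proof. by apply/funext => i; rewrite /upd; case: eqP => // ->. Qed.

Lemma upd_at psi s phi : upd psi s phi s = phi.
Proof. by rewrite /upd eqxx. Qed.

Lemma upd_ne psi s phi i : i != s -> upd psi s phi i = psi i.
Proof. by rewrite /upd => /negbTE ->. Qed.

Lemma upd_upd psi s phi eta : upd (upd psi s phi) s eta = upd psi s eta.
Proof. by apply/funext => i; rewrite /upd; case: eqP. Qed.

Lemma upd_comm psi s t phi eta : s != t ->
  upd (upd psi s phi) t eta = upd (upd psi t eta) s phi.
Proof.
move=> st; apply/funext => i; rewrite /upd; case: (i =P t) => [->|//].
by rewrite eq_sym (negbTE st).
Qed.

Lemma allbmeas_upd psi s phi : allbmeas psi -> bmeas (phi : measurableTypeR R -> R) ->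
  allbmeas (upd psi s phi).
Proof. by move=> pb phib i; rewrite /upd; case: ifP. Qed.

Lemma tensor_upd psi s phi x :
  tensor (upd psi s phi) x = phi (x ord0 s) * tensor (upd psi s (fun=> 1)) x.
Proof.
rewrite /tensor (bigD1 s)//= upd_at [in RHS](bigD1 s)//= upd_at mul1r.
by congr (_ * _); apply: eq_bigr => i /upd_ne E; rewrite !E.
Qed.

Lemma tensor_split psi s x :
  tensor psi x = psi s (x ord0 s) * tensor (upd psi s (fun=> 1)) x.
Proof. by rewrite -{1}(upd_id psi s) tensor_upd. Qed.

Lemma tensor_upd1_set_coord psi s x t :
  tensor (upd psi s (fun=> 1)) (set_coord x s t) = tensor (upd psi s (fun=> 1)) x.
Proof.
rewrite /tensor; apply: eq_bigr => i _; rewrite /upd set_coordE.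
by case: eqP.
Qed.

Lemma bmeas_tensor psi : allbmeas psi -> bmeas (tensor psi).
Proof.
move=> pb; apply: bmeas_prod => i _; apply: (bmeas_comp (pb i)).
exact: measurable_coord.
Qed.

Lemma bmeas_one : bmeas (fun _ : measurableTypeR R => 1 : R).
Proof. exact: bmeas_cst. Qed.

Lemma bracket_int f psi : rintegrable P f -> allbmeas psi ->
  rintegrable P (fun x => f x * tensor psi x).
Proof.
move=> fi pb; under [X in rintegrable _ X]eq_fun do rewrite mulrC.
by apply: bmeasM_int => //; exact: bmeas_tensor.
Qed.

Lemma bracketD f g psi : rintegrable P f -> rintegrable P g -> allbmeas psi ->
  bracket (fun x => f x + g x) psi = bracket f psi + bracket g psi.
Proof.
move=> fi gi pb; rewrite /bracket -RintegralDT; do ?exact: bracket_int.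
by apply: eq_Rintegral => x _; rewrite mulrDl.
Qed.

Lemma bracketZ c f psi : rintegrable P f -> allbmeas psi ->
  bracket (fun x => c * f x) psi = c * bracket f psi.
Proof.
move=> fi pb; rewrite /bracket -RintegralZT; last exact: bracket_int.
by apply: eq_Rintegral => x _; rewrite mulrA.
Qed.

Lemma bracketN f psi : rintegrable P f -> allbmeas psi ->
  bracket (fun x => - f x) psi = - bracket f psi.
Proof.
move=> fi pb; rewrite -mulN1r -bracketZ//.
by apply: eq_Rintegral => x _; rewrite mulN1r.
Qed.

Lemma bracketB f g psi : rintegrable P f -> rintegrable P g -> allbmeas psi ->
  bracket (fun x => f x - g x) psi = bracket f psi - bracket g psi.
Proof.
by move=> fi gi pb; rewrite bracketD ?bracketN//; exact: rintegrableN.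
Qed.

Lemma bracket0 psi : bracket (fun=> 0) psi = 0.
Proof.
by rewrite /bracket -[RHS](Rintegral0T P); apply: eq_Rintegral => x _; rewrite mul0r.
Qed.

Lemma ae_eq_bracket f g psi : {ae P, forall x, f x = g x} -> bracket f psi = bracket g psi.
Proof.
by move=> fg; apply: ae_eq_Rintegral; apply: ae_eqT; apply: filterS fg => x ->.
Qed.

Lemma bracket_updD f psi s (phi eta : R -> R) : rintegrable P f -> allbmeas psi ->
  bmeas (phi : measurableTypeR R -> R) -> bmeas (eta : measurableTypeR R -> R) ->
  bracket f (upd psi s (fun t => phi t + eta t)) =
  bracket f (upd psi s phi) + bracket f (upd psi s eta).
Proof.
move=> fi pb phib etab; rewrite /bracket -RintegralDT;
  do ?by apply: bracket_int => //; exact: allbmeas_upd.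
by apply: eq_Rintegral => x _; rewrite tensor_upd [tensor (upd _ _ phi) _]tensor_upd
  [tensor (upd _ _ eta) _]tensor_upd; ring.
Qed.

Lemma bracket_updZ f psi s c (phi : R -> R) : rintegrable P f -> allbmeas psi ->
  bmeas (phi : measurableTypeR R -> R) ->
  bracket f (upd psi s (fun t => c * phi t)) = c * bracket f (upd psi s phi).
Proof.
move=> fi pb phib; rewrite /bracket -RintegralZT;
  last by apply: bracket_int => //; exact: allbmeas_upd.
by apply: eq_Rintegral => x _; rewrite tensor_upd [tensor (upd _ _ phi) _]tensor_upd; ring.
Qed.

(** The indicator of a box is a tensor product of bounded measurable functions, and boxes form a
    generating pi-system. *)
Lemma ae_eq0_bracket f : rintegrable P f ->
  (forall psi, allbmeas psi -> bracket f psi = 0) -> {ae P, forall x, f x = 0}.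
Proof.
move=> fi f0.
have f0R (B : 'I_d -> set (measurableTypeR R)) : (forall i, measurable (B i)) ->
    \int[P]_(x in rectangle B) f x = 0.
  move=> mB; rewrite -(f0 (fun i => \1_(B i))); last first.
    move=> i; split; first exact: measurable_indic.
    by exists 1 => t; rewrite indicE; case: (_ \in _); rewrite ?normr1 ?normr0.
  rewrite Rintegral_mkcond; apply: eq_Rintegral => x _; rewrite patchE /tensor.
  case: ifPn => [|]; rewrite ?inE ?notin_setE => Bx.
    by rewrite big1 ?mulr1// => i _; rewrite indicE mem_set//; exact: Bx.
  have [i nBi] : exists i, ~ B i (x ord0 i).
    by apply: contrapT => /forallNP h; apply: Bx => i; exact: (contrapT (h i)).
  by rewrite (bigD1 i)//= indicE memNset ?mul0r ?mulr0.
apply: (@ae_eq0_pi_system _ _ _ _ (@rectangles R d)) => //.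
- exact: rectangles_generate.
- exact: rectangles_setI.
- by rewrite -(rectangleT d) f0R.
- by move=> _ [B mB ->]; exact: f0R.
Qed.

Lemma ae_eq_brackets f g : rintegrable P f -> rintegrable P g ->
  (forall psi, allbmeas psi -> bracket f psi = bracket g psi) ->
  {ae P, forall x, f x = g x}.
Proof.
move=> fi gi fg; have : {ae P, forall x, f x - g x = 0}.
  apply: ae_eq0_bracket; first exact: rintegrableB.
  by move=> psi pb; rewrite bracketB// fg// subrr.
by apply: filterS => x /eqP; rewrite subr_eq0 => /eqP.
Qed.

(* Test functions are replaced by bounded measurable ones, one coordinate of [A] at a time. *)
Lemma eq0_allbmeas (L : ('I_d -> R -> R) -> R) (A : pred 'I_d) :
  (forall i psi, A i -> allbmeas psi -> exists2 G, rintegrable P G &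
    forall phi, bmeas (phi : measurableTypeR R -> R) ->
      L (upd psi i phi) = \int[P]_x (G x * phi (x ord0 i))) ->
  (forall psi, allbmeas psi -> (forall i, A i -> Ccinf (psi i)) -> L psi = 0) ->
  forall psi, allbmeas psi -> L psi = 0.
Proof.
move=> LG L0.
suff H (r : seq 'I_d) psi : allbmeas psi ->
    (forall i, A i -> i \notin r -> Ccinf (psi i)) -> L psi = 0.
  by move=> psi pb; apply: (H (enum 'I_d)) => // i _; rewrite mem_enum.
elim: r psi => [|i r IH] psi pb pC; first by apply: L0 => // i Ai; exact: pC.
have [Ai|nAi] := boolP (A i); last first.
  apply: IH => // j Aj jr; apply: pC => //; rewrite inE negb_or jr andbT.
  by apply: contraNneq nAi => <-.
have [G Gi GE] := LG i psi Ai pb.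
rewrite -(upd_id psi i) GE//; apply: eq0_bmeas_coord => // phi phiC.
rewrite -GE; last exact: Ccinf_bmeas.
apply: IH; first by apply: allbmeas_upd => //; exact: Ccinf_bmeas.
move=> j Aj jr; rewrite /upd; case: eqP => // /eqP ji.
by apply: pC => //; rewrite inE negb_or ji.
Qed.

Lemma bracket_upd_coord f psi s : rintegrable P f -> allbmeas psi ->
  exists2 G, rintegrable P G & forall phi : R -> R, bracket f (upd psi s phi) =
    \int[P]_x (G x * phi (x ord0 s)).
Proof.
move=> fi pb; exists (fun x => f x * tensor (upd psi s (fun=> 1)) x).
  by apply: bracket_int => //; apply: allbmeas_upd => //; exact: bmeas_one.
by move=> phi; apply: eq_Rintegral => x _; rewrite tensor_upd; ring.
Qed.

Lemma ae_eq_Ccinf f g : rintegrable P f -> rintegrable P g ->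
  (forall psi, (forall i, Ccinf (psi i)) -> bracket f psi = bracket g psi) ->
  {ae P, forall x, f x = g x}.
Proof.
move=> fi gi fg; apply: ae_eq_brackets => // psi pb.
apply/eqP; rewrite -subr_eq0 -bracketB//; apply/eqP.
have fgi : rintegrable P (fun x => f x - g x) by exact: rintegrableB.
apply: (eq0_allbmeas (A := predT)) pb => [i eta _ etab|eta etab etaC].
  have [G Gi GE] := bracket_upd_coord i fgi etab.
  by exists G => // phi _.
by rewrite bracketB// fg ?subrr// => i; exact: etaC.
Qed.

(* Weak derivative along [x_s], tested on tensor products only; the factors in the other variables
   may be any bounded measurable functions. *)
Definition wD s f g := forall psi, allbmeas psi -> Ccinf (psi s) ->
  bracket f (upd psi s (derive1 (psi s))) = - bracket g psi.

Lemma wD_Ccinf s f g : rintegrable P f -> rintegrable P g ->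
  (forall psi, (forall i, Ccinf (psi i)) ->
    bracket f (upd psi s (derive1 (psi s))) = - bracket g psi) ->
  wD s f g.
Proof.
move=> fi gi fg psi pb sC; have dC := Ccinf_derive sC.
set phi := psi s; pose L eta := bracket f (upd eta s (derive1 phi)) + bracket g (upd eta s phi).
suff : L psi = 0 by rewrite /L upd_id => /eqP; rewrite addr_eq0 => /eqP.
apply: (eq0_allbmeas (A := fun i => i != s)) pb => [i eta is_ etab|eta etab etaC].
  have [F Fi FE] := bracket_upd_coord i fi (allbmeas_upd s etab (Ccinf_bmeas dC)).
  have [G Gi GE] := bracket_upd_coord i gi (allbmeas_upd s etab (Ccinf_bmeas sC)).
  exists (fun x => F x + G x); first exact: rintegrableD.
  move=> chi chib; rewrite /L !(upd_comm _ _ _ is_) FE GE -RintegralDT.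
  - by apply: eq_Rintegral => x _; rewrite mulrDl.
  - under [X in rintegrable _ X]eq_fun do rewrite mulrC; apply: bmeasM_int => //.
    by apply: (bmeas_comp chib); exact: measurable_coord.
  - under [X in rintegrable _ X]eq_fun do rewrite mulrC; apply: bmeasM_int => //.
    by apply: (bmeas_comp chib); exact: measurable_coord.
have := fg (upd eta s phi); rewrite upd_upd upd_at /L => ->; first by rewrite addNr.
by move=> i; rewrite /upd; case: eqP => // /eqP; exact: etaC.
Qed.

End Brackets.

Lemma rintegrable_ae_dom d (T : measurableType d) (R : realType) (P : probability T R)
    (f g : T -> R) : measurable_fun setT f -> rintegrable P g ->
  {ae P, forall x, `|f x| <= g x} -> rintegrable P f.
Proof.
move=> mf gi fg; apply/integrableP; split; first exact/measurable_EFinP.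
case/integrableP : (rintegrable_norm gi) => /measurable_EFinP mg; apply: le_lt_trans.
rewrite [leRHS](_ : _ = \int[P]_x (`|g x|)%:E)%E; last first.
  by apply: eq_integral => x _ /=; rewrite normr_id.
apply: ae_ge0_le_integral => //.
- by do 2 apply: measurableT_comp => //.
- exact/measurable_EFinP.
- by apply: (ae_imp fg) => x h _ /=; rewrite lee_fin (le_trans h)// ler_norm.
Qed.

(** * Operators acting in one variable *)

Section DirectionalOperators.
Context {R : realType} {d : nat}.
Local Notation P := (@cubeP R d).
Implicit Types (f g h : 'rV[R]_d -> R) (s : 'I_d) (K : R -> R -> R).

Definition Kop s K f (x : 'rV[R]_d) : R :=
  kint K (fun u => f (set_coord x s u)) (x ord0 s).

Lemma Kop_line s K f x t :
  Kop s K f (set_coord x s t) = kint K (fun u => f (set_coord x s u)) t.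
Proof.
rewrite /Kop set_coordE eqxx; congr kint; apply/funext => u.
by rewrite set_coord_set.
Qed.

Lemma bkernel_shuffle s K : bkernel K ->
  bmeas (fun p : 'rV[R]_d * measurableTypeR R => K (p.1 ord0 s) p.2).
Proof.
move=> Kb; apply: (bmeas_comp (g := fun p : 'rV[R]_d * measurableTypeR R =>
  ((p.1 ord0 s : measurableTypeR R), p.2)) Kb).
apply/measurable_fun_pairP; split; last exact: measurable_snd.
by apply: (measurableT_comp (measurable_coord s)); exact: measurable_fst.
Qed.

Lemma sqr_kint_le K M (v : R -> R) t : bkernel K -> (forall p : R * R, `|K p.1 p.2| <= M) ->
  sqintegrable lam v -> kint K v t ^+ 2 <= M ^+ 2 * \int[lam]_u (v u ^+ 2).
Proof.
move=> Kb KM vi; have Ki : sqintegrable lam (fun u => K t u * v u).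
  by apply: bmeasM_sq => //; exact: bkernel_line.
apply: le_trans (sqr_Rintegral_le Ki) _.
rewrite -RintegralZT; last by case: vi.
apply: le_RintegralT; first by case: Ki.
  by apply: rintegrableZ; case: vi.
move=> u; rewrite exprMn ler_wpM2r ?sqr_ge0//.
by rewrite -real_normK ?num_real// lerXn2r ?nnegrE ?(KM (t, u))//
  (le_trans _ (KM (t, u))).
Qed.

Lemma Kop_sqintegrable s K f : bkernel K -> sqintegrable P f -> sqintegrable P (Kop s K f).
Proof.
move=> Kb fi; have fi1 := sqintegrable_int fi.
have mK : measurable_fun setT (Kop s K f).
  apply: (@measurable_Rfubini _ _ _ _ _ P lam
    (fun p => K (p.1 ord0 s) p.2 * f (set_coord p.1 s p.2))).
  by apply: bmeasM_int; [exact: bkernel_shuffle|exact: rintegrable_shuffle].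
split => //; have [_ [M KM]] := Kb; have [_ fi2] := fi.
apply: (rintegrable_ae_dom _ (rintegrableZ (M ^+ 2) (rintegrable_resample s fi2))).
  exact: measurable_funX.
apply: (ae_imp (ae_sqintegrable_line s fi)) => x fx.
by rewrite ger0_norm ?sqr_ge0//; exact: sqr_kint_le.
Qed.

Lemma bracket_Kop s K f psi : bkernel K -> sqintegrable P f -> allbmeas psi ->
  bracket (Kop s K f) psi = bracket f (upd psi s (kintT K (psi s))).
Proof.
move=> Kb fi pb; have fi1 := sqintegrable_int fi.
have Tb : bmeas (kintT K (psi s) : measurableTypeR R -> R).
  by apply: bmeas_kintT => //; exact: bmeas_int (pb s).
rewrite /bracket.
apply: (@eq_Rintegral_lines R d s (fun x => Kop s K f x * tensor psi x)
  (fun x => f x * tensor (upd psi s (kintT K (psi s))) x)).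
- by apply: bracket_int => //; apply: sqintegrable_int; exact: Kop_sqintegrable.
- by apply: bracket_int => //; exact: allbmeas_upd.
apply: (ae_imp (ae_rintegrable_line s fi1)) => x fx.
set c := tensor (upd psi s (fun=> 1)) x.
transitivity (\int[lam]_t (c * (psi s t * kint K (fun u => f (set_coord x s u)) t))).
  apply: eq_Rintegral => t _; rewrite Kop_line (tensor_split psi s) set_coordE eqxx.
  by rewrite tensor_upd1_set_coord -/c; ring.
rewrite RintegralZT; last first.
  by apply: bmeasM_int => //; apply: bmeas_int; exact: bmeas_kint.
rewrite kint_dual// -RintegralZT; last exact: bmeasM_int.
apply: eq_Rintegral => t _; rewrite tensor_upd set_coordE eqxx.
by rewrite tensor_upd1_set_coord -/c; ring.
Qed.

(* An operator in the variable [x_s] is known through its transpose, acting on bounded functions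
   of one variable; this is all that commuting with operators and weak derivatives in the other
   variables requires. *)
Definition sop s (T : ('rV[R]_d -> R) -> 'rV[R]_d -> R) :=
  (forall f, sqintegrable P f -> sqintegrable P (T f)) /\
  exists Tt : (R -> R) -> R -> R,
    (forall phi, bmeas (phi : measurableTypeR R -> R) -> bmeas (Tt phi : measurableTypeR R -> R)) /\
    forall f psi, sqintegrable P f -> allbmeas psi ->
      bracket (T f) psi = bracket f (upd psi s (Tt (psi s))).

Lemma sop_Kop s K : bkernel K -> sop s (Kop s K).
Proof.
move=> Kb; split; first by move=> f; exact: Kop_sqintegrable.
exists (kintT K); split; last by move=> f psi; exact: bracket_Kop.
by move=> phi /(bmeas_int lam); exact: bmeas_kintT.
Qed.

Lemma sop_comp s T U : sop s T -> sop s U -> sop s (fun f => T (U f)).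
Proof.
move=> [Ts [Tt [Tb TE]]] [Us [Ut [Ub UE]]]; split; first by move=> f /Us /Ts.
exists (fun phi => Ut (Tt phi)); split; first by move=> phi /Tb /Ub.
move=> f psi fi pb; rewrite TE ?UE//; last exact: Us.
- by rewrite upd_at upd_upd.
- by apply: allbmeas_upd => //; exact: Tb.
Qed.

Lemma sop_add s T U : sop s T -> sop s U -> sop s (fun f x => T f x + U f x).
Proof.
move=> [Ts [Tt [Tb TE]]] [Us [Ut [Ub UE]]]; split.
  by move=> f fi; apply: sqintegrableD; [exact: Ts|exact: Us].
exists (fun phi t => Tt phi t + Ut phi t); split.
  by move=> phi phib; apply: bmeasD; [exact: Tb|exact: Ub].
move=> f psi fi pb; have fi1 := sqintegrable_int fi.
rewrite bracketD//; do ?by apply: sqintegrable_int; do ?[exact: Ts|exact: Us].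
by rewrite TE// UE// bracket_updD//; [exact: Tb|exact: Ub].
Qed.

Lemma sop_opp s T : sop s T -> sop s (fun f x => - T f x).
Proof.
move=> [Ts [Tt [Tb TE]]]; split; first by move=> f /Ts; exact: sqintegrableN.
exists (fun phi t => - 1 * Tt phi t); split.
  by move=> phi /Tb phib; apply: bmeasM => //; exact: bmeas_cst.
move=> f psi fi pb; have fi1 := sqintegrable_int fi.
rewrite bracketN// ?bracket_updZ ?mulN1r ?TE//; first exact: Tb.
by apply: sqintegrable_int; exact: Ts.
Qed.

Lemma sop_sub s T U : sop s T -> sop s U -> sop s (fun f x => T f x - U f x).
Proof. by move=> Ts /sop_opp; exact: sop_add. Qed.

Lemma sop_zero s : sop s (fun _ _ => 0).
Proof.
split; first by move=> f _; exact: sqintegrable_cst.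
exists (fun _ _ => 0); split; first by move=> *; exact: bmeas_cst.
move=> f psi fi pb; rewrite bracket0 /bracket -[LHS](Rintegral0T P).
by apply: eq_Rintegral => x _; rewrite tensor_upd mul0r mulr0.
Qed.

Section SopTheory.
Variables (s : 'I_d) (T : ('rV[R]_d -> R) -> 'rV[R]_d -> R).
Hypothesis Ts : sop s T.

Lemma sop_sq f : sqintegrable P f -> sqintegrable P (T f).
Proof. by case: Ts => h _; exact: h. Qed.

Lemma sop_int f : sqintegrable P f -> rintegrable P (T f).
Proof. by move=> fi; apply: sqintegrable_int; exact: sop_sq. Qed.

Lemma sop_ae f g : sqintegrable P f -> sqintegrable P g ->
  {ae P, forall x, f x = g x} -> {ae P, forall x, T f x = T g x}.
Proof.
move=> fi gi fg; apply: ae_eq_brackets; do ?exact: sop_int.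
by case: Ts => _ [Tt [Tb TE]] psi pb; rewrite !TE//; exact: ae_eq_bracket.
Qed.

Lemma sopD f g : sqintegrable P f -> sqintegrable P g ->
  {ae P, forall x, T (fun x => f x + g x) x = T f x + T g x}.
Proof.
move=> fi gi; apply: ae_eq_brackets.
- by apply: sop_int; exact: sqintegrableD.
- by apply: rintegrableD; exact: sop_int.
case: (Ts) => _ [Tt [Tb TE]] psi pb; rewrite TE//; last exact: sqintegrableD.
have ub : allbmeas (upd psi s (Tt (psi s))) by apply: allbmeas_upd => //; exact: Tb.
by rewrite bracketD//; do ?exact: sqintegrable_int; rewrite bracketD ?TE//; exact: sop_int.
Qed.

Lemma sopZ c f : sqintegrable P f -> {ae P, forall x, T (fun x => c * f x) x = c * T f x}.
Proof.
move=> fi; apply: ae_eq_brackets.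
- by apply: sop_int; exact: sqintegrableZ.
- by apply: rintegrableZ; exact: sop_int.
case: (Ts) => _ [Tt [Tb TE]] psi pb; rewrite TE//; last exact: sqintegrableZ.
have ub : allbmeas (upd psi s (Tt (psi s))) by apply: allbmeas_upd => //; exact: Tb.
by rewrite bracketZ//; do ?exact: sqintegrable_int; rewrite bracketZ ?TE//; exact: sop_int.
Qed.

Lemma sop_0 : {ae P, forall x, T (fun=> 0) x = 0}.
Proof.
have i0 := sqintegrable_cst P 0.
apply: ae_eq_brackets; [exact: sop_int|exact: rintegrable0|].
by case: Ts => _ [Tt [Tb TE]] psi pb; rewrite TE// !bracket0.
Qed.

Lemma sop_sum I (r : seq I) (Q : pred I) (F : I -> 'rV[R]_d -> R) :
  (forall i, Q i -> sqintegrable P (F i)) ->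
  {ae P, forall x, T (fun x => \sum_(i <- r | Q i) F i x) x = \sum_(i <- r | Q i) T (F i) x}.
Proof.
move=> FP; elim: r => [|i r IH].
  have -> : (fun x => \sum_(i <- [::] | Q i) F i x) = (fun=> 0).
    by apply/funext => x; rewrite big_nil.
  by apply: (ae_imp sop_0) => x ->; rewrite big_nil.
have -> : (fun x => \sum_(j <- i :: r | Q j) F j x) =
    (fun x => if Q i then F i x + \sum_(j <- r | Q j) F j x else \sum_(j <- r | Q j) F j x).
  by apply/funext => x; rewrite big_cons.
case: (boolP (Q i)) => Qi; last first.
  by apply: (ae_imp IH) => x ->; rewrite big_cons (negbTE Qi).
have := sopD (FP i Qi) (sqintegrable_sum r FP) => h.
by apply: (ae_imp2 h IH) => x -> ->; rewrite big_cons Qi.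
Qed.

(** The transpose of T replaces the factor in x_s by another bounded measurable function, possibly
    discontinuous, and leaves alone the factor in x_t that is differentiated. This is what dictates
    the class of factors in [wD]. *)
Lemma wD_sop t f g : s != t -> sqintegrable P f -> sqintegrable P g ->
  wD t f g -> wD t (T f) (T g).
Proof.
case: Ts => _ [Tt [Tb TE]] st fi gi fg psi pb pC.
have db := Ccinf_bmeas (Ccinf_derive pC).
rewrite !TE//; last exact: allbmeas_upd.
rewrite upd_ne// upd_comm 1?eq_sym//.
have := fg (upd psi s (Tt (psi s))); rewrite upd_ne 1?eq_sym//; apply => //.
by apply: allbmeas_upd => //; exact: Tb.
Qed.

End SopTheory.

(** The transposes modify different factors of a tensor product, hence commute whatever the
    operators are; tensor products determine the function almost everywhere. *)
Lemma sop_comm s t T U f : s != t -> sop s T -> sop t U -> sqintegrable P f ->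
  {ae P, forall x, T (U f) x = U (T f) x}.
Proof.
move=> st Ts Us fi; have Ti := sop_sq Ts fi; have Ui := sop_sq Us fi.
apply: ae_eq_brackets; [exact: (sop_int Ts)|exact: (sop_int Us)|].
case: (Ts) (Us) => _ [Tt [Tb TE]] [_ [Ut [Ub UE]]] psi pb.
rewrite TE// UE//; last by apply: allbmeas_upd => //; exact: Tb.
rewrite [RHS]UE// [RHS]TE//; last by apply: allbmeas_upd => //; exact: Ub.
by rewrite !upd_ne// 1?eq_sym// upd_comm.
Qed.

Lemma wD_ae s f f' g g' : {ae P, forall x, f x = f' x} -> {ae P, forall x, g x = g' x} ->
  wD s f g -> wD s f' g'.
Proof.
by move=> ff gg fg psi pb pC; rewrite -(ae_eq_bracket _ ff) -(ae_eq_bracket _ gg); exact: fg.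
Qed.

Lemma wD_unique s f g h : rintegrable P g -> rintegrable P h -> wD s f g -> wD s f h ->
  {ae P, forall x, g x = h x}.
Proof.
move=> gi hi fg fh; apply: ae_eq_Ccinf => // psi pC.
have pb : allbmeas psi by move=> i; exact: Ccinf_bmeas.
by apply: oppr_inj; rewrite -fg// -fh.
Qed.

Lemma wDD s f f' g g' : rintegrable P f -> rintegrable P f' ->
  rintegrable P g -> rintegrable P g' -> wD s f g -> wD s f' g' ->
  wD s (fun x => f x + f' x) (fun x => g x + g' x).
Proof.
move=> fi fi' gi gi' fg fg' psi pb pC.
have db := Ccinf_bmeas (Ccinf_derive pC).
by rewrite !bracketD// ?fg ?fg'// ?opprD//; exact: allbmeas_upd.
Qed.

Lemma wDZ s c f g : rintegrable P f -> rintegrable P g -> wD s f g ->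
  wD s (fun x => c * f x) (fun x => c * g x).
Proof.
move=> fi gi fg psi pb pC; have db := Ccinf_bmeas (Ccinf_derive pC).
by rewrite !bracketZ// ?fg ?mulrN//; exact: allbmeas_upd.
Qed.

Lemma wDN s f g : rintegrable P f -> rintegrable P g -> wD s f g ->
  wD s (fun x => - f x) (fun x => - g x).
Proof.
move=> fi gi fg psi pb pC; have db := Ccinf_bmeas (Ccinf_derive pC).
by rewrite !bracketN// ?fg//; exact: allbmeas_upd.
Qed.

Lemma wDB s f f' g g' : rintegrable P f -> rintegrable P f' ->
  rintegrable P g -> rintegrable P g' -> wD s f g -> wD s f' g' ->
  wD s (fun x => f x - f' x) (fun x => g x - g' x).
Proof.
move=> fi fi' gi gi' fg fg'; apply: wDD => //; do ?exact: rintegrableN.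
exact: wDN.
Qed.

Lemma wD0 s : wD s (fun _ : 'rV[R]_d => 0) (fun=> 0).
Proof. by move=> psi _ _; rewrite !bracket0 oppr0. Qed.

Lemma wD_sum s I (r : seq I) (Q : pred I) (F G : I -> 'rV[R]_d -> R) :
  (forall i, Q i -> rintegrable P (F i)) -> (forall i, Q i -> rintegrable P (G i)) ->
  (forall i, Q i -> wD s (F i) (G i)) ->
  wD s (fun x => \sum_(i <- r | Q i) F i x) (fun x => \sum_(i <- r | Q i) G i x).
Proof.
move=> Fi Gi FG; elim: r => [|i r IH].
  have E (H : I -> 'rV[R]_d -> R) : (fun x => \sum_(i <- [::] | Q i) H i x) = (fun=> 0).
    by apply/funext => x; rewrite big_nil.
  by rewrite !E; exact: wD0.
have E (H : I -> 'rV[R]_d -> R) : (fun x => \sum_(j <- i :: r | Q j) H j x) =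
    (fun x => if Q i then H i x + \sum_(j <- r | Q j) H j x else \sum_(j <- r | Q j) H j x).
  by apply/funext => x; rewrite big_cons.
rewrite !E; case: (boolP (Q i)) => // Qi; apply: wDD; do ?[exact: rintegrable_sum|exact: Fi|exact: Gi|exact: FG|exact: IH].
Qed.

End DirectionalOperators.

(** * Antiderivatives of one-variable test functions *)

Section Antiderivatives.
Context {R : realType}.
Local Notation leb := (@lebesgue_measure R).

(** The kernel of v -> int_0^t v. Its transpose, [tail], is phi -> int_u^1 phi for u in [0, 1]. *)
Definition stepk (t u : R) : R := (u < t)%R%:R.

Lemma bkernel_stepk : bkernel stepk.
Proof.
split; last by exists 1 => p; rewrite /stepk; case: (_ < _); rewrite ?normr1 ?normr0.
have -> : (fun p : measurableTypeR R * measurableTypeR R => stepk p.1 p.2) =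
    \1_[set p : measurableTypeR R * measurableTypeR R | (p.2 < p.1)%R].
  by apply/funext => p; rewrite indicE /stepk; congr (nat_of_bool _)%:R;
    apply/idP/idP; rewrite inE.
apply: measurable_indic; rewrite -[X in measurable X]setTI.
have := @measurable_fun_ltr _ (measurableTypeR R * measurableTypeR R)%type R setT
  (fun p => p.2) (fun p => p.1).
move=> /(_ (measurable_snd) (measurable_fst) measurableT [set true]) /=.
by apply.
Qed.

Definition tail (phi : R -> R) : R -> R := kintT stepk phi.

Lemma tail_ge1 phi u : 1 <= u -> tail phi u = 0.
Proof.
move=> u1; rewrite -[RHS](Rintegral0T lam); apply: ae_eq_Rintegral; apply: ae_eqT.
apply: (ae_imp ae_lam_itv) => t /andP[_ t1].
by rewrite /stepk ltNge (le_trans (ltW t1) u1) mul0r.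
Qed.

Lemma tail_le0 phi u : u <= 0 -> tail phi u = \int[lam]_t phi t.
Proof.
move=> u0; apply: ae_eq_Rintegral; apply: ae_eqT.
apply: (ae_imp ae_lam_itv) => t /andP[t0 _].
by rewrite /stepk (le_lt_trans u0 t0) mul1r.
Qed.

Lemma tailE phi u : rintegrable lam phi ->
  tail phi u = \int[lam]_t phi t - \int[lam]_t (phi t * (t <= u)%R%:R).
Proof.
move=> phii; rewrite -RintegralBT//.
  apply: eq_Rintegral => t _; rewrite /stepk ltNge.
  by case: (t <= u); rewrite /= ?mul0r ?mulr1 ?subrr ?mul1r ?mulr0 ?subr0.
apply: (rintegrable_dom _ (rintegrable_norm phii)).
  apply: measurable_funM; first exact: rintegrable_meas phii.
  have -> : (fun t : measurableTypeR R => (t <= u)%R%:R : R) = \1_`]-oo, u].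
    by apply/funext => t; rewrite indicE; congr (nat_of_bool _)%:R;
      apply/idP/idP; rewrite inE /= in_itv.
  by apply: measurable_indic; exact: measurable_itv.
move=> t; rewrite normrM; case: (t <= u); rewrite ?normr1 ?mulr1// normr0 mulr0.
exact: normr_ge0.
Qed.

Lemma hasder_tail phi u : Ccinf phi -> hasder (tail phi) u (- phi u).
Proof.
move=> phiC; have phii := bmeas_int lam (Ccinf_bmeas phiC).
have [u0|u0] := ltP u 0.
  rewrite (Ccinf_out phiC) ?negb_and -?leNgt ?(ltW u0)// oppr0.
  apply: (@hasder_near _ (fun=> \int[lam]_t phi t)); last exact: hasder_cst.
  by near=> z; rewrite tail_le0//; apply/ltW; near: z; exact: lt_nbhsl.
have [u1|u1] := ltP 1 u.
  rewrite (Ccinf_out phiC) ?negb_and -?leNgt ?(ltW u1) ?orbT// oppr0.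
  apply: (@hasder_near _ (fun=> 0)); last exact: hasder_cst.
  by near=> z; rewrite tail_ge1//; apply/ltW; near: z; exact: lt_nbhsr.
(* The interval from -1 to 2 has 0 and 1 in its interior, so the fundamental theorem applies at
   every remaining u, endpoints included. *)
pose F x := \int[leb]_(t in `[-1, x]) phi t.
have u2 : u < 2 by rewrite (le_lt_trans u1)// ltr1n.
have lebi : leb.-integrable `[-1, 2] (EFin \o phi).
  apply: continuous_compact_integrable; first exact: segment_compact.
  by apply: continuous_subspaceT; exact: Ccinf_continuous.
have [] := @continuous_FTC1_closed R phi (-1) u 2 u2 lebi.
- by rewrite (lt_le_trans _ u0)// oppr_lt0.
- exact: Ccinf_continuous.
rewrite -/F => dF F'.
have hF : hasder F u (phi u) by rewrite -F'; exact: derivable_hasder.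
have := hasderD (hasder_cst (\int[lam]_t phi t) u) (hasderN hF).
rewrite add0r; apply: hasder_near; near=> z.
rewrite tailE//; congr (_ - _); rewrite /F Rintegral_mrestr Rintegral_mkcond [RHS]Rintegral_mkcond.
apply: eq_Rintegral => t _; rewrite !patchE.
have [t01|t01] := boolP (0 < t < 1); last first.
  by rewrite (Ccinf_out phiC t01) mul0r; case: ifP => _; case: ifP.
case/andP: (t01) => t0 t1.
rewrite !mem_setE !in_itv/= t01 (_ : -1 <= t); last by rewrite (le_trans _ (ltW t0))// oppr_le0.
by case: (t <= z); rewrite ?mulr1 ?mulr0.
Unshelve. all: by end_near. Qed.

Lemma tail_derive phi u : Ccinf phi -> tail (derive1 phi) u = - phi u.
Proof.
move=> phiC; have dC := Ccinf_derive phiC.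
have h z : hasder (fun z => tail (derive1 phi) z + phi z) z 0.
  have := hasderD (hasder_tail z dC) (csmooth_hasder z (proj1 phiC)).
  by rewrite addNr.
have := @is_derive_0_is_cst R _ u 2 h => /=.
rewrite (tail_ge1 _ (ler1n _ 2)) (@Ccinf_out _ phi 2)//; last first.
  by rewrite negb_and -!leNgt ler1n orbT.
by move=> /eqP; rewrite addr0 addr_eq0 => /eqP.
Qed.

Lemma Rintegral_derive_Ccinf (phi : R -> R) : Ccinf phi -> \int[lam]_t derive1 phi t = 0.
Proof.
move=> phiC; rewrite -(tail_le0 _ (lexx 0)) tail_derive//.
by rewrite (Ccinf_out phiC) ?oppr0// ltxx.
Qed.

(** Otherwise, by rescaling, every test function would have integral 0, and the fundamental lemma
    would make the constant 1 vanish almost everywhere. *)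
Lemma exists_mollifier : exists rho : R -> R, Ccinf rho /\ \int[lam]_t rho t = 1.
Proof.
apply: contrapT => /forallNP h.
have z (phi : R -> R) : Ccinf phi -> \int[lam]_t phi t = 0.
  move=> phiC; apply: contrapT => /eqP n0.
  apply: (h (fun t => (\int[lam]_t phi t)^-1 * phi t)); split; first exact: CcinfZ.
  by rewrite RintegralZT ?mulVf//; exact: bmeas_int (Ccinf_bmeas phiC).
have := @ae_eq0_Ccinf R (fun=> 1) (rintegrable_cst lam 1).
move=> []; first by move=> phi phiC; under eq_Rintegral do rewrite mul1r; exact: z.
move=> N [mN N0 sN]; have : lam setT = 0%E :> \bar R.
  apply: (subset_measure0 _ mN _ N0) => // t _; apply: sN => /=.
  by apply/eqP; rewrite oner_neq0.
by rewrite [LHS]lam_setT => /eqP; rewrite onee_eq0.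
Qed.

Definition rho := projT1 (cid exists_mollifier).

Lemma Ccinf_rho : Ccinf rho.
Proof. by rewrite /rho; case: cid => r []. Qed.

Lemma Rintegral_rho : \int[lam]_t rho t = 1.
Proof. by rewrite /rho; case: cid => r []. Qed.

(** The tail of phi vanishes near 1 but equals int phi near 0; subtracting int phi times the tail of
    [rho] repairs this. Thus phi is a multiple of [rho] plus the derivative of a test function. *)
Lemma Ccinf_tail phi : Ccinf phi ->
  Ccinf (fun u => tail phi u - (\int[lam]_t phi t) * tail rho u).
Proof.
move=> phiC; have rC := Ccinf_rho; set c := \int[lam]_t phi t.
have h u : hasder (fun u => tail phi u - c * tail rho u) u (- phi u + c * rho u).
  have := hasderD (hasder_tail u phiC) (hasderM (hasder_cst (- c) u) (hasder_tail u rC)).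
  rewrite mulr0 addr0 mulrNN; congr (hasder _ u _).
  by apply/funext => z; rewrite mulNr.
split.
  case=> [|n]; first exact: nderivable0 h.
  apply: nderivableS h _; apply: nderivableD.
    under eq_fun do rewrite -mulN1r.
    by apply: nderivableM; [exact: nderivable_cst|case: phiC].
  by apply: nderivableM; [exact: nderivable_cst|case: rC].
have tail_right (eta : R -> R) b u : (forall x, b < x -> eta x = 0) -> b <= u -> tail eta u = 0.
  move=> e0 bu; rewrite -[RHS](Rintegral0T lam); apply: eq_Rintegral => t _.
  rewrite /stepk; case: ltP => ut; rewrite ?mul0r// mul1r e0//.
  exact: le_lt_trans ut.
have tail_left (eta : R -> R) a u : (forall x, x < a -> eta x = 0) -> u < a ->
    tail eta u = \int[lam]_t eta t.
  move=> e0 ua; apply: eq_Rintegral => t _; rewrite /stepk.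
  by case: ltP => ut; rewrite ?mul1r// mul0r e0// (le_lt_trans ut).
case: phiC rC => _ [a [b [a0 b1 pab]]] [_ [a' [b' [a0' b1' rab]]]].
exists (Num.min a a'), (Num.max b b'); split.
- by rewrite lt_min a0.
- by rewrite gt_max b1.
move=> u; rewrite negb_and -!ltNge => /orP[|]; rewrite ?lt_min ?gt_max => /andP[h1 h2].
  rewrite (tail_left phi a)// 1?(tail_left rho a')// ?Rintegral_rho ?mulr1 ?subrr//.
    by move=> x xa; apply: rab; rewrite negb_and -!ltNge xa.
  by move=> x xa; apply: pab; rewrite negb_and -!ltNge xa.
rewrite (tail_right phi b)// 1?(tail_right rho b')// ?ltW// ?mulr0 ?subrr//.
  by move=> x xa; apply: rab; rewrite negb_and -!ltNge xa orbT.
by move=> x xa; apply: pab; rewrite negb_and -!ltNge xa orbT.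
Qed.

End Antiderivatives.

(** * Recovering a function from its weak derivative in one variable *)

Section Representation.
Context {R : realType} {d : nat}.
Local Notation P := (@cubeP R d).
Implicit Types (f g h : 'rV[R]_d -> R) (s : 'I_d).

(** If v(t) = v(0) + int_0^t v', averaging against [rho] gives v(0) = int rho v - int (tail rho) v'.
    The kernels [rhok] and [tailk] are the two terms: the value at 0 is thereby expressed by
    operators bounded on L^2. *)
Definition rhok (t u : R) : R := rho u.
Definition tailk (t u : R) : R := - tail rho u.

Lemma bkernel_snd (phi : R -> R) : bmeas (phi : measurableTypeR R -> R) ->
  bkernel (fun _ u => phi u).
Proof. by move=> phib; apply: (bmeas_comp phib); exact: measurable_snd. Qed.

Lemma bkernel_rhok : bkernel rhok.
Proof. by apply: bkernel_snd; apply: Ccinf_bmeas; exact: Ccinf_rho. Qed.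

Lemma bkernel_tailk : bkernel tailk.
Proof.
apply: bkernel_snd; apply: bmeasN; apply: bmeas_kintT; first exact: bkernel_stepk.
by apply: bmeas_int; apply: Ccinf_bmeas; exact: Ccinf_rho.
Qed.

Lemma kintT_snd (eta phi : R -> R) u : rintegrable lam phi ->
  kintT (fun _ u => eta u) phi u = (\int[lam]_t phi t) * eta u.
Proof. by move=> phii; rewrite /kintT RintegralZT// mulrC. Qed.

Lemma wD_Kop_snd s (eta : R -> R) f : bmeas (eta : measurableTypeR R -> R) ->
  sqintegrable P f -> wD s (Kop s (fun _ u => eta u) f) (fun=> 0).
Proof.
move=> etab fi psi pb pC; have dC := Ccinf_derive pC.
rewrite bracket_Kop//; last 2 first.
- exact: bkernel_snd.
- by apply: allbmeas_upd => //; exact: Ccinf_bmeas.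
rewrite upd_at upd_upd bracket0 oppr0.
have -> : kintT (fun _ => eta) (derive1 (psi s)) = (fun t => 0 * (fun=> 1) t).
  apply/funext => u; rewrite kintT_snd; last by apply: bmeas_int; exact: Ccinf_bmeas.
  by rewrite Rintegral_derive_Ccinf// !mul0r.
rewrite bracket_updZ ?mul0r//; first exact: sqintegrable_int.
exact: bmeas_cst.
Qed.

Lemma wD_Kop_step s f : sqintegrable P f -> wD s (Kop s stepk f) f.
Proof.
move=> fi psi pb pC; have dC := Ccinf_derive pC; have fi1 := sqintegrable_int fi.
rewrite bracket_Kop//; last 2 first.
- exact: bkernel_stepk.
- by apply: allbmeas_upd => //; exact: Ccinf_bmeas.
rewrite upd_at upd_upd -[in RHS](upd_id psi s) -mulN1r -bracket_updZ//.
congr (bracket f (upd psi s _)); apply/funext => u.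
by rewrite mulN1r -tail_derive.
Qed.

(* The first two terms do not depend on [x_s]: they are the constant of integration on the line. *)
Lemma wD_antiderivative s f g : sqintegrable P f -> sqintegrable P g -> wD s f g ->
  {ae P, forall x, f x = Kop s rhok f x + Kop s tailk g x + Kop s stepk g x}.
Proof.
move=> fi gi fg; have fi1 := sqintegrable_int fi; have gi1 := sqintegrable_int gi.
have i1 := Kop_sqintegrable s bkernel_rhok fi.
have i2 := Kop_sqintegrable s bkernel_tailk gi.
have i3 := Kop_sqintegrable s bkernel_stepk gi.
apply: ae_eq_Ccinf => //.
  by apply: sqintegrable_int; do ?apply: sqintegrableD.
move=> psi pC; have pb : allbmeas psi by move=> i; exact: Ccinf_bmeas.
rewrite !bracketD//; do ?[exact: sqintegrable_int|
  by apply: sqintegrable_int; exact: sqintegrableD].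
rewrite !bracket_Kop//; do ?[exact: bkernel_rhok|exact: bkernel_tailk|exact: bkernel_stepk].
have phii : rintegrable lam (psi s) by apply: bmeas_int; exact: pb.
have tb (phi : R -> R) : rintegrable lam phi -> bmeas (tail phi : measurableTypeR R -> R).
  by move=> h; apply: bmeas_kintT => //; exact: bkernel_stepk.
have rhoi : rintegrable lam (@rho R) by apply: bmeas_int; apply: Ccinf_bmeas; exact: Ccinf_rho.
set c := \int[lam]_t psi s t.
pose Psi u := tail (psi s) u - c * tail rho u.
have PsiC : Ccinf Psi by exact: Ccinf_tail.
have rb : bmeas (@rho R : measurableTypeR R -> R) by apply: Ccinf_bmeas; exact: Ccinf_rho.
have HX : bracket f (upd psi s (kintT rhok (psi s))) = c * bracket f (upd psi s rho).
  have -> : kintT rhok (psi s) = (fun u => c * rho u).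
    by apply/funext => u; rewrite /rhok kintT_snd.
  exact: bracket_updZ.
have HAB : bracket g (upd psi s (kintT tailk (psi s))) + bracket g (upd psi s (kintT stepk (psi s))) =
    bracket g (upd psi s Psi).
  have <- : (fun t => kintT tailk (psi s) t + kintT stepk (psi s) t) = Psi.
    by apply/funext => u; rewrite /tailk kintT_snd// mulrN addrC.
  symmetry; apply: (bracket_updD s gi1 pb _ (tb _ phii)).
  by apply: bmeas_kintT => //; exact: bkernel_tailk.
have Psi' : derive1 Psi = (fun u => - 1 * psi s u + c * rho u).
  apply: derive1_fun => u.
  have := hasderD (hasder_tail u (pC s)) (hasderM (hasder_cst (- c) u) (hasder_tail u Ccinf_rho)).
  rewrite mulr0 addr0 mulrNN mulN1r; congr (hasder _ u _).
  by apply/funext => z; rewrite mulNr.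
have := fg (upd psi s Psi); rewrite upd_at upd_upd => /(_ _ PsiC) h.
have {h} := h (allbmeas_upd s pb (Ccinf_bmeas PsiC)).
rewrite Psi' (bracket_updD s fi1 pb); last 2 first.
- by apply: bmeasM => //; exact: bmeas_cst.
- by apply: bmeasM => //; exact: bmeas_cst.
rewrite (bracket_updZ s (-1) fi1 pb (pb s)) upd_id mulN1r (bracket_updZ s c fi1 pb rb) => h.
rewrite -addrA; apply: esym; apply: etrans (congr2 +%R HX HAB) _.
by rewrite -[bracket g _]opprK -h opprD opprK addrCA addrN addr0.
Qed.

End Representation.

(** * One-dimensional interpolation *)

Section Cells.
Context {R : realType}.
Local Notation leb := (@lebesgue_measure R).
Implicit Types (m i : nat) (p q r : {poly R}) (v e : R -> R).

Lemma node_ge0 m i : 0 <= node R m i.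
Proof. by rewrite divr_ge0. Qed.

Lemma node0 m : node R m 0 = 0.
Proof. by rewrite /node mul0r. Qed.

Lemma node_last m : node R m (2 ^ m) = 1.
Proof. by rewrite /node natrX divff. Qed.

Lemma nodeS m i : node R m i.+1 = node R m i + 2^-1 ^+ m.
Proof. by rewrite /node -natr1 mulrDl mul1r exprVn. Qed.

Lemma le_node m i j : (i <= j)%N -> node R m i <= node R m j.
Proof. by move=> ij; rewrite ler_wpM2r// ler_nat. Qed.

Lemma lt_nodeS m i : node R m i < node R m i.+1.
Proof. by rewrite nodeS ltrDl exprn_gt0. Qed.

Lemma node_le1 m i : (i <= 2 ^ m)%N -> node R m i <= 1.
Proof. by move=> im; rewrite -(node_last m) le_node. Qed.

(** Half-open cells partition [0, 1) exactly, so sums over cells telescope with no correction at the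
    nodes. *)
Definition cellind m i (t : R) : R := (node R m i <= t < node R m i.+1)%R%:R.

Lemma cellindE m i t : cellind m i t = (node R m i <= t)%R%:R - (node R m i.+1 <= t)%R%:R.
Proof.
rewrite /cellind; case: (ltP t (node R m i.+1)) => h; rewrite ?andbT ?andbF ?subr0//.
by rewrite (le_trans (ltW (lt_nodeS m i)) h) subrr.
Qed.

Lemma sum_cellind m n t : \sum_(i < n) cellind m i t = (0 <= t)%R%:R - (node R m n <= t)%R%:R.
Proof.
elim: n => [|n IH]; first by rewrite big_ord0 node0 subrr.
by rewrite big_ord_recr/= IH cellindE addrA subrK.
Qed.

Lemma sum_cellind1 m t : 0 <= t < 1 -> \sum_(i < 2 ^ m) cellind m i t = 1.
Proof. by move=> /andP[t0 t1]; rewrite sum_cellind node_last t0 leNgt t1 subr0. Qed.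

Lemma cellind_sq m i t : cellind m i t * cellind m i t = cellind m i t.
Proof. by rewrite /cellind -natrM mulnb andbb. Qed.

Lemma cellind_neq0 m i j t : cellind m i t != 0 -> cellind m j t != 0 -> i = j.
Proof.
rewrite /cellind !pnatr_eq0 !eqb0 !negbK => /andP[i1 i2] /andP[j1 j2].
apply/eqP; rewrite eqn_leq leqNgt [X in _ && X]leqNgt; apply/andP; split; apply/negP => h.
  by have := le_node m h; rewrite leNgt (le_lt_trans i1 j2).
by have := le_node m h; rewrite leNgt (le_lt_trans j1 i2).
Qed.

Lemma cellind_mul m i j t : i != j -> cellind m i t * cellind m j t = 0.
Proof.
move=> ij; have [->|i0] := eqVneq (cellind m i t) 0; first by rewrite mul0r.
have [->|j0] := eqVneq (cellind m j t) 0; first by rewrite mulr0.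
by rewrite (cellind_neq0 i0 j0) eqxx in ij.
Qed.

Lemma cellind_ge0 m i t : 0 <= cellind m i t.
Proof. exact: ler0n. Qed.

Lemma cellind_in m i t : cellind m i t != 0 -> node R m i <= t < node R m i.+1.
Proof. by rewrite /cellind pnatr_eq0 eqb0 negbK. Qed.

Lemma cellind1 m i t : node R m i <= t < node R m i.+1 -> cellind m i t = 1.
Proof. by rewrite /cellind => ->. Qed.

Lemma cellind_congr m i t (x y : R) : (node R m i <= t < node R m i.+1 -> x = y) ->
  cellind m i t * x = cellind m i t * y.
Proof.
rewrite /cellind; case: (_ <= _ < _) => h; last by rewrite !mul0r.
by rewrite h.
Qed.

Lemma bmeas_cellind m i : bmeas (cellind m i : measurableTypeR R -> R).
Proof.
split; last by exists 1 => t; rewrite /cellind; case: (_ <= _ < _); rewrite ?normr1 ?normr0.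
have -> : cellind m i = \1_`[node R m i, node R m i.+1[.
  by apply/funext => t; rewrite indicE /cellind; congr (nat_of_bool _)%:R;
    apply/idP/idP; rewrite inE /= in_itv.
by apply: measurable_indic; exact: measurable_itv.
Qed.

Lemma measurable_horner p : measurable_fun setT (fun t : R => p.[t]).
Proof. by apply: continuous_measurable_fun; exact: continuous_horner. Qed.

Lemma bmeas_cellpoly m i p : bmeas (fun t : measurableTypeR R => cellind m i t * p.[t]).
Proof.
split; first by apply: measurable_funM; [case: (bmeas_cellind m i)|exact: measurable_horner].
have cf : {within `[node R m i, node R m i.+1], continuous (fun x => `|p.[x]|)}.
  apply: continuous_subspaceT => x; apply: continuous_comp; last exact: norm_continuous.
  exact: continuous_horner.
have [c _ fc] := EVT_max (ltW (lt_nodeS m i)) cf; exists `|p.[c]| => t.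
rewrite /cellind; have [/andP[t1 t2]|_] := boolP (_ <= _ < _); last by rewrite mul0r normr0.
by rewrite mul1r; apply: fc; rewrite in_itv/= t1 ltW.
Qed.

Lemma lam_itv (c d : R) : 0 <= c -> d <= 1 -> c <= d -> lam `]c, d[ = (d - c)%:E.
Proof.
move=> c0 d1 cd; rewrite /lam /mrestr setIidl; last first.
  by apply: subset_itv; rewrite bnd_simp.
rewrite lebesgue_measure_itv/= lte_fin; case: ltgtP cd => // -> _.
by rewrite subrr.
Qed.

Lemma ae_eq0_continuous (f : R -> R) (a b : R) : 0 <= a -> b <= 1 ->
  {ae (@lam R), forall t, a < t < b -> f t = 0} ->
  (forall t, a < t < b -> {for t, continuous f}) ->
  forall t, a < t < b -> f t = 0.
Proof.
move=> a0 b1 [N [mN N0 fN]] cf t tab; apply: contrapT => /eqP ft0.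
have [e e0 he] : exists2 e : R, 0 < e & forall u, `|t - u| < e -> f u != 0.
  have nf : 0 < `|f t| by rewrite normr_gt0.
  have /cvgrPdist_lt/(_ _ nf) := cf t tab.
  case/nbhs_ballP => e e0 he; exists e => // u tu.
  apply/eqP => fu0; have := he u tu; rewrite fu0 subr0 ltxx => //.
have [/andP[ta tb]] := tab.
pose c := Num.max a (t - e); pose d := Num.min b (t + e).
have ct : c < t by rewrite gt_max ta ltrBlDr ltrDl.
have td : t < d by rewrite lt_min tb ltrDl.
have cd := lt_trans ct td.
have : lam (`]c, d[%classic : set (measurableTypeR R)) = 0%E.
  apply/eqP; rewrite -measure_le0 -[X in (_ <= X)%E]N0; apply: le_measure; rewrite ?inE//.
  move=> u /=.
  rewrite in_itv/= gt_max lt_min => /andP[/andP[au tu] /andP[ub ut]].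
  apply: fN => /= h; have : f u != 0 by apply: he; rewrite ltr_distlC ltrBlDr -ltrBlDr tu.
  by rewrite h ?eqxx// au.
rewrite lam_itv//; last 3 first.
- by rewrite le_max a0.
- by rewrite ge_min b1.
- exact: ltW.
by move=> [] /eqP; rewrite subr_eq0 gt_eqF.
Qed.

Lemma poly_eq0_itv p (a b : R) : a < b -> (forall t, a < t < b -> p.[t] = 0) -> p = 0.
Proof.
move=> ab p0; apply/eqP; apply: contraT => pn0.
(* These are [size p] distinct interior points, whereas a nonzero polynomial has fewer roots than
   its size. *)
pose n := size p; pose t (j : nat) : R := a + (b - a) * (j.+1%:R / n.+1%:R).
have tab j : (j < n)%N -> a < t j < b.
  move=> jn; have ba0 : 0 < b - a by rewrite subr_gt0.
  rewrite /t ltrDl mulr_gt0 ?divr_gt0//=.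
  rewrite -ltrBrDl -[ltRHS]mulr1 ltr_pM2l// ltr_pdivrMr// mul1r ltr_nat.
  by rewrite ltnS.
have := @max_poly_roots _ p [seq t j | j <- iota 0 n] pn0.
rewrite size_map size_iota ltnn => /(_ _ _) h; suff : false by [].
apply: h.
  by apply/allP => z /mapP[j]; rewrite mem_iota => /tab jab ->; apply/eqP; exact: p0.
rewrite map_inj_uniq ?iota_uniq// => j1 j2 /addrI /mulfI h.
have /h : b - a != 0 by rewrite subr_eq0 gt_eqF.
move=> /mulIf h2; have /h2 : n.+1%:R^-1 != 0 :> R by rewrite invr_eq0 pnatr_eq0.
by move=> /eqP; rewrite eqr_nat => /eqP[].
Qed.

Lemma poly_eq0_cell m i p : (i < 2 ^ m)%N ->
  \int[lam]_t (cellind m i t * p.[t] ^+ 2) = 0 -> p = 0.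
Proof.
move=> im p0.
pose f t : R := cellind m i t * p.[t] ^+ 2.
have fb : bmeas (f : measurableTypeR R -> R).
  have := bmeas_cellpoly m i (p ^+ 2); congr (bmeas _).
  by apply/funext => t; rewrite /f horner_exp.
have fi := bmeas_int lam fb.
have f0 t : 0 <= f t by rewrite mulr_ge0 ?cellind_ge0// sqr_ge0.
have : ae_eq lam setT (EFin \o f) (cst 0%E).
  apply/ae_eq_integral_abs => //; first exact: measurable_int fi.
  rewrite -[LHS]fineK; last first.
    by apply: integrable_fin_num => //; exact: integrable_abse.
  congr EFin; rewrite -[RHS]p0; congr fine; apply: eq_integral => t _ /=.
  by rewrite ger0_norm.
move=> fae; apply: (@poly_eq0_itv _ (node R m i) (node R m i.+1)); first exact: lt_nodeS.
apply: ae_eq0_continuous; [exact: node_ge0|exact: node_le1| |].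
  apply: (ae_imp fae) => t /(_ Logic.I) [] + /andP[t1 t2].
  rewrite /f /cellind t2 (ltW t1) mul1r => /eqP.
  by rewrite expf_eq0 => /eqP.
by move=> t _; exact: continuous_horner.
Qed.

Lemma poly_primitive p : exists2 q, deriv q = p & (size q <= (size p).+1)%N.
Proof.
exists (\poly_(j < (size p).+1) (if j is j'.+1 then p`_j' / j'.+1%:R else 0)); last exact: size_poly.
apply/polyP => j; rewrite coef_deriv coef_poly ltnS.
case: ltnP => jp; last by rewrite mul0rn nth_default.
by rewrite -[LHS]mulr_natr divfK// pnatr_eq0.
Qed.

Lemma hasder_horner p t : hasder (fun t => p.[t]) t (deriv p).[t].
Proof.
have := derivable_hasder (@derivable_horner _ p t).
by rewrite -[X in hasder _ _ (X t)]derivE.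
Qed.

Lemma Rintegral_FTC (F f : R -> R) (a t : R) : (forall u, hasder F u (f u)) -> continuous f ->
  0 <= a -> a <= t -> t <= 1 ->
  \int[lam]_u ((a <= u < t)%R%:R * f u) = F t - F a.
Proof.
move=> Ff cf a0 + t1; rewrite le_eqVlt => /predU1P[->|a_lt].
  rewrite subrr -[RHS](Rintegral0T lam); apply: eq_Rintegral => u _.
  by rewrite -[(_ <= _ < _)%R]/(_ && _) leNgt andNb mul0r.
have cF : continuous F.
  move=> u; apply: differentiable_continuous; apply/derivable1_diffP.
  exact: hasder_derivable (Ff u).
have cd : {within `[a, t], continuous f} by exact: continuous_subspaceT.
have dF : derivable_oo_LRcontinuous F a t.
  split; first by move=> x _; exact: hasder_derivable (Ff x).
    by apply: cvg_at_right_filter; exact: cF.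
  by apply: cvg_at_left_filter; exact: cF.
have dFE : {in `]a, t[, derive1 F =1 f} by move=> x _; exact: hasder_derive1.
have E : \int[leb]_(u in `[a, t]) f u = F t - F a.
  by rewrite /Rintegral (continuous_FTC2 a_lt cd dF dFE).
rewrite -E Rintegral_mrestr Rintegral_mkcond [RHS]Rintegral_mkcond.
(* The integrands can differ only at 0, which the open unit interval excludes, and at t, which the
   half-open interval excludes. *)
apply: ae_eq_Rintegral; exists [set 0; t]; split => //.
- by apply: measurableU; exact: measurable_set1.
- apply/eqP; rewrite -measure_le0; apply: le_trans (measureU2 _ _ _) _; do ?exact: measurable_set1.
  by rewrite [X in (X + _)%E]lebesgue_measure_set1 [X in (_ + X)%E]lebesgue_measure_set1 adde0.
move=> u /= /not_implyP[_]; apply: contra_notP => /not_orP[/eqP u0 /eqP ut].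
rewrite !patchE !mem_setE !in_itv/=.
have -> : (u <= t) = (u < t) by rewrite le_eqVlt (negbTE ut).
case: (boolP (a <= u < t)) => [/andP[au ut']|]; rewrite ?mul0r ?if_same// mul1r.
rewrite (lt_le_trans ut' t1) andbT lt_def u0 (le_trans a0 au)//.
Qed.

Lemma Rintegral_poly (q : {poly R}) (a t : R) : 0 <= a -> a <= t -> t <= 1 ->
  \int[lam]_u ((a <= u < t)%R%:R * (deriv q).[u]) = q.[t] - q.[a].
Proof.
apply: (Rintegral_FTC (F := fun u => q.[u])); last exact: continuous_horner.
by move=> u; exact: hasder_horner.
Qed.

End Cells.

(** * The L^2 projection onto piecewise polynomials *)

Section Projection.
Context {R : realType} (k : nat).
Implicit Types (m i : nat) (p q r w : {poly R}) (v e : R -> R).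

Definition cpoly m i p (t : R) : R := cellind m i t * p.[t].

Definition cmoment m i (v : R -> R) (b : nat) : R := \int[lam]_t (cellind m i t * t ^+ b * v t).

Definition gram m i : 'M[R]_k.+1 := \matrix_(a, b) \int[lam]_t (cellind m i t * t ^+ b * t ^+ a).

Lemma bmeas_cpoly m i p : bmeas (cpoly m i p : measurableTypeR R -> R).
Proof. exact: bmeas_cellpoly. Qed.

Lemma cpolyXn m i a : cpoly m i 'X^a = (fun t => cellind m i t * t ^+ a).
Proof. by apply/funext => t; rewrite /cpoly hornerXn. Qed.

Lemma bmeas_cellmono m i a : bmeas ((fun t => cellind m i t * t ^+ a) : measurableTypeR R -> R).
Proof. by rewrite -cpolyXn; exact: bmeas_cpoly. Qed.

Lemma size_rVpolyS (u : 'rV[R]_k.+1) : (size (rVpoly u) <= k.+1)%N.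
Proof. exact: size_poly. Qed.

Lemma horner_small (p : {poly R}) t : (size p <= k.+1)%N -> p.[t] = \sum_(a < k.+1) p`_a * t ^+ a.
Proof. exact: horner_coef_wide. Qed.

Lemma coef_rVpolyS (u : 'rV[R]_k.+1) (a : 'I_k.+1) : (rVpoly u)`_a = u ord0 a.
Proof. by rewrite coef_rVpoly_ord. Qed.

Lemma Rintegral_cpoly m i q v : (size q <= k.+1)%N -> rintegrable lam v ->
  \int[lam]_t (cpoly m i q t * v t) = \sum_(b < k.+1) q`_b * cmoment m i v b.
Proof.
move=> sq vi; transitivity (\int[lam]_t \sum_(b < k.+1) (q`_b * (cellind m i t * t ^+ b * v t))).
  apply: eq_Rintegral => t _; rewrite /cpoly horner_small// mulr_sumr mulr_suml.
  by apply: eq_bigr => b _; ring.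
rewrite Rintegral_sumT; last first.
  by move=> b _; apply: rintegrableZ; apply: bmeasM_int => //; exact: bmeas_cellmono.
apply: eq_bigr => b _; rewrite RintegralZT//.
by apply: bmeasM_int => //; exact: bmeas_cellmono.
Qed.

Lemma mul_gram m i (u : 'rV[R]_k.+1) b :
  (u *m gram m i) ord0 b = cmoment m i (cpoly m i (rVpoly u)) b.
Proof.
rewrite mxE.
have mi a : rintegrable (@lam R) (fun t => cellind m i t * t ^+ b * t ^+ a).
  have -> : (fun t : R => cellind m i t * t ^+ b * t ^+ a) =
      (fun t => cellind m i t * t ^+ (b + a)).
    by apply/funext => t; rewrite exprD mulrA.
  exact: bmeas_int (bmeas_cellmono _ _ _).
transitivity (\int[lam]_t \sum_(a < k.+1) (u ord0 a * (cellind m i t * t ^+ b * t ^+ a))).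
  rewrite Rintegral_sumT => [|a _]; last exact: rintegrableZ.
  by apply: eq_bigr => a _; rewrite mxE RintegralZT.
apply: eq_Rintegral => t _; rewrite /cpoly horner_small ?size_rVpolyS//.
rewrite [RHS]mulrACA cellind_sq [RHS]mulrA mulr_sumr.
by apply: eq_bigr => a _; rewrite coef_rVpolyS; ring.
Qed.

(** A vector in the kernel is the coefficient vector of a polynomial orthogonal on the cell to all
    monomials of degree at most k, hence to itself. *)
Lemma gram_unit m i : (i < 2 ^ m)%N -> gram m i \in unitmx.
Proof.
move=> im; rewrite -row_free_unit -kermx_eq0; apply/eqP/row_matrixP => j.
rewrite row0; set u := row j _.
have uG : u *m gram m i = 0 by apply/sub_kermxP; exact: row_sub.
suff : rVpoly u = 0 by move=> u0; rewrite -(rVpolyK u) u0 linear0.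
apply: (poly_eq0_cell im).
have ci := bmeas_int lam (bmeas_cpoly m i (rVpoly u)).
transitivity (\int[lam]_t (cpoly m i (rVpoly u) t * cpoly m i (rVpoly u) t)).
  by apply: eq_Rintegral => t _; rewrite /cpoly -[in LHS]cellind_sq; ring.
rewrite Rintegral_cpoly ?size_rVpolyS// big1// => b _.
by rewrite -mul_gram uG mxE mulr0.
Qed.

Definition ccoef m i v : 'rV[R]_k.+1 := (\row_b cmoment m i v b) *m invmx (gram m i).

Definition cproj m i v : {poly R} := rVpoly (ccoef m i v).

Lemma size_cproj m i v : (size (cproj m i v) <= k.+1)%N.
Proof. exact: size_rVpolyS. Qed.

Lemma cproj_orth m i v q : (i < 2 ^ m)%N -> (size q <= k.+1)%N -> rintegrable lam v ->
  \int[lam]_t (cpoly m i q t * cpoly m i (cproj m i v) t) = \int[lam]_t (cpoly m i q t * v t).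
Proof.
move=> im sq vi; rewrite !Rintegral_cpoly//; last by apply: bmeas_int; exact: bmeas_cpoly.
apply: eq_bigr => b _; congr (_ * _).
by rewrite -mul_gram /ccoef mulmxKV ?gram_unit// mxE.
Qed.

(* The kernel of the L^2 projection, written with the inverse Gram matrices of the monomials. *)
Definition kappa m (t u : R) : R := \sum_(i < 2 ^ m) \sum_(b < k.+1)
  cpoly m i (rVpoly (row b (invmx (gram m i)))) t * (cellind m i u * u ^+ b).

Lemma bkernel_kappa m : bkernel (kappa m).
Proof.
apply: bmeas_sum => i _; apply: bmeas_sum => b _; apply: bmeasM.
  by apply: (bmeas_comp (bmeas_cpoly _ _ _)); exact: measurable_fst.
by apply: (bmeas_comp (bmeas_cellmono _ _ _)); exact: measurable_snd.
Qed.

Lemma kint_kappa m v t : rintegrable lam v ->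
  kint (kappa m) v t = \sum_(i < 2 ^ m) cpoly m i (cproj m i v) t.
Proof.
move=> vi; rewrite /kint.
have vim i b : rintegrable lam (fun u => cellind m i u * u ^+ b * v u).
  by apply: bmeasM_int => //; exact: bmeas_cellmono.
transitivity (\int[lam]_u \sum_(i < 2 ^ m) \sum_(b < k.+1)
  (cpoly m i (rVpoly (row b (invmx (gram m i)))) t * (cellind m i u * u ^+ b * v u))).
  apply: eq_Rintegral => u _; rewrite mulr_suml; apply: eq_bigr => i _.
  by rewrite mulr_suml; apply: eq_bigr => b _; rewrite -!mulrA.
rewrite Rintegral_sumT => [|i _]; last by apply: rintegrable_sum => b _; exact: rintegrableZ.
apply: eq_bigr => i _.
rewrite Rintegral_sumT => [|b _]; last exact: rintegrableZ.
rewrite /cpoly /cproj /ccoef mulmx_sum_row linear_sum/= horner_sum mulr_sumr.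
apply: eq_bigr => b _; rewrite RintegralZT// linearZ/= hornerZ mxE -/(cmoment m i v b).
by ring.
Qed.

Lemma kint_kappa_cell m v t i : (i < 2 ^ m)%N -> rintegrable lam v ->
  cellind m i t * kint (kappa m) v t = cpoly m i (cproj m i v) t.
Proof.
move=> im vi; rewrite kint_kappa// (bigD1 (Ordinal im))//= mulrDr {1}/cpoly mulrA cellind_sq.
rewrite mulr_sumr big1 ?addr0// => j ji; rewrite /cpoly mulrA cellind_mul ?mul0r//.
by apply: contra ji => /eqP ij; apply/eqP/val_inj.
Qed.

Lemma kint_kappa_orth m v i q : (i < 2 ^ m)%N -> (size q <= k.+1)%N -> rintegrable lam v ->
  \int[lam]_t (cpoly m i q t * kint (kappa m) v t) = \int[lam]_t (cpoly m i q t * v t).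
Proof.
move=> im sq vi; rewrite -[RHS](cproj_orth im sq vi); apply: eq_Rintegral => t _.
rewrite -(kint_kappa_cell t im vi) [in RHS]/cpoly [in LHS]/cpoly -{1}[cellind m i t]cellind_sq.
by ring.
Qed.

Lemma kint_kappa_Q m v : rintegrable lam v -> Q_space k m (kint (kappa m) v).
Proof.
move=> vi i im; exists (cproj m i v); first exact: size_cproj.
move=> t; rewrite in_itv/= => ti; have := kint_kappa_cell t im vi.
by rewrite /cpoly (cellind1 ti) !mul1r.
Qed.

Lemma Rintegral_sum_cells m (h : R -> R) :
  (forall i : 'I_(2 ^ m), rintegrable lam (fun t => cellind m i t * h t)) ->
  \int[lam]_t h t = \sum_(i < 2 ^ m) \int[lam]_t (cellind m i t * h t).
Proof.
move=> hi; rewrite -Rintegral_sumT//; apply: ae_eq_Rintegral; apply: ae_eqT.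
apply: (ae_imp ae_lam_itv) => t /andP[t0 t1].
by rewrite -mulr_suml sum_cellind1 ?mul1r// ltW.
Qed.

Lemma exists_cell m (t : R) : 0 <= t < 1 ->
  exists2 i, (i < 2 ^ m)%N & node R m i <= t < node R m i.+1.
Proof.
move=> t01; apply: contrapT => h; have := sum_cellind1 m t01.
rewrite big1 => [/eqP|i _]; first by rewrite eq_sym oner_eq0.
by apply/eqP; apply: contra_notT h => /cellind_in ti; exists i.
Qed.

Lemma is_Pi1_kappa m (v v0 : R -> R) : rintegrable lam v0 -> ae_eq lam setT v v0 ->
  is_Pi1 k m v (kint (kappa m) v0).
Proof.
move=> vi vv0; split; first exact: kint_kappa_Q.
move=> w Qw; rewrite -Rintegral_mrestr.
have pi : rintegrable lam (kint (kappa m) v0).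
  by apply: bmeas_int; apply: bmeas_kint => //; exact: bkernel_kappa.
transitivity (\int[lam]_t ((kint (kappa m) v0 t - v0 t) * w t)).
  by apply: ae_eq_Rintegral; apply: (ae_imp vv0) => t /(_ Logic.I) -> _.
have wE i : (i < 2 ^ m)%N -> exists2 q : {poly R}, (size q <= k.+1)%N &
    (fun t => cellind m i t * ((kint (kappa m) v0 t - v0 t) * w t)) =
    (fun t => cpoly m i q t * kint (kappa m) v0 t - cpoly m i q t * v0 t).
  move=> /Qw[q sq qE]; exists q => //; apply/funext => t; rewrite -mulrBr /cpoly.
  by rewrite [RHS]mulrAC -mulrA; apply: cellind_congr => ti; rewrite qE ?in_itv.
have qi i q h : rintegrable lam h -> rintegrable lam (fun t => cpoly m i q t * h t).
  by move=> ?; apply: bmeasM_int => //; exact: bmeas_cpoly.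
rewrite (@Rintegral_sum_cells m) => [|i]; last first.
  by have [q sq ->] := wE i (ltn_ord i); apply: rintegrableB; exact: qi.
rewrite big1// => i _; have [q sq ->] := wE i (ltn_ord i).
by rewrite RintegralBT ?kint_kappa_orth ?subrr//; exact: qi.
Qed.

(** On one cell the two candidates differ by a polynomial r of degree at most k. Extended by 0
    outside the cell, r is an admissible test function, and it gives int r^2 = 0. The point 1 is
    left out since [Q_space] prescribes values on half-open cells. *)
Lemma is_Pi1_unique m (v v0 p : R -> R) : rintegrable lam v0 -> ae_eq lam setT v v0 ->
  is_Pi1 k m v p -> forall t, 0 <= t < 1 -> p t = kint (kappa m) v0 t.
Proof.
move=> vi vv0 [Qp pE] t t01.
have [i im it] := exists_cell m t01.
have [q sq qE] := Qp i im.
suff E : q = cproj m i v0.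
  have := kint_kappa_cell t im vi; rewrite /cpoly (cellind1 it) !mul1r => ->.
  by rewrite qE ?in_itv//= E.
apply/eqP; rewrite -subr_eq0; apply/eqP.
set r := q - cproj m i v0.
have sr : (size r <= k.+1)%N.
  by rewrite (leq_trans (size_polyD _ _))// size_polyN geq_max sq size_cproj.
apply: (poly_eq0_cell im).
have Qr : Q_space k m (cpoly m i r).
  move=> j jm; have [->|ij] := eqVneq i j.
    by exists r => // u; rewrite in_itv/= => uj; rewrite /cpoly cellind1 ?mul1r.
  exists 0; first by rewrite size_poly0.
  move=> u; rewrite in_itv/= => uj; rewrite /cpoly horner0.
  by have := @cellind_mul R m i j u ij; rewrite (cellind1 uj) mulr1 => ->; rewrite mul0r.
have := pE _ Qr; rewrite -Rintegral_mrestr => E1.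
have ri := bmeas_cpoly m i r.
have ri' := bmeas_int lam ri.
have qi (h : R -> R) : rintegrable lam h -> rintegrable lam (fun t => cpoly m i r t * h t).
  by move=> ?; exact: bmeasM_int.
have ci p' := bmeas_int lam (bmeas_cpoly m i p').
have {E1} E1 : \int[lam]_t (cpoly m i r t * cpoly m i q t) = \int[lam]_t (cpoly m i r t * v0 t).
  apply/eqP; rewrite -subr_eq0 -RintegralBT; [|exact: qi|exact: qi]; apply/eqP.
  rewrite -[RHS]E1; apply: ae_eq_Rintegral; apply: (ae_imp vv0) => u /(_ Logic.I) -> _.
  rewrite -mulrBr /cpoly [RHS]mulrCA -mulrA; apply: cellind_congr => ui.
  by rewrite (cellind1 ui) mul1r -qE ?in_itv// mulrC.
transitivity (\int[lam]_t (cpoly m i r t * cpoly m i q t - cpoly m i r t * cpoly m i (cproj m i v0) t)).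
  apply: eq_Rintegral => u _; rewrite -mulrBr /cpoly -mulrBr -hornerN -hornerD -/r.
  by rewrite -[in LHS](cellind_sq m i u); ring.
by rewrite RintegralBT ?E1 ?cproj_orth ?subrr//; exact: qi.
Qed.

End Projection.

(** * Primitives on the cells and Poincare's inequality *)

Section Primitives.
Context {R : realType}.
Local Notation leb := (@lebesgue_measure R).
Implicit Types (m i : nat) (p q r w : {poly R}) (v e h : R -> R).

Definition prim h (t : R) : R := kint stepk h t.

Definition itvind (a t u : R) : R := (a <= u < t)%R%:R.

Lemma bmeas_itvind a t : bmeas (itvind a t : measurableTypeR R -> R).
Proof.
split; last by exists 1 => u; rewrite /itvind; case: (_ <= _ < _); rewrite ?normr1 ?normr0.
have -> : itvind a t = \1_`[a, t[.
  by apply/funext => u; rewrite indicE /itvind; congr (nat_of_bool _)%:R;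
    apply/idP/idP; rewrite inE /= in_itv.
by apply: measurable_indic; exact: measurable_itv.
Qed.

Lemma bmeas_stepk t : bmeas (stepk t : measurableTypeR R -> R).
Proof. by apply: bkernel_line; exact: bkernel_stepk. Qed.

Lemma ae_lam_neq (a : R) : {ae (@lam R), forall t, t != a}.
Proof.
apply/ae_mrestr; exists [set a]; split; first exact: measurable_set1.
  exact: lebesgue_measure_set1.
by move=> t /= /not_implyP[_ /negP]; rewrite negbK => /eqP.
Qed.

Lemma Rintegral_itvind (a t : R) : 0 <= a -> a <= t -> t <= 1 -> \int[lam]_u itvind a t u = t - a.
Proof.
move=> a0 at_ t1; rewrite -[t in RHS]hornerX -[a in RHS]hornerX -Rintegral_poly//.
by apply: eq_Rintegral => u _; rewrite derivX hornerC mulr1.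
Qed.

Lemma primB h a t : rintegrable lam h -> a <= t ->
  prim h t - prim h a = \int[lam]_u (itvind a t u * h u).
Proof.
move=> hi at_; rewrite -RintegralBT; do ?by apply: bmeasM_int => //; exact: bmeas_stepk.
apply: eq_Rintegral => u _; rewrite -mulrBl; congr (_ * _).
rewrite /stepk /itvind; case: (ltP u a) => ua.
  by rewrite (lt_le_trans ua at_) /= subrr.
by rewrite /= subr0.
Qed.

Lemma sqr_primB_le h a t : sqintegrable lam h -> 0 <= a -> a <= t -> t <= 1 ->
  (prim h t - prim h a) ^+ 2 <= (t - a) * \int[lam]_u (h u ^+ 2).
Proof.
move=> hi a0 at_ t1; rewrite primB//; last exact: sqintegrable_int.
move/le_trans: (sqr_Rintegral_mul_le (bmeas_sqintegrable lam (bmeas_itvind a t)) hi); apply.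
rewrite -(Rintegral_itvind a0 at_ t1) le_eqVlt; apply/orP; left; apply/eqP; congr (_ * _).
by apply: eq_Rintegral => u _; rewrite expr2 /itvind -natrM mulnb andbb.
Qed.

(** By Cauchy-Schwarz a primitive of a square-integrable function is Hoelder continuous of exponent
    1/2. This provides the continuous representative required by [is_Pi0]. *)
Lemma continuous_prim h (c : R) : sqintegrable lam h ->
  {within `[0, 1], continuous (fun t => c + prim h t)}.
Proof.
move=> hi; apply/continuous_within_itvP; first exact: ltr01.
pose C := \int[lam]_u (h u ^+ 2).
have C0 : 0 <= C := sq_ge0_Rintegral lam h.
have lip a t : 0 <= a <= 1 -> 0 <= t <= 1 -> (prim h t - prim h a) ^+ 2 <= `|t - a| * C.
  move=> /andP[a0 a1] /andP[t0 t1]; have [at_|ta] := leP a t.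
    by rewrite ger0_norm ?subr_ge0//; exact: sqr_primB_le.
  rewrite distrC ger0_norm ?subr_ge0 ?(ltW ta)// -sqrrN opprB.
  by apply: sqr_primB_le => //; exact: ltW.
have cvg_sqr (F : set_system R) (FF : Filter F) (a : R) : 0 <= a <= 1 -> F --> a ->
    (\forall t \near F, 0 <= t <= 1) -> (fun t => c + prim h t) @ F --> c + prim h a.
  move=> a01 Fa F01; apply: cvgD; first exact: cvg_cst.
  apply/cvgrPdist_lt => e e0; near=> t.
  have t01 : 0 <= t <= 1 by near: t.
  rewrite -(@ltr_pXn2r _ 2)// ?nnegrE ?(ltW e0)// real_normK ?num_real// -sqrrN opprB.
  apply: (le_lt_trans (lip _ _ a01 t01)).
  apply: (@le_lt_trans _ _ (`|a - t| * (C + 1))).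
    by rewrite distrC ler_wpM2l// lerDl.
  have C1 : 0 < C + 1 by rewrite ltr_wpDl.
  rewrite -ltr_pdivlMr//; near: t.
  have e2 : 0 < e ^+ 2 / (C + 1).
    by apply: divr_gt0; [exact: exprn_gt0|rewrite ltr_wpDl].
  by move/cvgrPdist_lt : Fa => /(_ _ e2).
split.
- move=> t; rewrite in_itv/= => /andP[t0 t1]; apply: cvg_sqr => //.
    by rewrite !ltW.
  near=> u; apply/andP; split; apply/ltW; near: u; [exact: lt_nbhsr|exact: lt_nbhsl].
- apply: (@cvg_sqr 0^'+) => //; first by rewrite lexx ler01.
    exact: cvg_at_right_filter.
  near=> u; apply/andP; split; last by near: u; exact: nbhs_right_le.
  by apply/ltW; near: u; exact: nbhs_right_gt.
- apply: (@cvg_sqr 1^'-) => //; first by rewrite lexx ler01.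
    exact: cvg_at_left_filter.
  near=> u; apply/andP; split; first by near: u; exact: nbhs_left_ge.
  by apply/ltW; near: u; exact: nbhs_left_lt.
Unshelve. all: by end_near. Qed.

Lemma prim_node h m i : (i <= 2 ^ m)%N -> rintegrable lam h ->
  prim h (node R m i) = \sum_(j < i) \int[lam]_u (cellind m j u * h u).
Proof.
move=> im hi; rewrite -Rintegral_sumT => [|j _]; last by apply: bmeasM_int => //; exact: bmeas_cellind.
apply: ae_eq_Rintegral; apply: ae_eqT; apply: (ae_imp ae_lam_itv) => u /andP[u0 u1].
rewrite -mulr_suml sum_cellind (ltW u0) /stepk ltNge.
by case: (node R m i <= u); rewrite ?subrr ?subr0.
Qed.

Lemma prim_node0 h m i : (i <= 2 ^ m)%N -> rintegrable lam h ->
  (forall j, (j < 2 ^ m)%N -> \int[lam]_u (cellind m j u * h u) = 0) ->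
  prim h (node R m i) = 0.
Proof.
by move=> im hi h0; rewrite prim_node// big1// => j _; rewrite h0// (leq_trans (ltn_ord j)).
Qed.

Lemma sqr_prim_cell_le h m i t : (i < 2 ^ m)%N -> sqintegrable lam h ->
  node R m i <= t < node R m i.+1 ->
  (prim h t - prim h (node R m i)) ^+ 2 <= 2^-1 ^+ m * \int[lam]_u (cellind m i u * h u ^+ 2).
Proof.
move=> im hi ti; have [at_ tb] := andP ti.
have chi : sqintegrable lam (fun u => cellind m i u * h u).
  by apply: bmeasM_sq => //; exact: bmeas_cellind.
rewrite primB//; last exact: sqintegrable_int.
have -> : \int[lam]_u (itvind (node R m i) t u * h u) =
    \int[lam]_u (itvind (node R m i) t u * (cellind m i u * h u)).
  apply: eq_Rintegral => u _; rewrite /itvind; have [|_] := boolP (_ <= _ < _).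
    by move=> /andP[u1 u2]; rewrite cellind1 ?mul1r// u1 (lt_trans u2).
  by rewrite !mul0r.
move/le_trans: (sqr_Rintegral_mul_le (bmeas_sqintegrable lam (bmeas_itvind (node R m i) t)) chi); apply.
have t1 : t <= 1 by rewrite (le_trans (ltW tb))// node_le1.
have -> : \int[lam]_u (itvind (node R m i) t u ^+ 2) = t - node R m i.
  rewrite -(Rintegral_itvind (node_ge0 m i) at_ t1).
  by apply: eq_Rintegral => u _; rewrite expr2 /itvind -natrM mulnb andbb.
have -> : \int[lam]_u ((cellind m i u * h u) ^+ 2) = \int[lam]_u (cellind m i u * h u ^+ 2).
  by apply: eq_Rintegral => u _; rewrite exprMn expr2 cellind_sq.
rewrite ler_wpM2r//; last by rewrite lerBlDr addrC -nodeS ltW.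
by apply: Rintegral_ge0 => u _; rewrite mulr_ge0 ?cellind_ge0// sqr_ge0.
Qed.

Lemma Rintegral_cellind m i : (i < 2 ^ m)%N -> \int[lam]_u cellind m i u = 2^-1 ^+ m :> R.
Proof.
move=> im; rewrite -[LHS]/(\int[lam]_u itvind (node R m i) (node R m i.+1) u).
rewrite Rintegral_itvind ?node_ge0 ?node_le1//; last exact/ltW/lt_nodeS.
by rewrite nodeS addrC addKr.
Qed.

Lemma bmeas_prim h : rintegrable lam h -> bmeas (prim h : measurableTypeR R -> R).
Proof. by move=> hi; apply: bmeas_kint => //; exact: bkernel_stepk. Qed.

(** Poincare's inequality on one cell: Cauchy-Schwarz gives a pointwise bound with one factor of the
    length 2^-m, and integrating over the cell gives the other. *)
Lemma Rintegral_sqr_prim_cell h m i : (i < 2 ^ m)%N -> sqintegrable lam h ->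
  \int[lam]_t (cellind m i t * (prim h t - prim h (node R m i)) ^+ 2) <=
  (2^-1 ^+ m) ^+ 2 * \int[lam]_u (cellind m i u * h u ^+ 2).
Proof.
move=> im hi; set D := \int[lam]_u (cellind m i u * h u ^+ 2).
have pb : bmeas ((fun t => (prim h t - prim h (node R m i)) ^+ 2) : measurableTypeR R -> R).
  have bb := bmeasB (bmeas_prim (sqintegrable_int hi)) (bmeas_cst _ (prim h (node R m i))).
  exact: (bmeasM bb bb).
have -> : (2^-1 ^+ m) ^+ 2 * D = \int[lam]_t ((2^-1 ^+ m * D) * cellind m i t).
  rewrite RintegralZT; last by apply: bmeas_int; exact: bmeas_cellind.
  by rewrite Rintegral_cellind//; ring.
apply: le_RintegralT.
- by apply: bmeas_int; apply: bmeasM => //; exact: bmeas_cellind.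
- by apply: rintegrableZ; apply: bmeas_int; exact: bmeas_cellind.
move=> t; rewrite [leRHS]mulrC; have [->|/cellind_in ti] := eqVneq (cellind m i t) 0.
  by rewrite !mul0r.
by rewrite (cellind1 ti) !mul1r sqr_prim_cell_le.
Qed.

Lemma prim_cell_poly h m i q t : (i < 2 ^ m)%N -> rintegrable lam h ->
  (forall u, node R m i <= u < node R m i.+1 -> h u = (deriv q).[u]) ->
  node R m i <= t <= node R m i.+1 ->
  prim h t = prim h (node R m i) + (q.[t] - q.[node R m i]).
Proof.
move=> im hi hq /andP[t1 t2]; apply/eqP; rewrite addrC -subr_eq primB//; apply/eqP.
rewrite -Rintegral_poly ?node_ge0//; last by rewrite (le_trans t2)// node_le1.
apply: eq_Rintegral => u _; rewrite /itvind; have [|_] := boolP (_ <= _ < _); last by rewrite !mul0r.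
by move=> /andP[u1 u2]; rewrite !mul1r hq// u1 (lt_le_trans u2).
Qed.

Lemma Rintegral_cell (f : R -> R) m i : (i < 2 ^ m)%N ->
  \int[leb]_(x in `]node R m i, node R m i.+1[) f x = \int[lam]_t (cellind m i t * f t).
Proof.
move=> im; rewrite Rintegral_mrestr Rintegral_mkcond [RHS]Rintegral_mkcond.
apply: ae_eq_Rintegral; exists [set node R m i]; split; first exact: measurable_set1.
  exact: lebesgue_measure_set1.
move=> u /= /not_implyP[_]; apply: contra_notP => /eqP ua.
rewrite !patchE !mem_setE !in_itv/= /cellind.
have -> : (node R m i <= u) = (node R m i < u) by rewrite [RHS]lt_def ua.
case: (boolP (_ < _ < _)) => [/andP[u1 u2]|_]; last by rewrite mul0r if_same.
rewrite (le_lt_trans (node_ge0 m i) u1) (lt_le_trans u2) ?mul1r//.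
by rewrite node_le1.
Qed.

End Primitives.

(** * The interpolant Pi^0 as a primitive of an L^2 projection *)

Section Interpolation0.
Context {R : realType} (k : nat).
Local Notation leb := (@lebesgue_measure R).
Implicit Types (m i : nat) (p q r w : {poly R}) (v e h : R -> R).

Definition corth m e := forall i q, (i < 2 ^ m)%N -> (size q <= k.+1)%N ->
  \int[lam]_t (cpoly m i q t * e t) = 0.

Lemma corth_cell m e i : corth m e -> (i < 2 ^ m)%N -> \int[lam]_t (cellind m i t * e t) = 0.
Proof.
move=> eo im; rewrite -(eo i 1%:P im).
  by apply: eq_Rintegral => t _; rewrite /cpoly hornerC mulr1.
by rewrite size_polyC; case: (_ == _).
Qed.

(** The integral from u to 1 of a polynomial supported on one cell is constant to the left of the
    cell, a polynomial on it and 0 to its right. *)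
Lemma tail_cpoly m i (W : {poly R}) u : (i < 2 ^ m)%N -> 0 <= u < 1 ->
  tail (cpoly m i (deriv W)) u =
  (u < node R m i)%R%:R * (W.[node R m i.+1] - W.[node R m i]) +
  cellind m i u * (W.[node R m i.+1] - W.[u]).
Proof.
move=> im /andP[u0 u1]; rewrite /cellind.
have b1 : node R m i.+1 <= 1 by exact: node_le1.
have ab := @lt_nodeS R m i.
have [ua|au] := ltP u (node R m i).
  rewrite /= mul0r addr0 mul1r -Rintegral_poly ?node_ge0 ?(ltW ab)//.
  apply: eq_Rintegral => t _; rewrite /stepk /cpoly -/(cellind m i t) mulrCA.
  by apply: cellind_congr => /andP[t1 _]; rewrite (lt_le_trans ua t1) mul1r.
rewrite /= mul0r add0r; have [ub|bu] := ltP u (node R m i.+1).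
  rewrite mul1r -Rintegral_poly ?(ltW ub)//.
  apply: ae_eq_Rintegral; apply: ae_eqT; apply: (ae_imp (ae_lam_neq u)) => t tu.
  rewrite /stepk /cpoly /cellind mulrA -natrM mulnb; congr ((nat_of_bool _)%:R * _).
  have -> : (u < t) = (u <= t) by rewrite lt_def tu.
  apply/andP/andP => [[ut /andP[_ ->]]//|[ut tb]]; split => //.
  by rewrite (le_trans au ut).
rewrite /= mul0r -[RHS](Rintegral0T lam); apply: eq_Rintegral => t _.
rewrite /stepk /cpoly mulrCA -[RHS](mulr0 (cellind m i t)).
by apply: cellind_congr => /andP[_ t2]; rewrite ltNge (le_trans (ltW t2) bu) mul0r.
Qed.

(** The primitive is transposed onto the test polynomial. By [tail_cpoly] this yields a constant on
    the cells before the i-th and a polynomial of degree at most k on the i-th: e is orthogonal to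
    both. One degree is lost because w is replaced by its primitive. *)
Lemma prim_corth m e i w : rintegrable lam e -> corth m e -> (i < 2 ^ m)%N -> (size w <= k)%N ->
  \int[lam]_t (cpoly m i w t * prim e t) = 0.
Proof.
move=> ei eo im sw; have [W dW sW] := poly_primitive w.
have W1 : (size W <= k.+1)%N by rewrite (leq_trans sW).
rewrite kint_dual//; [|exact: bkernel_stepk|exact: bmeas_cpoly].
set C := W.[node R m i.+1] - W.[node R m i].
have cj (j : nat) : rintegrable lam (fun u => C * (cellind m j u * e u)).
  by apply: rintegrableZ; apply: bmeasM_int => //; exact: bmeas_cellind.
have ci (q : {poly R}) : rintegrable lam (fun u => cpoly m i q u * e u).
  by apply: bmeasM_int => //; exact: bmeas_cpoly.
transitivity (\int[lam]_u (\sum_(j < i) C * (cellind m j u * e u) +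
    cpoly m i (W.[node R m i.+1]%:P - W) u * e u)).
  apply: ae_eq_Rintegral; apply: ae_eqT; apply: (ae_imp ae_lam_itv) => u /andP[u0 u1].
  have u01 : 0 <= u < 1 by rewrite ltW.
  have := tail_cpoly W im u01; rewrite dW /tail => ->.
  rewrite -mulr_sumr -mulr_suml sum_cellind (ltW u0) mulrDl /cpoly hornerD hornerN hornerC.
  congr (_ + _); rewrite -/C ltNge.
  by case: (node R m i <= u) => /=; ring.
rewrite RintegralDT ?Rintegral_sumT//; last exact: rintegrable_sum.
rewrite eo// ?addr0; last first.
  by rewrite (leq_trans (size_polyD _ _))// size_polyN geq_max W1 (leq_trans (size_polyC_leq1 _)).
rewrite big1// => j _; rewrite RintegralZT ?corth_cell ?mulr0//.
  exact: ltn_trans (ltn_ord j) im.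
by apply: bmeasM_int => //; exact: bmeas_cellind.
Qed.

Lemma corth_kappa m v : rintegrable lam v -> corth m (fun t => kint (kappa k m) v t - v t).
Proof.
move=> vi i q im sq.
have qi h : rintegrable lam h -> rintegrable lam (fun t => cpoly m i q t * h t).
  by move=> ?; apply: bmeasM_int => //; exact: bmeas_cpoly.
have pi : rintegrable lam (kint (kappa k m) v).
  by apply: bmeas_int; apply: bmeas_kint => //; exact: bkernel_kappa.
transitivity (\int[lam]_t (cpoly m i q t * kint (kappa k m) v t - cpoly m i q t * v t)).
  by apply: eq_Rintegral => t _; rewrite mulrBr.
by rewrite RintegralBT ?kint_kappa_orth ?subrr//; exact: qi.
Qed.

(** The explicit Pi^0 of c + int_0^t v1. Nodal values agree because the projection error of v1 has
    mean 0 on every cell, and the moments agree by [prim_corth]. *)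
Definition pi0 m (c : R) v1 (t : R) : R := c + prim (kint (kappa k m) v1) t.

Lemma primBl h e t : rintegrable lam h -> rintegrable lam e ->
  prim (fun u => h u - e u) t = prim h t - prim e t.
Proof.
move=> hi ei; rewrite /prim /kint -RintegralBT; do ?by apply: bmeasM_int => //; exact: bmeas_stepk.
by apply: eq_Rintegral => u _; rewrite mulrBr.
Qed.

Section Existence.
Variables (m : nat) (c : R) (v v1 : R -> R).
Hypotheses (v1i : sqintegrable lam v1) (vE : ae_eq lam setT v (fun t => c + prim v1 t)).

Let K := kint (kappa k m) v1.
Let v1i1 := sqintegrable_int v1i.

Let Kb : bmeas (K : measurableTypeR R -> R).
Proof. by apply: bmeas_kint => //; exact: bkernel_kappa. Qed.

Let Ki : rintegrable lam K := bmeas_int lam Kb.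

Lemma pi0_cell i : (i < 2 ^ m)%N -> exists2 q : {poly R}, (size q <= k.+2)%N &
  forall t, node R m i <= t <= node R m i.+1 -> pi0 m c v1 t = q.[t].
Proof.
move=> im; have [p sp pE] := kint_kappa_Q k v1i1 im.
have [W dW sW] := poly_primitive p.
exists ((c + prim K (node R m i) - W.[node R m i])%:P + W).
  rewrite (leq_trans (size_polyD _ _))// geq_max (leq_trans (size_polyC_leq1 _))//=.
  by rewrite (leq_trans sW).
move=> t ti; rewrite hornerD hornerC /pi0 -/K (@prim_cell_poly _ K m i W)//; first by ring.
by move=> u ui; rewrite dW; apply: pE; rewrite in_itv.
Qed.

Lemma pi0_node i : (i <= 2 ^ m)%N -> pi0 m c v1 (node R m i) = c + prim v1 (node R m i).
Proof.
move=> im; congr (_ + _); apply/eqP; rewrite -subr_eq0 -primBl//; apply/eqP.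
apply: (@prim_node0 _ _ m) => //; first exact: rintegrableB.
by move=> j jm; apply: corth_cell => //; exact: corth_kappa.
Qed.

Lemma pi0_orth i w : (i < 2 ^ m)%N -> (size w <= k)%N ->
  \int[lam]_t (cellind m i t * ((pi0 m c v1 t - v t) * w.[t])) = 0.
Proof.
move=> im sw; rewrite -(prim_corth (rintegrableB Ki v1i1) (corth_kappa v1i1) im sw).
apply: ae_eq_Rintegral; apply: (ae_imp vE) => t /(_ Logic.I) -> _.
by rewrite primBl// /pi0 /cpoly -/K; ring.
Qed.

Lemma is_Pi0_pi0 : is_Pi0 k m v (pi0 m c v1).
Proof.
split.
- split; first by apply: continuous_prim; exact: bmeas_sqintegrable.
  by move=> i /pi0_cell[q sq qE]; exists q => // t; rewrite in_itv/= => /qE.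
- exists (fun t => c + prim v1 t); split.
  + exact: continuous_prim.
  + have /ae_mrestr := ae_imp vE (fun t (h : setT t -> _) => h Logic.I).
    by apply: filterS => t.
  + exact: pi0_node.
- by move=> i im w sw; rewrite Rintegral_cell// pi0_orth.
Qed.

(** Integrating (r r')' over the cell gives 0, since r vanishes at both ends; and int r r'' = 0,
    since r'' has degree at most k - 1. So int r'^2 = 0 and r is constant. *)
Lemma poly_zero_cell r i : (i < 2 ^ m)%N -> (size r <= k.+2)%N ->
  r.[node R m i] = 0 -> r.[node R m i.+1] = 0 ->
  (forall w, (size w <= k)%N -> \int[lam]_t (cellind m i t * (r.[t] * w.[t])) = 0) ->
  forall t, node R m i <= t <= node R m i.+1 -> r.[t] = 0.
Proof.
move=> im sr r0 r1 rw.
have dr : deriv r = 0.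
  apply: (poly_eq0_cell im).
  have b1 : node R m i.+1 <= 1 by exact: node_le1.
  have := Rintegral_poly (r * deriv r) (node_ge0 m i) (ltW (lt_nodeS m i)) b1.
  rewrite !hornerM r0 r1 !mul0r subrr => h.
  have sd : (size (deriv r) <= k.+1)%N.
    have [->|rn0] := eqVneq r 0; first by rewrite linear0 size_poly0.
    by rewrite -ltnS (leq_trans _ sr)// lt_size_deriv.
  have sd2 : (size (deriv (deriv r)) <= k)%N.
    have [->|rn0] := eqVneq (deriv r) 0; first by rewrite linear0 size_poly0.
    by rewrite -ltnS (leq_trans _ sd)// lt_size_deriv.
  have := rw _ sd2 => h2.
  have pi p : rintegrable (@lam R) (fun t => cellind m i t * p.[t]).
    by apply: bmeas_int; exact: bmeas_cellpoly.
  rewrite -[RHS]h -[LHS]addr0 -h2 -RintegralDT.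
  - by apply: eq_Rintegral => t _; rewrite derivM hornerD !hornerM /cellind; ring.
  - by have := pi (deriv r ^+ 2); under eq_fun do rewrite horner_exp.
  - by have := pi (r * deriv (deriv r)); under eq_fun do rewrite hornerM.
move=> t /andP[t0 t1].
have t1' : t <= 1 by rewrite (le_trans t1)// node_le1.
have := Rintegral_poly r (node_ge0 m i) t0 t1'.
rewrite r0 subr0 => <-; rewrite -[RHS](Rintegral0T lam).
by apply: eq_Rintegral => u _; rewrite dr horner0 mulr0.
Qed.

Lemma ae_eq_continuous_within (f g : R -> R) : {within `[0, 1], continuous f} ->
  {within `[0, 1], continuous g} -> {ae (@lam R), forall t, f t = g t} ->
  forall t, 0 <= t <= 1 -> f t = g t.
Proof.
move=> cf cg fg.
have [cf1 cf2 cf3] := (continuous_within_itvP f ltr01).1 cf.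
have [cg1 cg2 cg3] := (continuous_within_itvP g ltr01).1 cg.
have E t : 0 < t < 1 -> f t = g t.
  move=> t01; apply/eqP; rewrite -subr_eq0; apply/eqP.
  apply: (@ae_eq0_continuous _ (fun t => f t - g t) 0 1) t01 => //.
    by apply: (ae_imp fg) => u -> _; rewrite subrr.
  by move=> u u01; apply: cvgB; [apply: cf1|apply: cg1]; rewrite in_itv.
move=> t /andP[]; rewrite le_eqVlt => /predU1P[<- _|t0].
  have h : f x @[x --> 0^'+] --> g 0.
    apply: cvg_trans cg2; apply: near_eq_cvg; near=> u; apply/esym/E.
    by apply/andP; split; near: u; [exact: nbhs_right_gt|exact: nbhs_right_lt].
  exact: (cvg_unique _ cf2 h).
rewrite le_eqVlt => /predU1P[->|t1]; last by apply: E; rewrite t0.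
have h : f x @[x --> 1^'-] --> g 1.
  apply: cvg_trans cg3; apply: near_eq_cvg; near=> u; apply/esym/E.
  by apply/andP; split; near: u; [exact: nbhs_left_gt|exact: nbhs_left_lt].
exact: (cvg_unique _ cf3 h).
Unshelve. all: by end_near. Qed.

Lemma is_Pi0_unique (p : R -> R) : is_Pi0 k m v p -> forall t, 0 <= t < 1 -> p t = pi0 m c v1 t.
Proof.
move=> [[cp Sp] [v' [cv' vv' pv']] pw] t t01.
(* The continuous representative is unique up to and including the endpoints, so nodal values do not
   depend on the one that [is_Pi0] provides. *)
have v'E : forall t, 0 <= t <= 1 -> v' t = c + prim v1 t.
  apply: ae_eq_continuous_within => //; first exact: continuous_prim.
  have vv : {ae (@lam R), forall t, v t = v' t}.
    by apply/ae_mrestr; apply: filterS vv' => u.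
  by apply: (ae_imp2 vv vE) => u <- /(_ Logic.I).
have [i im it] := exists_cell m t01.
have [q sq qE] := Sp i im; have [q' sq' qE'] := pi0_cell im.
have ab := @lt_nodeS R m i.
have it' : node R m i <= t <= node R m i.+1 by case/andP : it => -> /ltW ->.
have q0 : q.[node R m i] = p (node R m i).
  by rewrite qE// in_itv/= lexx (ltW ab).
have q1 : q.[node R m i.+1] = p (node R m i.+1).
  by rewrite qE// in_itv/= lexx (ltW ab).
have q0' : q'.[node R m i] = pi0 m c v1 (node R m i) by rewrite qE'// lexx (ltW ab).
have q1' : q'.[node R m i.+1] = pi0 m c v1 (node R m i.+1) by rewrite qE'// lexx (ltW ab).
rewrite qE ?in_itv// qE'//; apply/eqP; rewrite -subr_eq0 -hornerN -hornerD; apply/eqP.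
apply: (@poly_zero_cell _ i) it' => //.
- by rewrite (leq_trans (size_polyD _ _))// size_polyN geq_max sq.
- rewrite hornerD hornerN q0 q0' pv' 1?ltnW// v'E ?node_ge0 ?node_le1 1?ltnW//.
  by rewrite pi0_node 1?ltnW// subrr.
- rewrite hornerD hornerN q1 q1' pv'// v'E ?node_ge0 ?node_le1//.
  by rewrite pi0_node// subrr.
move=> w sw; have := pi0_orth im sw; have := pw i im w sw.
rewrite Rintegral_cell// => E1 E2.
have pi z : rintegrable (@lam R) (fun t => cellind m i t * (z.[t] * w.[t])).
  apply: bmeas_int; have := bmeas_cellpoly m i (z * w).
  by under eq_fun do rewrite hornerM.
have vi : rintegrable (@lam R) (fun t => cellind m i t * ((c + prim v1 t) * w.[t])).
  have -> : (fun t => cellind m i t * ((c + prim v1 t) * w.[t])) =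
      (fun t => (c + prim v1 t) * cpoly m i w t).
    by apply/funext => u; rewrite /cpoly; ring.
  apply: bmeas_int; apply: bmeasM; last exact: bmeas_cpoly.
  by apply: bmeasD; [exact: bmeas_cst|exact: bmeas_prim].
have F (f : R -> R) (z : {poly R}) :
    (forall t, node R m i <= t < node R m i.+1 -> f t = z.[t]) ->
    \int[lam]_t (cellind m i t * ((f t - v t) * w.[t])) =
    \int[lam]_t (cellind m i t * (z.[t] * w.[t])) -
    \int[lam]_t (cellind m i t * ((c + prim v1 t) * w.[t])).
  move=> fE; rewrite -RintegralBT//; apply: ae_eq_Rintegral.
  apply: (ae_imp vE) => u /(_ Logic.I) -> _; rewrite -mulrBr -mulrBl.
  by apply: cellind_congr => ui; rewrite fE.
rewrite (F _ q) in E1; last first.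
  by move=> u /andP[u0 u1]; rewrite qE// in_itv/= u0 ltW.
rewrite (F _ q') in E2; last first.
  by move=> u /andP[u0 u1]; rewrite qE'// u0 ltW.
transitivity (\int[lam]_t (cellind m i t * (q.[t] * w.[t]) - cellind m i t * (q'.[t] * w.[t]))).
  by apply: eq_Rintegral => u _; rewrite hornerD hornerN; ring.
by rewrite RintegralBT//; lra.
Qed.

End Existence.

(** [pi0] is an interpolant, so [xget] does return one rather than its default; uniqueness then
    identifies it on [0, 1). *)
Lemma Pi1d_false m c v v1 : sqintegrable lam v1 ->
  ae_eq lam setT v (fun t => c + prim v1 t) ->
  forall t, 0 <= t < 1 -> Pi1d k false m v t = c + prim (kint (kappa k m) v1) t.
Proof.
move=> v1i vE; apply: (is_Pi0_unique v1i vE); rewrite /Pi1d.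
by apply: xgetPex; exists (pi0 m c v1); exact: is_Pi0_pi0.
Qed.

Lemma Pi1d_true m v v0 : rintegrable lam v0 -> ae_eq lam setT v v0 ->
  forall t, 0 <= t < 1 -> Pi1d k true m v t = kint (kappa k m) v0 t.
Proof.
move=> vi vE; apply: (is_Pi1_unique vi vE); rewrite /Pi1d.
by apply: xgetPex; exists (kint (kappa k m) v0); exact: is_Pi1_kappa.
Qed.

End Interpolation0.

(** * Interpolation errors in one variable *)

Section Errors.
Context {R : realType} (k : nat).
Implicit Types (m i j : nat) (p q r : {poly R}) (h : R -> R) (v : nat -> R -> R).

(** Membership of [v 0] in H^j, with [v i] as its i-th derivative. Derivatives are encoded by
    primitives, the form in which they are found on almost every line. *)
Definition prim_chain j v := (forall i, (i <= j)%N -> sqintegrable lam (v i)) /\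
  forall i, (i < j)%N -> exists c, ae_eq lam setT (v i) (fun t => c + prim (v i.+1) t).

Lemma prim_chainS j v : prim_chain j.+1 v -> prim_chain j (fun i => v i.+1).
Proof. by case=> vi vE; split => i ij; [exact: vi|exact: vE]. Qed.

Lemma sqr_hS m j : (2^-1 ^+ (m * j.+1)) ^+ 2 = (2^-1 ^+ m) ^+ 2 * (2^-1 ^+ (m * j)) ^+ 2 :> R.
Proof. by rewrite mulnS exprD exprMn. Qed.

(* Taylor-type estimate on one cell: subtract a primitive of the approximation of the derivative
   and apply the Poincare inequality to the remainder. *)
Lemma cell_approx m i j v : (i < 2 ^ m)%N -> prim_chain j v ->
  exists2 q : {poly R}, (size q <= j)%N &
    \int[lam]_t (cellind m i t * (v 0%N t - q.[t]) ^+ 2) <=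
    (2^-1 ^+ (m * j)) ^+ 2 * \int[lam]_t (cellind m i t * v j t ^+ 2).
Proof.
move=> im; elim: j v => [|j IH] v vc.
  exists 0; first by rewrite size_poly0.
  rewrite muln0 expr0 expr1n mul1r le_eqVlt; apply/orP; left; apply/eqP.
  by apply: eq_Rintegral => t _; rewrite horner0 subr0.
have [q' sq' Hq'] := IH _ (prim_chainS vc).
have [q dq sq] := poly_primitive q'.
case: vc => vi vE; have [c {}vE] := vE 0%N isT.
have v1i := vi 1%N isT; have v1i' := sqintegrable_int v1i.
pose a := node R m i.
pose e t := v 1%N t - cpoly m i q' t.
have ei : sqintegrable lam e.
  by apply: sqintegrableB => //; apply: bmeas_sqintegrable; exact: bmeas_cpoly.
have qe : forall t, a <= t < node R m i.+1 ->
    prim e t - prim e a = prim (v 1%N) t - prim (v 1%N) a - (q.[t] - q.[a]).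
  move=> t /andP[t1 t2]; rewrite !primB//; last exact: sqintegrable_int.
  have ii := bmeas_itvind (R:=R) a t.
  transitivity (\int[lam]_u (itvind a t u * v 1%N u - itvind a t u * cpoly m i q' u)).
    by apply: eq_Rintegral => u _; rewrite mulrBr.
  rewrite RintegralBT; last 2 first.
  - exact: bmeasM_int.
  - by apply: bmeas_int; apply: bmeasM => //; exact: bmeas_cpoly.
  congr (_ - _); rewrite -Rintegral_poly ?node_ge0//; last first.
    by rewrite (le_trans (ltW t2))// node_le1.
  apply: eq_Rintegral => u _; rewrite dq /itvind /cpoly; have [|_] := boolP (_ <= _ < _).
    by move=> /andP[u1 u2]; rewrite cellind1 ?mul1r// u1 (lt_trans u2).
  by rewrite !mul0r.
exists (q + (c + prim (v 1%N) a - q.[a])%:P).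
  by rewrite (leq_trans (size_polyD _ _))// geq_max (leq_trans sq)//=
     (leq_trans (size_polyC_leq1 _)).
have -> : \int[lam]_t (cellind m i t * (v 0%N t - (q + (c + prim (v 1%N) a - q.[a])%:P).[t]) ^+ 2) =
    \int[lam]_t (cellind m i t * (prim e t - prim e a) ^+ 2).
  apply: ae_eq_Rintegral; apply: (ae_imp vE) => t /(_ Logic.I) -> _.
  apply: cellind_congr => /qe ->; rewrite hornerD hornerC; congr (_ ^+ 2).
  by ring.
apply: le_trans (Rintegral_sqr_prim_cell im ei) _.
rewrite sqr_hS -[leRHS]mulrA; apply: ler_wpM2l; first exact: sqr_ge0.
apply: le_trans Hq'; rewrite le_eqVlt; apply/orP; left; apply/eqP.
by apply: eq_Rintegral => t _; apply: cellind_congr => ti; rewrite /e /cpoly cellind1 ?mul1r.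
Qed.

(** Pythagoras on one cell: the projection error is orthogonal to the difference r between the
    projection and q, so replacing the projection by q only adds int r^2. *)
Lemma proj_le_cell m i q h : (i < 2 ^ m)%N -> (size q <= k.+1)%N -> sqintegrable lam h ->
  \int[lam]_t (cellind m i t * (h t - kint (kappa k m) h t) ^+ 2) <=
  \int[lam]_t (cellind m i t * (h t - q.[t]) ^+ 2).
Proof.
move=> im sq hi; have hi1 := sqintegrable_int hi.
pose r := cproj k m i h - q.
have sr : (size r <= k.+1)%N.
  by rewrite (leq_trans (size_polyD _ _))// size_polyN geq_max sq size_cproj.
pose e t := kint (kappa k m) h t - h t.
have kb : bmeas (kint (kappa k m) h : measurableTypeR R -> R).
  by apply: bmeas_kint => //; exact: bkernel_kappa.
have ei : sqintegrable lam e by apply: sqintegrableB => //; exact: bmeas_sqintegrable.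
have E1 : \int[lam]_t (cellind m i t * (h t - kint (kappa k m) h t) ^+ 2) =
    \int[lam]_t (cellind m i t * (e t) ^+ 2).
  by apply: eq_Rintegral => t _; rewrite -sqrrN opprB.
have i1 : rintegrable lam (fun t => cellind m i t * e t ^+ 2).
  by apply: bmeasM_int; [exact: bmeas_cellind|case: ei].
have i2 : rintegrable lam (fun t => cpoly m i r t * e t).
  by apply: bmeasM_int; [exact: bmeas_cpoly|exact: sqintegrable_int].
have i3 : rintegrable lam (fun t => cpoly m i r t * cpoly m i r t).
  by apply: bmeas_int; apply: bmeasM; exact: bmeas_cpoly.
have -> : \int[lam]_t (cellind m i t * (h t - q.[t]) ^+ 2) =
    \int[lam]_t (cellind m i t * e t ^+ 2 + (-2) * (cpoly m i r t * e t) +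
                 cpoly m i r t * cpoly m i r t).
  apply: eq_Rintegral => t _.
  have := @kint_kappa_cell _ k m h t i im hi1; rewrite /cpoly /e /r hornerD hornerN => E.
  have c1 := cellind_sq m i t.
  have [c0|c0] : cellind m i t = 0 \/ cellind m i t = 1.
  - by rewrite /cellind; case: (_ <= _ < _); [right|left].
  - by rewrite c0; ring.
  - by move: E; rewrite c0 !mul1r => ->; ring.
rewrite E1 !RintegralDT//; last 2 first.
- exact: rintegrableZ.
- by apply: rintegrableD => //; exact: rintegrableZ.
rewrite RintegralZT// (corth_kappa hi1 im sr) mulr0 addr0 lerDl.
by apply: Rintegral_ge0 => t _; rewrite -expr2 sqr_ge0.
Qed.

Lemma Pi1_error m v : prim_chain k.+1 v ->
  \int[lam]_t ((v 0%N t - kint (kappa k m) (v 0%N) t) ^+ 2) <=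
  (2^-1 ^+ (m * k.+1)) ^+ 2 * \int[lam]_t (v k.+1 t ^+ 2).
Proof.
move=> vc; have [vi _] := vc; have v0i := vi 0%N isT.
have ei : sqintegrable lam (fun t => v 0%N t - kint (kappa k m) (v 0%N) t).
  apply: sqintegrableB => //; apply: bmeas_sqintegrable; apply: bmeas_kint; first exact: bkernel_kappa.
  exact: sqintegrable_int.
have ci i h : sqintegrable lam h -> rintegrable lam (fun t => cellind m i t * h t ^+ 2).
  by case=> _ ?; apply: bmeasM_int => //; exact: bmeas_cellind.
rewrite (@Rintegral_sum_cells _ m) => [|i]; last exact: ci.
rewrite [leRHS](_ : _ = \sum_(i < 2 ^ m) ((2^-1 ^+ (m * k.+1)) ^+ 2 *
    \int[lam]_t (cellind m i t * v k.+1 t ^+ 2))); last first.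
  by rewrite -mulr_sumr -(@Rintegral_sum_cells _ m)// => i; apply: ci; exact: vi.
apply: ler_sum => i _; have [q sq qle] := cell_approx (ltn_ord i) vc.
exact: le_trans (proj_le_cell (ltn_ord i) sq v0i) qle.
Qed.

(** Up to sign, the error is the primitive of the projection error of the derivative, and it
    vanishes at the nodes. Poincare's inequality contributes one factor 2^-m, and [Pi1_error] for
    the derivative contributes the other k+1. *)
Lemma Pi0_error m c v : prim_chain k.+2 v -> ae_eq lam setT (v 0%N) (fun t => c + prim (v 1%N) t) ->
  \int[lam]_t ((v 0%N t - (c + prim (kint (kappa k m) (v 1%N)) t)) ^+ 2) <=
  (2^-1 ^+ (m * k.+2)) ^+ 2 * \int[lam]_t (v k.+2 t ^+ 2).
Proof.
move=> vc vE; have [vi _] := vc; have v1i := vi 1%N isT; have v1i' := sqintegrable_int v1i.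
have kb : bmeas (kint (kappa k m) (v 1%N) : measurableTypeR R -> R).
  by apply: bmeas_kint => //; exact: bkernel_kappa.
pose e t := kint (kappa k m) (v 1%N) t - v 1%N t.
have ei : sqintegrable lam e by apply: sqintegrableB => //; exact: bmeas_sqintegrable.
have ei1 := sqintegrable_int ei.
have -> : \int[lam]_t ((v 0%N t - (c + prim (kint (kappa k m) (v 1%N)) t)) ^+ 2) =
    \int[lam]_t (prim e t ^+ 2).
  apply: ae_eq_Rintegral; apply: (ae_imp vE) => t /(_ Logic.I) -> _.
  by rewrite -sqrrN primBl//; [congr (_ ^+ 2); ring|exact: bmeas_int].
have ci i h : sqintegrable lam h -> rintegrable lam (fun t => cellind m i t * h t ^+ 2).
  by case=> _ ?; apply: bmeasM_int => //; exact: bmeas_cellind.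
have /ci pei : sqintegrable lam (prim e) by apply: bmeas_sqintegrable; exact: bmeas_prim.
rewrite (@Rintegral_sum_cells _ m) => [|i]; last exact: pei.
apply: (@le_trans _ _ ((2^-1 ^+ m) ^+ 2 * \int[lam]_t (e t ^+ 2))).
  rewrite [X in _ <= _ * X](@Rintegral_sum_cells _ m) => [|i]; last exact: ci.
  rewrite mulr_sumr; apply: ler_sum => i _.
  apply: le_trans (Rintegral_sqr_prim_cell (ltn_ord i) ei); rewrite le_eqVlt; apply/orP; left.
  apply/eqP; apply: eq_Rintegral => t _; rewrite (prim_node0 (i := i))// ?subr0 1?ltnW//.
  by move=> j jm; apply: (corth_cell _ jm); exact: corth_kappa.
rewrite sqr_hS -[leRHS]mulrA; apply: ler_wpM2l; first exact: sqr_ge0.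
apply: le_trans (Pi1_error m (prim_chainS vc)).
rewrite le_eqVlt; apply/orP; left; apply/eqP; apply: eq_Rintegral => t _.
by rewrite -sqrrN opprB.
Qed.

End Errors.

(** * Interpolation in one variable of the cube *)

Section OneVariable.
Context {R : realType} {d : nat} (k : nat).
Local Notation P := (@cubeP R d).
Implicit Types (f g u : 'rV[R]_d -> R) (s : 'I_d) (m : nat).

Lemma ae_cubeP : {ae P, forall x, cube x}.
Proof. by apply/ae_mrestr; apply: aeW => x. Qed.

Lemma ae_ltn d' (T : measurableType d') (mu : {measure set T -> \bar R}) (Q : nat -> T -> Prop) n :
  (forall i, (i < n)%N -> {ae mu, forall x, Q i x}) ->
  {ae mu, forall x, forall i, (i < n)%N -> Q i x}.
Proof.
elim: n => [|n IH] h; first exact: ae_all.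
have h1 : {ae mu, forall x, forall i, (i < n)%N -> Q i x} by apply: IH => i /ltnW/h.
apply: (ae_imp2 h1 (h n (ltnSn n))) => x Qi Qn i.
by rewrite ltnS leq_eqVlt => /predU1P[->|/Qi].
Qed.

Definition Proj1 s m f : 'rV[R]_d -> R := Kop s (kappa k m) f.

(** Pi^0 in the variable x_s, where g stands for the derivative of f in x_s: the constant of
    integration plus the primitive of the projected derivative. Both arguments enter through
    operators bounded on L^2. *)
Definition Proj0 s m f g : 'rV[R]_d -> R := fun x =>
  Kop s rhok f x + (Kop s tailk g x + Kop s stepk (Kop s (kappa k m) g) x).

(* The value at the left endpoint of the continuous representative on the line through [x]. *)
Definition line_cst s f g x : R :=
  kint rhok (fun t => f (set_coord x s t)) 0 + kint tailk (fun t => g (set_coord x s t)) 0.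

Lemma Proj0E s m f g x t : Proj0 s m f g (set_coord x s t) =
  line_cst s f g x + prim (kint (kappa k m) (fun t => g (set_coord x s t))) t.
Proof.
rewrite /Proj0 !Kop_line addrA; congr (_ + kint stepk _ t).
by apply/funext => v; rewrite Kop_line.
Qed.

(** The passage from weak derivatives on the cube to absolute continuity: on almost every line f is
    a genuine primitive of g, so the one-variable theory applies there. *)
Lemma ae_line_prim s f g : sqintegrable P f -> sqintegrable P g -> wD s f g ->
  {ae P, forall x, ae_eq (@lam R) setT (fun t => f (set_coord x s t))
    (fun t => line_cst s f g x + prim (fun t => g (set_coord x s t)) t)}.
Proof.
move=> fi gi fg; apply: (ae_imp (ae_line s (wD_antiderivative fi gi fg))) => x h.
by apply: (ae_imp h) => t E _; rewrite E !Kop_line.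
Qed.

Lemma ae_prim_chain s j (U : nat -> 'rV[R]_d -> R) :
  (forall i, (i <= j)%N -> sqintegrable P (U i)) ->
  (forall i, (i < j)%N -> wD s (U i) (U i.+1)) ->
  {ae P, forall x, prim_chain j (fun i t => U i (set_coord x s t))}.
Proof.
move=> Ui UD.
have h1 := @ae_ltn _ _ P (fun i x => sqintegrable lam (fun t => U i (set_coord x s t))) j.+1
  (fun i ij => ae_sqintegrable_line s (Ui i ij)).
have h2 := @ae_ltn _ _ P (fun i x => ae_eq (@lam R) setT (fun t => U i (set_coord x s t))
    (fun t => line_cst s (U i) (U i.+1) x + prim (fun t => U i.+1 (set_coord x s t)) t)) j
  (fun i ij => ae_line_prim (Ui i (ltnW ij)) (Ui i.+1 ij) (UD i ij)).
apply: (ae_imp2 h1 h2) => x c1 c2; split => i ij; first exact: c1.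
by exists (line_cst s (U i) (U i.+1) x); exact: c2.
Qed.

Lemma Proj1_sq s m f : sqintegrable P f -> sqintegrable P (Proj1 s m f).
Proof. by apply: Kop_sqintegrable; exact: bkernel_kappa. Qed.

Lemma Proj0_sq s m f g : sqintegrable P f -> sqintegrable P g -> sqintegrable P (Proj0 s m f g).
Proof.
move=> fi gi; apply: sqintegrableD; first exact: (Kop_sqintegrable _ bkernel_rhok).
apply: sqintegrableD; first exact: (Kop_sqintegrable _ bkernel_tailk).
by apply: (Kop_sqintegrable _ bkernel_stepk); exact: Proj1_sq.
Qed.

Lemma Proj1_error s m (U : nat -> 'rV[R]_d -> R) :
  (forall i, (i <= k.+1)%N -> sqintegrable P (U i)) ->
  (forall i, (i < k.+1)%N -> wD s (U i) (U i.+1)) ->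
  nrm P (fun x => U 0%N x - Proj1 s m (U 0%N) x) <= 2^-1 ^+ (m * k.+1) * nrm P (U k.+1).
Proof.
move=> Ui UD; have h0 : 0 <= 2^-1 ^+ (m * k.+1) :> R by rewrite exprn_ge0.
rewrite -[X in X * _](ger0_norm h0) -nrmZ; last exact: Ui.
apply: nrm_le_sqr; apply: (@le_Rintegral_lines R d s).
- have [] // : sqintegrable P (fun x => U 0%N x - Proj1 s m (U 0%N) x).
  by apply: sqintegrableB; [|apply: Proj1_sq]; exact: Ui.
- by have [] := sqintegrableZ (2^-1 ^+ (m * k.+1)) (Ui k.+1 (leqnn _)).
apply: (ae_imp (ae_prim_chain Ui UD)) => x vc.
have [_ [_ v2]] : sqintegrable lam (fun t => U k.+1 (set_coord x s t)) /\
    sqintegrable lam (fun t => U k.+1 (set_coord x s t)) by split; case: vc => + _; exact.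
under [leRHS]eq_Rintegral do rewrite exprMn.
rewrite RintegralZT//; apply: le_trans (Pi1_error m vc).
rewrite le_eqVlt; apply/orP; left; apply/eqP; apply: eq_Rintegral => t _.
by rewrite /Proj1 Kop_line.
Qed.

Lemma Proj0_error s m (U : nat -> 'rV[R]_d -> R) :
  (forall i, (i <= k.+2)%N -> sqintegrable P (U i)) ->
  (forall i, (i < k.+2)%N -> wD s (U i) (U i.+1)) ->
  nrm P (fun x => U 0%N x - Proj0 s m (U 0%N) (U 1%N) x) <= 2^-1 ^+ (m * k.+2) * nrm P (U k.+2).
Proof.
move=> Ui UD; have h0 : 0 <= 2^-1 ^+ (m * k.+2) :> R by rewrite exprn_ge0.
rewrite -[X in X * _](ger0_norm h0) -nrmZ; last exact: Ui.
have U0i := Ui 0%N isT; have U1i := Ui 1%N isT.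
apply: nrm_le_sqr; apply: (@le_Rintegral_lines R d s).
- have [] // : sqintegrable P (fun x => U 0%N x - Proj0 s m (U 0%N) (U 1%N) x).
  by apply: sqintegrableB => //; exact: Proj0_sq.
- by have [] := sqintegrableZ (2^-1 ^+ (m * k.+2)) (Ui k.+2 (leqnn _)).
apply: (ae_imp2 (ae_prim_chain Ui UD) (ae_line_prim U0i U1i (UD 0%N isT))) => x vc v0.
have [_ [_ v2]] : sqintegrable lam (fun t => U k.+2 (set_coord x s t)) /\
    sqintegrable lam (fun t => U k.+2 (set_coord x s t)) by split; case: vc => + _; exact.
under [leRHS]eq_Rintegral do rewrite exprMn.
rewrite RintegralZT//; apply: le_trans (Pi0_error m vc v0).
rewrite le_eqVlt; apply/orP; left; apply/eqP; apply: eq_Rintegral => t _.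
by rewrite Proj0E.
Qed.

(** For almost every x, the line through x meets the set where u and f differ in a null set, and on
    a line the interpolant depends only on the class of the function. *)
Lemma in_var_Pi1 s m u f : sqintegrable P f -> {ae P, forall x, u x = f x} ->
  {ae P, forall x, in_var s (Pi1d k true m) u x = Proj1 s m f x}.
Proof.
move=> fi uf.
have h1 := ae_imp2 (ae_sqintegrable_line s fi) (ae_line s uf) (fun x a b => conj a b).
apply: (ae_imp2 ae_cubeP h1) => x x01 [fx ux]; have /andP[x0 x1] := x01 s.
by apply: Pi1d_true; [exact: sqintegrable_int|exact: ae_eqT|rewrite (ltW x0)].
Qed.

Lemma in_var_Pi0 s m u f g : sqintegrable P f -> sqintegrable P g -> wD s f g ->
  {ae P, forall x, u x = f x} ->
  {ae P, forall x, in_var s (Pi1d k false m) u x = Proj0 s m f g x}.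
Proof.
move=> fi gi fg uf.
have h1 := ae_imp2 (ae_sqintegrable_line s gi) (ae_line s uf) (fun x a b => conj a b).
apply: (ae_imp2 ae_cubeP (ae_imp2 h1 (ae_line_prim fi gi fg) (fun x a b => conj a b))).
move=> x x01 [[gx ux] fx]; have /andP[x0 x1] := x01 s.
rewrite -[in RHS](set_coord_id x s) Proj0E; apply: Pi1d_false => //; last by rewrite (ltW x0).
by apply: (ae_imp2 ux fx) => t -> h _; exact: h.
Qed.

(** The commuting relation d_s Pi^0 = Pi^1 d_s can be read off the formula: the first two terms of
    [Proj0] are constant in x_s and the third is a primitive of the projection of g. *)
Lemma wD_Proj0 s m f g : sqintegrable P f -> sqintegrable P g ->
  wD s (Proj0 s m f g) (Proj1 s m g).
Proof.
move=> fi gi; have gm := Proj1_sq s m gi.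
have rb : bmeas (@rho R : measurableTypeR R -> R) by apply: Ccinf_bmeas; exact: Ccinf_rho.
have tb : bmeas ((fun t : R => - tail rho t) : measurableTypeR R -> R).
  by apply: bmeasN; apply: bmeas_kintT; [exact: bkernel_stepk|exact: bmeas_int].
have i0 := rintegrable0 P.
have i1 := sqintegrable_int (Kop_sqintegrable s bkernel_rhok fi).
have i2 := sqintegrable_int (Kop_sqintegrable s bkernel_tailk gi).
have i3 := sqintegrable_int (Kop_sqintegrable s bkernel_stepk gm).
have i4 := sqintegrable_int gm.
have := wDD i1 (rintegrableD i2 i3) i0 (rintegrableD i0 i4) (wD_Kop_snd (s := s) rb fi)
  (wDD i2 i3 i0 i4 (wD_Kop_snd (s := s) tb gi) (wD_Kop_step (s := s) gm)).
by apply: wD_ae; apply: ae_all => x //; rewrite !add0r.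
Qed.

Lemma sop_Proj1 s m : sop s (Proj1 s m).
Proof. by apply: sop_Kop; exact: bkernel_kappa. Qed.

Lemma sop_Proj0_snd s m : sop s (fun g x => Kop s tailk g x + Kop s stepk (Kop s (kappa k m) g) x).
Proof.
apply: sop_add; first exact: (sop_Kop _ bkernel_tailk).
apply: (@sop_comp _ _ s (Kop s stepk)); first exact: (sop_Kop _ bkernel_stepk).
exact: sop_Proj1.
Qed.

End OneVariable.

(** * Sparse sums *)

Section Families.
Context {R : realType} {d : nat} (k : nat).
Local Notation P := (@cubeP R d).
Local Notation fam := (('I_d -> nat) -> 'rV[R]_d -> R).
Implicit Types (f g u : 'rV[R]_d -> R) (s t : 'I_d) (m N : nat) (q : 'I_d -> nat)
  (I : {set 'I_d}) (L : seq 'I_d) (U V : fam).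

(* A family [U] stands for the function [U 0] together with its mixed weak derivatives [U q]. *)
Definition inc s q : 'I_d -> nat := fun i => if i == s then (q i).+1 else q i.

Lemma inc_comm s t q : inc s (inc t q) = inc t (inc s q).
Proof. by apply/funext => i; rewrite /inc; case: eqP; case: eqP. Qed.

Lemma iter_inc j s q i : iter j (inc s) q i = if i == s then (j + q i)%N else q i.
Proof. by elim: j => [|j IH] /=; rewrite ?if_same// {1}/inc IH; case: eqP. Qed.

(* The multi-indices of the derivatives still available once the operators in the variables
   of [L] have been applied. *)
Definition adm I L q := (forall i, (q i <= reg_order k I i)%N) /\ (forall i, i \in L -> q i = 0%N).

Lemma adm_inc I L s q : adm I L (inc s q) -> adm I L q.
Proof.
move=> [h1 h2]; split => i.
  by apply: leq_trans (h1 i); rewrite /inc; case: eqP.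
by move/h2; rewrite /inc; case: eqP.
Qed.

Lemma adm_cons I L s q : adm I (s :: L) q -> adm I L q.
Proof. by move=> [h1 h2]; split => // i iL; apply: h2; rewrite inE iL orbT. Qed.

Lemma adm_iter I L s q j : s \notin L -> adm I (s :: L) q -> (j <= reg_order k I s)%N ->
  adm I L (iter j (inc s) q).
Proof.
move=> sL [h1 h2] js; split=> i; rewrite iter_inc; case: eqP => [->|//].
  by rewrite h2 ?mem_head// addn0.
by rewrite (negbTE sL).
- by move=> _ iL; apply: h2; rewrite inE iL orbT.
Qed.

Lemma reg_order_gt0 I s : (0 < reg_order k I s)%N.
Proof. by rewrite /reg_order; case: ifP. Qed.

Lemma adm_cons_inc I L s q : s \notin L -> adm I (s :: L) q -> adm I L (inc s q).
Proof. by move=> sL qa; apply: (@adm_iter _ _ _ _ 1) => //; exact: reg_order_gt0. Qed.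

Lemma adm0 I L : adm I L (fun=> 0%N).
Proof. by []. Qed.

Definition reg I L U :=
  (forall q, adm I L q -> sqintegrable P (U q)) /\
  (forall q s, s \notin L -> adm I L (inc s q) -> wD s (U q) (U (inc s q))).

Lemma reg_sq I L U q : reg I L U -> adm I L q -> sqintegrable P (U q).
Proof. by case=> h _; exact: h. Qed.

Lemma reg_int I L U q : reg I L U -> adm I L q -> rintegrable P (U q).
Proof. by move=> h /(reg_sq h); exact: sqintegrable_int. Qed.

Lemma reg_sum I L (X : Type) (r : seq X) (Q : pred X) (F : X -> fam) :
  (forall i, Q i -> reg I L (F i)) -> reg I L (fun q x => \sum_(i <- r | Q i) F i q x).
Proof.
move=> h; split=> [q qa|q s sL qa].
  by apply: sqintegrable_sum => i /h Fi; exact: (reg_sq Fi).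
apply: wD_sum => i /h Fi; [exact: (reg_int Fi (adm_inc qa))|exact: (reg_int Fi qa)|].
by case: Fi => _; apply.
Qed.

Lemma regZ I L c U : reg I L U -> reg I L (fun q x => c * U q x).
Proof.
move=> h; split=> [q qa|q s sL qa]; first by apply: sqintegrableZ; exact: (reg_sq h).
apply: wDZ; [exact: (reg_int h (adm_inc qa))|exact: (reg_int h qa)|].
by case: h => _; apply.
Qed.

Lemma regB I L U V : reg I L U -> reg I L V -> reg I L (fun q x => U q x - V q x).
Proof.
move=> h h'; split=> [q qa|q s sL qa].
  by apply: sqintegrableB; [exact: (reg_sq h)|exact: (reg_sq h')].
apply: wDB; [exact: (reg_int h (adm_inc qa))|exact: (reg_int h' (adm_inc qa))|
  exact: (reg_int h qa)|exact: (reg_int h' qa)| |].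
  by case: h => _; apply.
by case: h' => _; apply.
Qed.

(** Induction on the total order of q: two families that agree at a lower order have there the same
    weak derivatives, which are unique. *)
Lemma reg_unique I U V : reg I [::] U -> reg I [::] V ->
  {ae P, forall x, U (fun=> 0%N) x = V (fun=> 0%N) x} ->
  forall q, adm I [::] q -> {ae P, forall x, U q x = V q x}.
Proof.
move=> Ur Vr UV0 q; move: {2}(\sum_i q i)%N (erefl (\sum_i q i)%N) => n.
elim: n q => [|n IH] q.
  move=> /eqP; rewrite sum_nat_eq0 => /forallP q0 _.
  by have -> : q = fun=> 0%N by apply/funext => i; apply/eqP/(q0 i).
move=> qn qa; have [s qs] : exists s, (0 < q s)%N.
  apply: contrapT => /forallNP h; move: qn; rewrite big1// => i _.
  by apply/eqP; rewrite -leqn0 leqNgt; apply/negP; exact: h.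
pose q' i := if i == s then (q i).-1 else q i.
have qE : q = inc s q' by apply/funext => i; rewrite /inc /q'; case: eqP => // ->; rewrite prednK.
have qn' : (\sum_i q' i)%N = n.
  apply/eqP; rewrite -eqSS -qn (bigD1 s)//= [X in _ == X](bigD1 s)//= {1}/q' eqxx.
  rewrite -addSn prednK// eqn_add2l; apply/eqP; apply: eq_bigr => i.
  by rewrite /q' => /negbTE ->.
move: qa; rewrite qE => qa; have UV := IH q' qn' (adm_inc qa).
case: (Ur) (Vr) => _ UD [_ VD].
apply: (wD_unique (reg_int Ur qa) (reg_int Vr qa)); first exact: UD.
by apply: (wD_ae _ _ (VD _ _ _ qa)) => //; [apply: (ae_imp UV) => x ->|exact: ae_all].
Qed.

Section TwoTermOperators.
Variables (s : 'I_d) (A B : ('rV[R]_d -> R) -> 'rV[R]_d -> R).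
Hypotheses (sA : sop s A) (sB : sop s B).

(** The common shape of all the operators used: Pi^1 has B = 0, and Pi^0 reads the derivative in x_s
    through B. *)
Definition fop U : fam := fun q x => A (U q) x + B (U (inc s q)) x.

Lemma fop_reg I L U : s \notin L -> reg I L U -> reg I (s :: L) (fop U).
Proof.
move=> sL Ur; have Asq q : adm I L q -> sqintegrable P (A (U q)).
  by move=> qa; exact: (sop_sq sA (reg_sq Ur qa)).
have Bsq q : adm I L q -> sqintegrable P (B (U q)).
  by move=> qa; exact: (sop_sq sB (reg_sq Ur qa)).
split=> [q qa|q t].
  by apply: sqintegrableD; [exact/Asq/adm_cons/qa|exact/Bsq/adm_cons_inc].
rewrite inE negb_or => /andP[ts tL] qa.
have a1 := adm_cons qa; have a2 := adm_cons_inc sL qa.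
have a3 := adm_inc a1; have a4 : adm I L (inc s q).
  by apply: (adm_cons_inc sL); exact: adm_inc qa.
have UD := proj2 Ur.
apply: wDD; do ?[by apply: sqintegrable_int; exact: Asq|by apply: sqintegrable_int; exact: Bsq].
  by apply: (wD_sop sA); [rewrite eq_sym|exact: (reg_sq Ur a3)|exact: (reg_sq Ur a1)|exact: UD].
rewrite [inc s (inc t q)]inc_comm in a2 *.
by apply: (wD_sop sB); [rewrite eq_sym|exact: (reg_sq Ur a4)|exact: (reg_sq Ur a2)|exact: UD].
Qed.

Lemma fop_ae I L U V q : s \notin L -> reg I L U -> reg I L V ->
  (forall q, adm I L q -> {ae P, forall x, U q x = V q x}) -> adm I (s :: L) q ->
  {ae P, forall x, fop U q x = fop V q x}.
Proof.
move=> sL Ur Vr UV qa; have a1 := adm_cons qa; have a2 := adm_cons_inc sL qa.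
have h1 := sop_ae sA (reg_sq Ur a1) (reg_sq Vr a1) (UV _ a1).
have h2 := sop_ae sB (reg_sq Ur a2) (reg_sq Vr a2) (UV _ a2).
by apply: (ae_imp2 h1 h2) => x E1 E2; rewrite /fop E1 E2.
Qed.

Lemma fop_sum I L (X : Type) (r : seq X) (Q : pred X) (F : X -> fam) q : s \notin L ->
  (forall i, Q i -> reg I L (F i)) -> adm I (s :: L) q ->
  {ae P, forall x, fop (fun q x => \sum_(i <- r | Q i) F i q x) q x =
                   \sum_(i <- r | Q i) fop (F i) q x}.
Proof.
move=> sL Fr qa; have a1 := adm_cons qa; have a2 := adm_cons_inc sL qa.
have h1 := sop_sum sA r (fun i Qi => reg_sq (Fr i Qi) a1).
have h2 := sop_sum sB r (fun i Qi => reg_sq (Fr i Qi) a2).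
by apply: (ae_imp2 h1 h2) => x E1 E2; rewrite /fop E1 E2 big_split.
Qed.

Lemma fopZ I L c U q : s \notin L -> reg I L U -> adm I (s :: L) q ->
  {ae P, forall x, fop (fun q x => c * U q x) q x = c * fop U q x}.
Proof.
move=> sL Ur qa; have a1 := adm_cons qa; have a2 := adm_cons_inc sL qa.
have h1 := sopZ sA c (reg_sq Ur a1); have h2 := sopZ sB c (reg_sq Ur a2).
by apply: (ae_imp2 h1 h2) => x E1 E2; rewrite /fop E1 E2 mulrDr.
Qed.

Lemma fopB I L U V q : s \notin L -> reg I L U -> reg I L V -> adm I (s :: L) q ->
  {ae P, forall x, fop (fun q x => U q x - V q x) q x = fop U q x - fop V q x}.
Proof.
move=> sL Ur Vr qa; have a1 := adm_cons qa; have a2 := adm_cons_inc sL qa.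
have h T q' : sop s T -> adm I L q' ->
    {ae P, forall x, T (fun x => U q' x - V q' x) x = T (U q') x - T (V q') x}.
  move=> sT q'a; have u1 := reg_sq Ur q'a; have v1 := reg_sq Vr q'a.
  have -> : (fun x => U q' x - V q' x) = (fun x => U q' x + (-1) * V q' x).
    by apply/funext => x; rewrite mulN1r.
  apply: (ae_imp2 (sopD sT u1 (sqintegrableZ (-1) v1)) (sopZ sT (-1) v1)) => x -> ->.
  by rewrite mulN1r.
apply: (ae_imp2 (h _ _ sA a1) (h _ _ sB a2)) => x E1 E2; rewrite /fop E1 E2.
by ring.
Qed.

End TwoTermOperators.

Lemma fop_comm I L s t A B A' B' U q : s != t -> s \notin L -> t \notin L ->
  sop s A -> sop s B -> sop t A' -> sop t B' -> reg I L U -> adm I [:: s, t & L] q ->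
  {ae P, forall x, fop s A B (fop t A' B' U) q x = fop t A' B' (fop s A B U) q x}.
Proof.
move=> st sL tL sA sB sA' sB' Ur qa.
have qs := adm_cons qa; have q1 := adm_cons qs.
have stL : s \notin t :: L by rewrite inE negb_or st.
have q2 : adm I L (inc t q) by exact: adm_cons_inc.
have q3' : adm I (t :: L) (inc s q) by exact: adm_cons_inc.
have q3 := adm_cons q3'; have q4 : adm I L (inc t (inc s q)) by exact: adm_cons_inc.
have u1 := reg_sq Ur q1; have u2 := reg_sq Ur q2; have u3 := reg_sq Ur q3.
have u4 := reg_sq Ur q4.
have hA := sopD sA (sop_sq sA' u1) (sop_sq sB' u2).
have hB := sopD sB (sop_sq sA' u3) (sop_sq sB' u4).
have hA' := sopD sA' (sop_sq sA u1) (sop_sq sB u3).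
have hB' := sopD sB' (sop_sq sA u2) (sop_sq sB u4).
have c1 := sop_comm st sA sA' u1; have c2 := sop_comm st sA sB' u2.
have c3 := sop_comm st sB sA' u3; have c4 := sop_comm st sB sB' u4.
have h1 := ae_imp2 hA hB (fun x a b => conj a b).
have h2 := ae_imp2 hA' hB' (fun x a b => conj a b).
have h3 := ae_imp2 c1 c2 (fun x a b => conj a b).
have h4 := ae_imp2 c3 c4 (fun x a b => conj a b).
have h5 := ae_imp2 h1 h2 (fun x a b => conj a b).
have h6 := ae_imp2 h3 h4 (fun x a b => conj a b).
apply: (ae_imp2 h5 h6) => x [[e1 e2] [e3 e4]] [[e5 e6] [e7 e8]].
rewrite /fop [in RHS](inc_comm s t) e1 e2 e3 e4 e5 e6 e7 e8.
by ring.
Qed.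

End Families.

Section SparseSums.
Context {R : realType} {d : nat} (k : nat).
Local Notation P := (@cubeP R d).
Local Notation fam := (('I_d -> nat) -> 'rV[R]_d -> R).
Local Notation adm := (@adm d k).
Local Notation reg := (@reg R d k).
Implicit Types (f g u : 'rV[R]_d -> R) (s t : 'I_d) (m : 'I_d -> nat) (N j : nat)
  (q : 'I_d -> nat) (I : {set 'I_d}) (L : seq 'I_d) (U V : fam) (b : bool).

Definition ProjA b s j : ('rV[R]_d -> R) -> 'rV[R]_d -> R :=
  if b then Proj1 k s j else Kop s rhok.

Definition ProjB b s j : ('rV[R]_d -> R) -> 'rV[R]_d -> R :=
  if b then fun _ _ => 0 else fun g x => Kop s tailk g x + Kop s stepk (Kop s (kappa k j) g) x.

Lemma sop_ProjA b s j : sop s (ProjA b s j).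
Proof. by rewrite /ProjA; case: b; [exact: sop_Proj1|exact: (sop_Kop _ bkernel_rhok)]. Qed.

Lemma sop_ProjB b s j : sop s (ProjB b s j).
Proof. by rewrite /ProjB; case: b; [exact: sop_zero|exact: sop_Proj0_snd]. Qed.

Definition DeltaA b s j : ('rV[R]_d -> R) -> 'rV[R]_d -> R :=
  fun f x => ProjA b s j f x - (if j is j'.+1 then ProjA b s j' else fun _ _ => 0) f x.

Definition DeltaB b s j : ('rV[R]_d -> R) -> 'rV[R]_d -> R :=
  fun f x => ProjB b s j f x - (if j is j'.+1 then ProjB b s j' else fun _ _ => 0) f x.

Lemma sop_DeltaA b s j : sop s (DeltaA b s j).
Proof.
apply: sop_sub; first exact: sop_ProjA.
by case: j => [|j]; [exact: sop_zero|exact: sop_ProjA].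
Qed.

Lemma sop_DeltaB b s j : sop s (DeltaB b s j).
Proof.
apply: sop_sub; first exact: sop_ProjB.
by case: j => [|j]; [exact: sop_zero|exact: sop_ProjB].
Qed.

Definition ProjF b s j : fam -> fam := fop s (ProjA b s j) (ProjB b s j).
Definition DeltaF b s j : fam -> fam := fop s (DeltaA b s j) (DeltaB b s j).

Lemma DeltaF0 b s U q x : DeltaF b s 0 U q x = ProjF b s 0 U q x.
Proof. by rewrite /DeltaF /fop /DeltaA /DeltaB !subr0. Qed.

Lemma DeltaFS b s j U q x : DeltaF b s j.+1 U q x = ProjF b s j.+1 U q x - ProjF b s j U q x.
Proof. by rewrite /DeltaF /ProjF /fop /DeltaA /DeltaB opprD addrACA. Qed.

Lemma sum_DeltaF b s N U q x : \sum_(j < N.+1) DeltaF b s j U q x = ProjF b s N U q x.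
Proof.
elim: N => [|N IH]; first by rewrite big_ord1 DeltaF0.
rewrite big_ord_recr/= IH DeltaFS addrC; exact: subrK.
Qed.

Lemma ProjF_error I L s j U q : reg I L U -> s \notin L -> adm I (s :: L) q ->
  nrm P (fun x => U q x - ProjF (s \in I) s j U q x) <=
  2^-1 ^+ (j * reg_order k I s) * nrm P (U (iter (reg_order k I s) (inc s) q)).
Proof.
move=> Ur sL qa; pose W i := U (iter i (inc s) q).
have Wa i : (i <= reg_order k I s)%N -> adm I L (iter i (inc s) q) by exact: adm_iter.
have Wi i : (i <= reg_order k I s)%N -> sqintegrable P (W i).
  by move=> /Wa wa; exact: (reg_sq Ur wa).
have WD i : (i < reg_order k I s)%N -> wD s (W i) (W i.+1).
  by move=> /Wa wa; case: Ur => _; apply.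
have E (f g : 'rV[R]_d -> R) : (forall x, f x = g x) -> nrm P f = nrm P g.
  by move=> fg; apply: ae_eq_nrm; exact: ae_all.
move: Wi WD; rewrite /ProjF /fop /ProjA /ProjB /reg_order; case: ifP => sI Wi WD.
  rewrite (E _ (fun x => W 0%N x - Proj1 k s j (W 0%N) x)); first exact: Proj1_error.
  by move=> x; rewrite addr0.
exact: (Proj0_error j Wi WD).
Qed.

(** For j > 0 the increment is the error at level j - 1 minus the error at level j, and the coarser
    one accounts for the factor 2^a. For j = 0 it is U minus the error at level 0, bounded by 2
    S. *)
Lemma DeltaF_bound I L s j U q (S : R) : reg I L U -> s \notin L -> adm I (s :: L) q ->
  (forall q, adm I L q -> nrm P (U q) <= S) ->
  nrm P (DeltaF (s \in I) s j U q) <=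
  (1 + 2 ^+ reg_order k I s) * 2^-1 ^+ (j * reg_order k I s) * S.
Proof.
move=> Ur sL qa US; set a := reg_order k I s; set b := s \in I.
have a0 : adm I L q := adm_cons qa.
have S0 : 0 <= S := le_trans (nrm_ge0 _ _) (US q a0).
have aa : adm I L (iter a (inc s) q) by exact: adm_iter.
pose E i x := U q x - ProjF b s i U q x.
have Psq i : sqintegrable P (ProjF b s i U q).
  have := fop_reg (sop_ProjA b s i) (sop_ProjB b s i) sL Ur.
  by move=> h; exact: (reg_sq h qa).
have Usq := reg_sq Ur a0.
have Esq i : sqintegrable P (E i) by apply: sqintegrableB.
have Eb i : nrm P (E i) <= 2^-1 ^+ (i * a) * S.
  apply: le_trans (ProjF_error i Ur sL qa) _.
  by rewrite ler_wpM2l ?exprn_ge0//; exact: US.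
have subE (x y z : R) : y - z = (x - z) - (x - y) by ring.
have a1 : 1 <= 2 ^+ a :> R by rewrite exprn_ege1// ler1n.
case: j => [|j].
  have -> : DeltaF b s 0 U q = (fun x => U q x - E 0%N x).
    by apply/funext => x; rewrite DeltaF0 /E; ring.
  apply: le_trans (nrmB Usq (Esq _)) _.
  apply: le_trans (lerD (US q a0) (Eb 0%N)) _.
  rewrite mul0n expr0 mulr1 mul1r mulrDl mul1r lerD2l.
  by rewrite ler_peMl.
have -> : DeltaF b s j.+1 U q = (fun x => E j x - E j.+1 x).
  by apply/funext => x; rewrite DeltaFS; exact: subE.
apply: le_trans (nrmB (Esq _) (Esq _)) _.
apply: le_trans (lerD (Eb _) (Eb _)) _.
rewrite addrC mulrDl mul1r mulrDl lerD2l mulSn exprD mulrA -exprMn divff ?pnatr_eq0// expr1n mul1r.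
exact: lexx.
Qed.

(** The hierarchical surplus H_m restricted to the variables of L, with every operator in its
    two-term form. *)
Definition Fold I m L U : fam := foldr (fun s => DeltaF (s \in I) s (m s)) U L.

(** The sum of [Fold] over the multi-indices supported in L of total at most N, nested so that the
    outermost variable is exposed and the others keep the budget N - j. The error recursion needs
    this form. *)
Fixpoint SF I L U N : fam :=
  if L is s :: L' then fun q x => \sum_(j < N.+1) DeltaF (s \in I) s j (SF I L' U (N - j)) q x
  else U.

Lemma DeltaF_reg I L s b j U : s \notin L -> reg I L U -> reg I (s :: L) (DeltaF b s j U).
Proof. by move=> sL Ur; apply: fop_reg => //; [exact: sop_DeltaA|exact: sop_DeltaB]. Qed.

Lemma SF_reg I L U N : uniq L -> reg I [::] U -> reg I L (SF I L U N).
Proof.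
move=> + Ur; elim: L N => [//|s L IH] N /= /andP[sL uL].
by apply: reg_sum => j _; apply: DeltaF_reg => //; exact: IH.
Qed.

Lemma Fold_reg I m L U : uniq L -> reg I [::] U -> reg I L (Fold I m L U).
Proof.
move=> + Ur; elim: L => [//|s L IH] /= /andP[sL uL].
by apply: DeltaF_reg => //; exact: IH.
Qed.

Lemma reg_weaken I L U : reg I [::] U -> reg I L U.
Proof.
move=> [h1 h2]; split=> [q [qa _]|q s sL [qa _]]; first by apply: h1.
by apply: h2.
Qed.

(* With [s] the first variable of [s :: L], U - SF_N U = (U - Pi_(s,N) U) +
   sum_(j <= N) Delta_(s,j) (U - SF'_(N - j) U), where SF' is the sparse sum over [L]. *)
Fixpoint ebound (l : seq nat) N : R :=
  if l is a :: l' then 2^-1 ^+ (N * a) +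
    \sum_(j < N.+1) (1 + 2 ^+ a) * 2^-1 ^+ (j * a) * ebound l' (N - j)
  else 0.

Lemma SF_error I L U N q (S : R) : uniq L -> reg I [::] U ->
  (forall q, adm I [::] q -> nrm P (U q) <= S) -> adm I L q ->
  nrm P (fun x => U q x - SF I L U N q x) <= ebound [seq reg_order k I s | s <- L] N * S.
Proof.
move=> uL Ur US; elim: L uL N q => [_ N q _|s L IH /andP[sL uL] N q qa].
  rewrite /= mul0r -[leRHS](nrm0 P) le_eqVlt; apply/orP; left; apply/eqP.
  by apply: ae_eq_nrm; apply: ae_all => x; rewrite subrr.
have UrL := reg_weaken L Ur.
have Sr j := SF_reg (N - j) uL Ur.
have Er j := regB UrL (Sr j).
pose E j : fam := fun q x => U q x - SF I L U (N - j) q x.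
pose W x := U q x - ProjF (s \in I) s N U q x.
have a0 := adm_cons qa.
have Psq : sqintegrable P (ProjF (s \in I) s N U q).
  have := fop_reg (sop_ProjA (s \in I) s N) (sop_ProjB (s \in I) s N) sL UrL.
  by move=> h; exact: (reg_sq h qa).
have Wsq : sqintegrable P W by apply: sqintegrableB => //; exact: (reg_sq UrL a0).
have Dsq j : sqintegrable P (DeltaF (s \in I) s j (E j) q).
  by have := DeltaF_reg (s \in I) j sL (Er j) => h; exact: (reg_sq h qa).
have -> : nrm P (fun x => U q x - SF I (s :: L) U N q x) =
    nrm P (fun x => W x + \sum_(j < N.+1) DeltaF (s \in I) s j (E j) q x).
  apply: ae_eq_nrm.
  have h : {ae P, forall x, forall j, (j < N.+1)%N -> DeltaF (s \in I) s j (E j) q x =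
      DeltaF (s \in I) s j U q x - DeltaF (s \in I) s j (SF I L U (N - j)) q x}.
    apply: ae_ltn => j _; apply: (fopB (I := I) _ _ sL) => //.
    - exact: sop_DeltaA.
    - exact: sop_DeltaB.
    - exact: UrL.
  apply: (ae_imp h) => x hx; rewrite /= /W -(sum_DeltaF (s \in I) s N U q x).
  rewrite (_ : \sum_(j < N.+1) DeltaF _ s j (E j) q x = \sum_(j < N.+1) DeltaF (s \in I) s j U q x -
    \sum_(j < N.+1) DeltaF (s \in I) s j (SF I L U (N - j)) q x); last first.
    by rewrite -sumrB; apply: eq_bigr => j _; exact: hx.
  by rewrite addrA subrK.
pose D (j : 'I_N.+1) : 'rV[R]_d -> R := DeltaF (s \in I) s j (E j) q.
have Vsq : sqintegrable P (fun x => \sum_j D j x) by apply: sqintegrable_sum => j _; exact: Dsq.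
apply: (le_trans (nrmD Wsq Vsq)); rewrite [X in _ <= X * _]/= mulrDl; apply: lerD.
  apply: le_trans (ProjF_error N UrL sL qa) _.
  rewrite ler_wpM2l ?exprn_ge0//; apply: US.
  by case: (adm_iter sL qa (leqnn _)) => + _; split.
have nD := @nrm_sum _ _ _ P _ (index_enum 'I_N.+1) xpredT D (fun (j : 'I_N.+1) _ => Dsq j).
apply: (le_trans nD).
rewrite mulr_suml; apply: ler_sum => j _; rewrite -[leRHS]mulrA.
exact: (@DeltaF_bound I L s j (E j) q _ (Er j) sL qa (IH uL (N - j)%N)).
Qed.

Lemma in_var_Delta I L s j u U : s \notin L -> reg I L U ->
  {ae P, forall x, u x = U (fun=> 0%N) x} ->
  {ae P, forall x, in_var s (@Delta1d R k (s \in I) j) u x = DeltaF (s \in I) s j U (fun=> 0%N) x}.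
Proof.
move=> sL Ur uU; set q0 := (fun=> 0%N : nat); have a0 : adm I (s :: L) q0 by exact: adm0.
have u0 := reg_sq Ur (adm_cons a0); have u1 := reg_sq Ur (adm_cons_inc sL a0).
have uD : wD s (U q0) (U (inc s q0)) by apply: (proj2 Ur) => //; exact: adm_cons_inc.
have h i : {ae P, forall x, in_var s (@Pi1d R k (s \in I) i) u x = ProjF (s \in I) s i U q0 x}.
  rewrite /ProjF /fop /ProjA /ProjB; case: (s \in I).
    by apply: (ae_imp (@in_var_Pi1 R d k s i u _ u0 uU)) => x ->; rewrite addr0.
  by apply: (ae_imp (@in_var_Pi0 R d k s i u _ _ u0 u1 uD uU)) => x ->.
case: j => [|j].
  by apply: (ae_imp (h 0%N)) => x E; rewrite DeltaF0 -E /in_var /Delta1d subr0.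
by apply: (ae_imp2 (h j.+1) (h j)) => x E E'; rewrite DeltaFS -E -E'.
Qed.

Lemma in_var_Fold I m L u U : uniq L -> reg I [::] U ->
  {ae P, forall x, u x = U (fun=> 0%N) x} ->
  {ae P, forall x, foldr (fun s => in_var s (@Delta1d R k (s \in I) (m s))) u L x =
    Fold I m L U (fun=> 0%N) x}.
Proof.
move=> + Ur uU; elim: L => [//|s L IH] /= /andP[sL uL].
by apply: (in_var_Delta _ sL) => //; [exact: Fold_reg|exact: IH].
Qed.

(** This is the order of application in [hier_surplus], and it also puts the slow variables in
    front, as the estimate [ebound_mixed] requires. *)
Definition vars I : seq 'I_d := enum I ++ enum (~: I).

Lemma vars_uniq I : uniq (vars I).
Proof.
rewrite cat_uniq !enum_uniq andbT /=; apply/hasPn => i.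
by rewrite !mem_enum inE.
Qed.

Lemma mem_vars I i : i \in vars I.
Proof. by rewrite mem_cat !mem_enum inE orbN. Qed.

Lemma hier_surplus_foldr I m u :
  hier_surplus k I m u = foldr (fun s => in_var s (@Delta1d R k (s \in I) (m s))) u (vars I).
Proof.
rewrite /hier_surplus /Delta_prod /vars foldr_cat.
have H b (L : seq 'I_d) v : {in L, forall s, (s \in I) = b} ->
    foldr (fun s => in_var s (@Delta1d R k b (m s))) v L =
    foldr (fun s => in_var s (@Delta1d R k (s \in I) (m s))) v L.
  elim: L => [//|s L IH] h /=; congr (in_var s (Delta1d k _ (m s)) _).
    by rewrite h ?mem_head.
  by apply: IH => t tL; apply: h; rewrite inE tL orbT.
rewrite -(H true); last by move=> s; rewrite mem_enum.
by rewrite -(H false)// => s; rewrite mem_enum inE => /negbTE.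
Qed.

Lemma hier_surplus_Fold I m u U : reg I [::] U -> {ae P, forall x, u x = U (fun=> 0%N) x} ->
  {ae P, forall x, hier_surplus k I m u x = Fold I m (vars I) U (fun=> 0%N) x}.
Proof.
by move=> Ur uU; rewrite hier_surplus_foldr; apply: in_var_Fold => //; exact: vars_uniq.
Qed.

End SparseSums.

Lemma ae_fin d' (T : measurableType d') (R : realType) (mu : {measure set T -> \bar R})
    (X : finType) (Q : X -> T -> Prop) :
  (forall e, {ae mu, forall x, Q e x}) -> {ae mu, forall x, forall e, Q e x}.
Proof.
move=> h; have H i : (i < #|X|)%N -> {ae mu, forall x, forall e, enum_rank e = i :> nat -> Q e x}.
  move=> iN; apply: (ae_imp (h (enum_val (Ordinal iN)))) => x Qx e ei.
  suff -> : e = enum_val (Ordinal iN) by [].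
  by apply: enum_rank_inj; rewrite enum_valK; exact: val_inj.
by apply: (ae_imp (ae_ltn H)) => x hx e; exact: (hx (enum_rank e)).
Qed.

(** * From nested sums to the sum over multi-indices *)

Section Reindexing.
Context {R : realType} {d : nat} (k : nat).
Local Notation P := (@cubeP R d).
Local Notation fam := (('I_d -> nat) -> 'rV[R]_d -> R).
Local Notation adm := (@adm d k).
Local Notation reg := (@reg R d k).
Implicit Types (s t : 'I_d) (m : 'I_d -> nat) (N j : nat)
  (q : 'I_d -> nat) (I : {set 'I_d}) (L : seq 'I_d) (U V : fam).

Lemma adm_mem I L L' q : L =i L' -> adm I L q -> adm I L' q.
Proof. by move=> LL [h1 h2]; split => // i iL; apply: h2; rewrite LL. Qed.

Lemma reg_mem I L L' U : L =i L' -> reg I L U -> reg I L' U.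
Proof.
move=> LL [h1 h2]; have LL' : L' =i L by move=> i; rewrite LL.
split=> [q /(adm_mem LL')/h1//|q s sL /(adm_mem LL') qa].
by apply: h2 => //; rewrite LL.
Qed.

Lemma mem_cons_rem s L : uniq L -> s \in L -> s :: rem s L =i L.
Proof. by move=> uL sL i; rewrite (perm_mem (perm_to_rem sL)). Qed.

(** The operator in x_s is commuted to the front, past those of the preceding variables. It serves
    to compare index sets with and without s, for which [vars] lists s at different places. *)
Lemma Fold_rem I m L U s q : uniq L -> reg I [::] U -> s \in L -> adm I L q ->
  {ae P, forall x, Fold k I m L U q x = Fold k I m (s :: rem s L) U q x}.
Proof.
move=> + Ur; elim: L q => [//|a L IH] q /andP[aL uL]; rewrite inE => /predU1P[->|sL] qa.
  by apply: ae_all => x; rewrite /= eqxx.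
have as_ : a != s by apply: contraNneq aL => ->.
rewrite [rem _ _]/= (negbTE as_).
have uR : uniq (rem s L) by exact: rem_uniq.
have sR : s \notin rem s L by rewrite mem_rem_uniqF.
have aR : a \notin rem s L by apply: contra aL; exact: mem_rem.
have VR := Fold_reg m uR Ur.
have RL := mem_cons_rem uL sL.
have r1 := Fold_reg m uL Ur.
have r2 : reg I L (Fold k I m (s :: rem s L) U).
  by apply: (reg_mem RL); apply: DeltaF_reg.
have qb : adm I [:: a, s & rem s L] q.
  by apply: adm_mem qa => i; rewrite inE -RL inE.
have h1 := @fop_ae _ _ _ _ _ _ (sop_DeltaA k (a \in I) a (m a)) (sop_DeltaB k (a \in I) a (m a)) I L _ _ q aL r1 r2
  (fun q' q'a => IH q' uL sL q'a) qa.
have h2 := @fop_comm _ _ _ I _ a s _ _ _ _ _ q as_ aR sR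
  (sop_DeltaA k (a \in I) a (m a)) (sop_DeltaB k (a \in I) a (m a))
  (sop_DeltaA k (s \in I) s (m s)) (sop_DeltaB k (s \in I) s (m s)) VR qb.
by apply: (ae_imp2 h1 h2) => x E1 E2; rewrite [LHS]E1.
Qed.

Section FiniteSums.
Variable M : nat.
Implicit Types (e : {ffun 'I_d -> 'I_M.+1}).

(** Multi-indices in the variables of L are encoded as multi-indices in all variables that vanish
    outside L, so that the induction on L stays within one finite type. *)
Definition supp L e := [forall i, (i \notin L) ==> (e i == ord0)].
Definition msum e := (\sum_i e i)%N.
Definition setm e s (j : 'I_M.+1) : {ffun 'I_d -> 'I_M.+1} := [ffun i => if i == s then j else e i].

Lemma eq_Fold I m m' L U : {in L, m =1 m'} -> Fold k I m L U = Fold k I m' L U.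
Proof.
elim: L => [//|s L IH] h; rewrite /= h ?mem_head// IH// => i iL.
by apply: h; rewrite inE iL orbT.
Qed.

Lemma msum_setm e s (j : 'I_M.+1) : e s = ord0 -> msum (setm e s j) = (j + msum e)%N.
Proof.
move=> es; rewrite /msum (bigD1 s)//= [in RHS](bigD1 s)//= es add0n ffunE eqxx.
by congr (_ + _)%N; apply: eq_bigr => i /negbTE is_; rewrite ffunE is_.
Qed.

Lemma sum_ffun_cons (F : {ffun 'I_d -> 'I_M.+1} -> R) s L N : s \notin L -> (N <= M)%N ->
  \sum_(e | supp (s :: L) e && (msum e <= N)%N) F e =
  \sum_(j < M.+1 | (j < N.+1)%N) \sum_(e | supp L e && (msum e <= N - j)%N) F (setm e s j).
Proof.
move=> sL NM; rewrite (partition_big (fun e => e s) xpredT)//= [RHS]big_mkcond/=.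
apply: eq_bigr => j _.
(* A multi-index with entry j at s corresponds to the one with that entry erased, which is supported
   in L. *)
rewrite (reindex_onto (fun e => setm e s j) (fun e => setm e s ord0)); last first.
  move=> e /andP[_ /eqP ej]; apply/ffunP => i; rewrite !ffunE; case: eqP => // ->.
  by rewrite ej.
case: ifPn => jN; last first.
  apply: big_pred0 => e; apply/negP => /andP[/andP[/andP[_ te] _] _].
  move: jN; rewrite ltnS => /negP; apply; apply: leq_trans te.
  by rewrite /msum (bigD1 s)//= ffunE eqxx leq_addr.
apply: eq_bigl => e; rewrite [setm e s j s]ffunE eqxx eqxx andbT.
have E0 : (setm (setm e s j) s ord0 == e) = (e s == ord0).
  apply/eqP/eqP => [<-|es]; first by rewrite ffunE eqxx.
  by apply/ffunP => i; rewrite !ffunE; case: eqP => // ->.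
rewrite E0; have [es|es] := eqVneq (e s) ord0; last first.
  rewrite andbF; apply/esym/negP => /andP[/forallP/(_ s)].
  by rewrite sL (negbTE es).
rewrite andbT msum_setm// leq_subRL//; congr (_ && _).
apply/forallP/forallP => h i; apply/implyP => iL.
  have [->|is_] := eqVneq i s; first exact/eqP.
  have := h i; rewrite inE (negbTE is_) /= => /implyP/(_ iL).
  by rewrite ffunE (negbTE is_).
move: iL; rewrite inE negb_or ffunE => /andP[/negbTE -> iL].
by have := h i; rewrite iL.
Qed.

Lemma sum_Fold I L U N q : uniq L -> (N <= M)%N -> reg I [::] U -> adm I L q ->
  {ae P, forall x, \sum_(e | supp L e && (msum e <= N)%N) Fold k I (fun i => e i) L U q x =
                   SF k I L U N q x}.
Proof.
move=> + + Ur; elim: L N q => [|s L IH] N q uL NM qa.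
  apply: ae_all => x /=; rewrite (big_pred1 [ffun=> ord0])// => e /=.
  apply/andP/eqP => [[/forallP h _]|->].
    by apply/ffunP => i; rewrite ffunE; apply/eqP; apply: (implyP (h i)).
  split; first by apply/forallP => i; rewrite ffunE.
  by rewrite /msum big1// => i _; rewrite ffunE.
case/andP: uL => sL uL.
have Fr j : reg I L (fun q x => \sum_(e | supp L e && (msum e <= N - j)%N)
    Fold k I (fun i => e i) L U q x).
  by apply: reg_sum => e _; exact: Fold_reg.
have h j : (j < N.+1)%N -> {ae P, forall x,
    \sum_(e | supp L e && (msum e <= N - j)%N)
      DeltaF k (s \in I) s j (Fold k I (fun i => e i) L U) q x =
    DeltaF k (s \in I) s j (SF k I L U (N - j)) q x}.
  move=> jN; have h1 := @fop_sum _ _ _ _ _ _ (sop_DeltaA k (s \in I) s j) (sop_DeltaB k (s \in I) s j) I L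
     _ (index_enum {ffun 'I_d -> 'I_M.+1}) (fun e => supp L e && (msum e <= N - j)%N)
     (fun e => Fold k I (fun i => e i) L U) q sL
     (fun e _ => Fold_reg _ uL Ur) qa.
  have NjM : (N - j <= M)%N by rewrite (leq_trans (leq_subr _ _)).
  have h2 := @fop_ae _ _ _ _ _ _ (sop_DeltaA k (s \in I) s j) (sop_DeltaB k (s \in I) s j) I L
    _ _ q sL (Fr j) (SF_reg (N - j) uL Ur) (fun q' q'a => IH (N - j)%N q' uL NjM q'a) qa.
  by apply: (ae_imp2 h1 h2) => x E1 E2; rewrite -[LHS]E1 [LHS]E2.
apply: (ae_imp (ae_ltn h)) => x hx.
rewrite (sum_ffun_cons _ sL NM) [RHS]/= [RHS](big_ord_widen M.+1 (fun j =>
  DeltaF k (s \in I) s j (SF k I L U (N - j)) q x))//.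
apply: eq_bigr => j jN; rewrite -hx//; apply: eq_bigr => e _ /=.
rewrite ffunE eqxx (@eq_Fold I (fun i => setm e s j i) (fun i => e i))// => i iL.
by rewrite ffunE; case: eqP => // E; move: sL; rewrite -E iL.
Qed.

End FiniteSums.

Lemma sum_Fold_vars I U N : reg I [::] U -> {ae P, forall x,
  \sum_(e : {ffun 'I_d -> 'I_N.+1} | (msum e <= N)%N)
    Fold k I (fun i => e i) (vars I) U (fun=> 0%N) x = SF k I (vars I) U N (fun=> 0%N) x}.
Proof.
move=> Ur; apply: (ae_imp (sum_Fold (vars_uniq I) (leqnn N) Ur (adm0 k I (vars I)))) => x <-.
apply: eq_bigl => e; rewrite /supp (_ : [forall i, _] = true)//.
by apply/forallP => i; rewrite mem_vars.
Qed.

Lemma sparse_interp_SF n I u U : (0 < d)%N -> reg I [::] U ->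
  {ae P, forall x, u x = U (fun=> 0%N) x} ->
  {ae P, forall x, sparse_interp_coef k n I u x = SF k I (vars I) U (n + d - 1) (fun=> 0%N) x}.
Proof.
move=> d0 Ur uU.
(* The entries in the definition range over ['I_(n + d)], which has the form ['I_M.+1] with M = n +
   d - 1 because d > 0; the bound is generalized to allow the substitution. *)
suff H K M : K = M.+1 -> {ae P, forall x,
    \sum_(e : {ffun 'I_d -> 'I_K} | (\sum_i e i <= M)%N) hier_surplus k I (fun i => e i : nat) u x =
    SF k I (vars I) U M (fun=> 0%N) x}.
  by apply: H; rewrite subn1 prednK// addn_gt0 d0 orbT.
move=> ->; have hs := sum_Fold_vars M Ur.
have hF : {ae P, forall x, forall e : {ffun 'I_d -> 'I_M.+1},
    hier_surplus k I (fun i => e i : nat) u x = Fold k I (fun i => e i : nat) (vars I) U (fun=> 0%N) x}.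
  by apply: ae_fin => e; exact: hier_surplus_Fold.
by apply: (ae_imp2 hs hF) => x <- hx; apply: eq_bigr => e _; exact: hx.
Qed.

End Reindexing.

(** * Convergence rates *)

Section Rates.
Context {R : realType}.
Implicit Types (a p N M : nat) (l : seq nat).
Local Notation ebound := (@ebound R).
Local Notation c a := (1 + 2 ^+ a : R).

Lemma ebound_ge0 l N : 0 <= ebound l N.
Proof.
elim: l N => [//|a l IH] N /=; rewrite addr_ge0 ?exprn_ge0//.
by apply: sumr_ge0 => j _; rewrite !mulr_ge0 ?exprn_ge0 ?addr_ge0.
Qed.

(** When the new variable decays at the same rate as the bound for the others, all N+1 terms of the
    convolution have the same size, which costs one power of N+1. *)
Lemma ebound_cons_same a p l (C : R) : 0 <= C ->
  (forall N, ebound l N <= C * (2^-1 ^+ (N * a) * N.+1%:R ^+ p)) ->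
  forall N, ebound (a :: l) N <= (1 + c a * C) * (2^-1 ^+ (N * a) * N.+1%:R ^+ p.+1).
Proof.
move=> C0 h N /=; set H := 2^-1 ^+ (N * a) : R; have H0 : 0 <= H by rewrite exprn_ge0.
have c0 : 0 <= c a by rewrite addr_ge0 ?exprn_ge0.
have N1 : 1 <= N.+1%:R ^+ p.+1 :> R by rewrite exprn_ege1// ler1n.
rewrite mulrDl mul1r; apply: lerD; first by rewrite ler_peMr.
apply: (@le_trans _ _ (\sum_(j < N.+1) c a * C * (H * N.+1%:R ^+ p))).
  apply: ler_sum => j _; rewrite -!mulrA; apply: ler_wpM2l => //.
  apply: (@le_trans _ _ (2^-1 ^+ (j * a) * (C * (2^-1 ^+ ((N - j) * a) * N.+1%:R ^+ p)))).
    apply: ler_wpM2l; first exact: exprn_ge0.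
    apply: le_trans (h _) _; apply: ler_wpM2l => //; apply: ler_wpM2l; first exact: exprn_ge0.
    by rewrite lerXn2r ?nnegrE// ler_nat ltnS leq_subr.
  rewrite mulrCA; apply: ler_wpM2l => //; rewrite mulrA -exprD -mulnDl subnKC//.
  by rewrite -ltnS.
by rewrite sumr_const card_ord -[leLHS]mulr_natr -!mulrA -exprSr.
Qed.

Lemma ebound_nseq a f : exists2 C : R, 0 <= C &
  forall N, ebound (nseq f.+1 a) N <= C * (2^-1 ^+ (N * a) * N.+1%:R ^+ f).
Proof.
elim: f => [|f [C C0 IH]].
  exists 1 => // N /=; rewrite big1 => [|j _]; last by rewrite mulr0.
  by rewrite addr0 mul1r mulr1.
exists (1 + c a * C); last exact: ebound_cons_same.
by rewrite addr_ge0// mulr_ge0// addr_ge0// exprn_ge0.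
Qed.

(** Young's inequality for the convolution with the sequence 2^-j, whose sum is 2. *)
Lemma sum_geometric_conv (g : nat -> R) M : (forall N, 0 <= g N) ->
  \sum_(N < M) \sum_(j < N.+1) 2^-1 ^+ j * g (N - j)%N <= 2 * \sum_(N < M) g N.
Proof.
move=> g0; pose F N := \sum_(j < N.+1) 2^-1 ^+ j * g (N - j)%N.
have F0 N : 0 <= F N by apply: sumr_ge0 => j _; rewrite mulr_ge0 ?exprn_ge0.
have FS N : F N.+1 = g N.+1 + 2^-1 * F N.
  rewrite /F big_ord_recl/= expr0 mul1r subn0 mulr_sumr; congr (_ + _).
  by apply: eq_bigr => j _; rewrite /bump /= add1n subSS exprS mulrA.
(* The recursion F (N+1) = g (N+1) + F N / 2 makes this an exact identity; nonnegativity of F then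
   gives the bound. *)
suff H : \sum_(N < M.+1) F N + F M = 2 * \sum_(N < M.+1) g N.
  case: M H => [_|M H]; first by rewrite !big_ord0 mulr0.
  have : \sum_(N < M.+2) F N + F M.+1 = 2 * \sum_(N < M.+2) g N by exact: H.
  rewrite !(big_ord_recr M.+1)/= FS => E.
  have := F0 M; have := g0 M.+1; rewrite -/(F _).
  have -> : \sum_(i < M.+1) F i = 2 * \sum_(N < M.+1) g N - F M by lra.
  by lra.
elim: M => [|M IH]; first by rewrite !big_ord1 /F big_ord1 expr0 mul1r; ring.
by rewrite big_ord_recr/= FS [in RHS]big_ord_recr/= [RHS]mulrDr -IH; field.
Qed.

(** Multiplied by 2^(a N), the bound for variables of rate a+1 satisfies a recursion made of 2^-N
    and a convolution with 2^-j. The weighted bounds stay summable, so no power of N appears. *)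
Lemma ebound_nseq_sum a f : exists2 C : R, 0 <= C &
  forall M, \sum_(N < M) 2 ^+ (N * a) * ebound (nseq f a.+1) N <= C.
Proof.
elim: f => [|f [C C0 IH]].
  by exists 0 => // M; rewrite big1// => N _; rewrite mulr0.
have c0 : 0 <= c a.+1 by rewrite addr_ge0 ?exprn_ge0.
exists (2 + c a.+1 * (2 * C)); first by rewrite addr_ge0// !mulr_ge0.
move=> M; pose g N := 2 ^+ (N * a) * ebound (nseq f a.+1) N.
have g0 N : 0 <= g N by rewrite mulr_ge0 ?exprn_ge0// ebound_ge0.
have two_half (n : nat) : 2 ^+ n * 2^-1 ^+ n = 1 :> R.
  by rewrite -exprMn divff ?pnatr_eq0// expr1n.
have E N : 2 ^+ (N * a) * ebound (nseq f.+1 a.+1) N =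
    2^-1 ^+ N + c a.+1 * \sum_(j < N.+1) 2^-1 ^+ j * g (N - j)%N.
  rewrite /= mulrDr; congr (_ + _); first by rewrite mulnS addnC exprD mulrA two_half mul1r.
  rewrite !mulr_sumr; apply: eq_bigr => j _; rewrite /g.
  have jN : (j <= N)%N by rewrite -ltnS.
  rewrite -{1}(subnKC jN) mulnDl mulnS !exprD.
  transitivity (2 ^+ (j * a) * 2^-1 ^+ (j * a) * (c a.+1 * (2^-1 ^+ j * (2 ^+ ((N - j) * a) *
    ebound (nseq f a.+1) (N - j))))); first by ring.
  by rewrite two_half mul1r.
under eq_bigr do rewrite E.
rewrite big_split/= -mulr_sumr; apply: lerD; last first.
  by apply: ler_wpM2l => //; apply: le_trans (sum_geometric_conv M g0) _; apply: ler_wpM2l.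
have -> : \sum_(i < M) 2^-1 ^+ i = 2 - 2 * 2^-1 ^+ M :> R.
  elim: M => [|M IHM]; first by rewrite big_ord0 expr0; ring.
  by rewrite big_ord_recr/= IHM exprS; field.
by rewrite gerBl mulr_ge0// exprn_ge0.
Qed.

(** The innermost slow variable convolves 2^(-a j) with the fast bounds, which are summable after
    multiplication by 2^(a N): it costs only a constant. Each further slow variable then costs one
    power of N+1. *)
Lemma ebound_mixed a j f : exists2 C : R, 0 <= C &
  forall N, ebound (nseq j.+1 a ++ nseq f a.+1) N <= C * (2^-1 ^+ (N * a) * N.+1%:R ^+ j).
Proof.
elim: j => [|j [C C0 IH]]; last first.
  exists (1 + c a * C); last exact: ebound_cons_same.
  by rewrite addr_ge0// mulr_ge0// addr_ge0// exprn_ge0.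
have [C C0 h] := ebound_nseq_sum a f.
have c0 : 0 <= c a by rewrite addr_ge0 ?exprn_ge0.
exists (1 + c a * C); first by rewrite addr_ge0// mulr_ge0.
move=> N /=; rewrite expr0 mulr1 mulrDl mul1r lerD2l.
set H := 2^-1 ^+ (N * a); have H0 : 0 <= H by rewrite exprn_ge0.
apply: (@le_trans _ _ (c a * (\sum_(i < N.+1) 2 ^+ (i * a) * ebound (nseq f a.+1) i) * H)); last first.
  by rewrite ler_wpM2r// ler_wpM2l.
rewrite -mulrA mulr_suml mulr_sumr (reindex_inj rev_ord_inj)/=; apply: ler_sum => j _.
have jN : (j <= N)%N by rewrite -ltnS.
rewrite subSS subKn// -[leLHS]mulrA ler_wpM2l//.
have -> : H = 2^-1 ^+ (j * a) * 2^-1 ^+ ((N - j) * a) by rewrite -exprD -mulnDl subnKC.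
rewrite le_eqVlt; apply/orP; left; apply/eqP.
have two_half : 2 ^+ (j * a) * 2^-1 ^+ (j * a) = 1 :> R.
  by rewrite -exprMn divff ?pnatr_eq0// expr1n.
transitivity (2 ^+ (j * a) * 2^-1 ^+ (j * a) * (2^-1 ^+ ((N - j) * a) * ebound (nseq f a.+1) j)).
  by rewrite two_half mul1r.
by ring.
Qed.

Lemma ebound_E_rate k d j : (0 < d)%N -> exists2 C : R, 0 <= C &
  forall n, ebound (nseq j k.+1 ++ nseq (d - j) k.+2) (n + d - 1) <= C * E_rate R j k d n.
Proof.
move=> d0.
(* Passing from the level N = n + d - 1 to n costs the constant d^p, since N + 1 = n + d <= d (n +
   1), while the power of 2 only improves. *)
have shift a p (C : R) (l : seq nat) : 0 <= C ->
    (forall N, ebound l N <= C * (2^-1 ^+ (N * a) * N.+1%:R ^+ p)) -> forall n,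
    ebound l (n + d - 1) <= C * d%:R ^+ p * ((2 ^+ (a * n))^-1 * n.+1%:R ^+ p).
  move=> C0 h n; apply: le_trans (h _) _; rewrite -mulrA; apply: ler_wpM2l => //.
  rewrite mulrCA -exprMn -exprVn; apply: ler_pM; rewrite ?exprn_ge0//.
    rewrite ler_wiXn2l ?invr_ge0 ?invf_le1 ?ler1n//.
    by rewrite mulnC leq_mul2r -addnBA// leq_addr orbT.
  rewrite lerXn2r ?nnegrE// -natrM ler_nat.
  rewrite subn1 prednK ?addn_gt0 ?d0 ?orbT// mulnS addnC leq_add2l.
  by rewrite -{1}(mul1n n) leq_mul2r d0 orbT.
case: j => [|j].
  have [C C0 h] := ebound_nseq k.+2 d.-1; exists (C * d%:R ^+ d.-1).
    by rewrite mulr_ge0// exprn_ge0.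
  rewrite subn0 /= => n; rewrite -{1}(prednK d0); exact: (shift k.+2 d.-1 C).
have [C C0 h] := ebound_mixed k.+1 j (d - j.+1).
exists (C * d%:R ^+ j); first by rewrite mulr_ge0// exprn_ge0.
by move=> n; exact: (shift k.+1 j C).
Qed.

Lemma reg_order_vars d k (I : {set 'I_d}) :
  [seq reg_order k I s | s <- vars I] = nseq #|I| k.+1 ++ nseq (d - #|I|) k.+2.
Proof.
have H (A : {set 'I_d}) (b : nat) : {in A, forall s, reg_order k I s = b} ->
    [seq reg_order k I s | s <- enum A] = nseq #|A| b.
  move=> h; rewrite cardE -(size_map (reg_order k I)); apply/all_pred1P/allP => _ /mapP[s + ->].
  by rewrite mem_enum => sA /=; rewrite h.
rewrite /vars map_cat (H I k.+1) => [|s sI]; last by rewrite /reg_order sI.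
rewrite (H (~: I) k.+2) => [|s]; last by rewrite inE /reg_order => /negbTE ->.
by rewrite -[X in (X - _)%N](card_ord d) -(cardsC I) addKn.
Qed.

End Rates.

(** * Weak derivatives of sparse sums *)

Section DerivativeOfSparseSums.
Context {R : realType} {d : nat} (k : nat).
Local Notation P := (@cubeP R d).
Local Notation fam := (('I_d -> nat) -> 'rV[R]_d -> R).
Local Notation adm := (@adm d k).
Local Notation reg := (@reg R d k).
Implicit Types (s t j : 'I_d) (m : 'I_d -> nat) (N i : nat)
  (q : 'I_d -> nat) (I J : {set 'I_d}) (L : seq 'I_d) (U V W : fam).

Definition deriv_fam j W : fam := fun q => W (inc j q).

Lemma mem_setD1 j J s : s != j -> (s \in J :\ j) = (s \in J).
Proof. by move=> sj; rewrite !inE sj. Qed.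

(** The anisotropic orders are made for this: removing j from the index set raises the order allowed
    in x_j from k+1 to k+2, exactly the derivative that d_j consumes. *)
Lemma adm_shift j J q : j \in J -> adm J [::] q -> adm (J :\ j) [::] (inc j q).
Proof.
move=> jJ [h _]; split => // i; rewrite /inc; have := h i; rewrite /reg_order.
case: eqP => [->|/eqP ij]; last by rewrite mem_setD1.
by rewrite jJ !inE eqxx.
Qed.

Lemma reg_shift j J W : j \in J -> reg (J :\ j) [::] W -> reg J [::] (deriv_fam j W).
Proof.
move=> jJ [h1 h2]; split=> [q qa|q s _ qa]; first by apply: h1; exact: adm_shift.
rewrite /deriv_fam inc_comm; apply: h2 => //; rewrite inc_comm.
exact: adm_shift.
Qed.

Lemma Fold_shift j J m L W q : j \notin L ->
  Fold k (J :\ j) m L W (inc j q) = Fold k J m L (deriv_fam j W) q.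
Proof.
elim: L q => [//|s L IH] q; rewrite inE negb_or => /andP[js jL].
rewrite /= mem_setD1 1?eq_sym//.
by rewrite /DeltaF /fop !IH// [inc s (inc j q)]inc_comm IH.
Qed.

Lemma rem_vars j J : rem j (vars (J :\ j)) = rem j (vars J).
Proof.
rewrite !rem_filter ?vars_uniq// /vars !filter_cat /enum_mem -!filter_predI.
by congr (_ ++ _); apply: eq_filter => i /=; rewrite !inE; case: eqP.
Qed.

Lemma wD_DeltaF j i U q : sqintegrable P (U q) -> sqintegrable P (U (inc j q)) ->
  wD j (U q) (U (inc j q)) ->
  wD j (DeltaF k false j i U q) (DeltaF k true j i (deriv_fam j U) q).
Proof.
move=> u0 u1 uD.
have hP b n : wD j (ProjF k false j n U q) (ProjF k true j n (deriv_fam j U) q) /\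
    rintegrable P (ProjF k b j n (if b then deriv_fam j U else U) q).
  split.
    apply: (wD_ae _ _ (wD_Proj0 k n u0 u1)); apply: ae_all => x //.
    by rewrite /ProjF /fop /ProjA /ProjB addr0.
  apply: sqintegrable_int; rewrite /ProjF /fop /ProjA /ProjB; case: b.
    under [X in sqintegrable _ X]eq_fun do rewrite addr0.
    exact: Proj1_sq.
  exact: Proj0_sq.
have rP n : rintegrable P (ProjF k true j n (deriv_fam j U) q) by case: (hP true n).
have rP' n : rintegrable P (ProjF k false j n U q) by case: (hP false n).
have D n : wD j (ProjF k false j n U q) (ProjF k true j n (deriv_fam j U) q) by case: (hP false n).
case: i => [|i].
  have E b V : DeltaF k b j 0 V q = ProjF k b j 0 V q by apply/funext => x; exact: DeltaF0.
  by rewrite !E.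
have E b V : DeltaF k b j i.+1 V q = (fun x => ProjF k b j i.+1 V q x - ProjF k b j i V q x).
  by apply/funext => x; exact: DeltaFS.
by rewrite !E; exact: wDB.
Qed.

(** With the operator in x_j moved to the front on both sides, the remaining operators coincide and
    commute with d_j. What is left is the relation d_j Delta^0 = Delta^1 d_j in that variable. *)
Lemma wD_Fold j J m W : j \in J -> reg (J :\ j) [::] W ->
  wD j (Fold k (J :\ j) m (vars (J :\ j)) W (fun=> 0%N))
       (Fold k J m (vars J) (deriv_fam j W) (fun=> 0%N)).
Proof.
move=> jJ Wr; set I := J :\ j; pose q0 : 'I_d -> nat := fun=> 0%N; set L := rem j (vars J).
have uL : uniq L by rewrite rem_uniq// vars_uniq.
have jL : j \notin L by rewrite mem_rem_uniqF// vars_uniq.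
have h1 := Fold_rem m (vars_uniq I) Wr (mem_vars I j) (adm0 k I _).
have h2 := Fold_rem m (vars_uniq J) (reg_shift jJ Wr) (mem_vars J j) (adm0 k J _).
have sym (f g : 'rV[R]_d -> R) : {ae P, forall x, f x = g x} -> {ae P, forall x, g x = f x}.
  by move=> h; apply: (ae_imp h) => x ->.
apply: (wD_ae (sym _ _ h1) (sym _ _ h2)).
rewrite /I rem_vars -/L /= jJ !inE eqxx /=.
have -> : Fold k J m L (deriv_fam j W) = deriv_fam j (Fold k I m L W).
  by apply/funext => q; rewrite /deriv_fam [RHS]Fold_shift.
have Fr := Fold_reg m uL Wr.
have q1 : adm I L (inc j q0) by apply: adm_cons_inc => //; exact: adm0.
apply: wD_DeltaF; [exact: (reg_sq Fr (adm0 k I L))|exact: (reg_sq Fr q1)|].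
by apply: (proj2 Fr).
Qed.

Lemma wD_SF j J W N : j \in J -> reg (J :\ j) [::] W ->
  wD j (SF k (J :\ j) (vars (J :\ j)) W N (fun=> 0%N))
       (SF k J (vars J) (deriv_fam j W) N (fun=> 0%N)).
Proof.
move=> jJ Wr; have Vr := reg_shift jJ Wr; set I := J :\ j.
apply: (wD_ae (sum_Fold_vars N Wr) (sum_Fold_vars N Vr)).
apply: wD_sum => e _; last exact: wD_Fold.
  by apply: (reg_int (Fold_reg _ (vars_uniq I) Wr)); exact: adm0.
by apply: (reg_int (Fold_reg _ (vars_uniq J) Vr)); exact: adm0.
Qed.

Lemma SF_ae I L N U V q : uniq L -> reg I [::] U -> reg I [::] V ->
  (forall q, adm I [::] q -> {ae P, forall x, U q x = V q x}) -> adm I L q ->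
  {ae P, forall x, SF k I L U N q x = SF k I L V N q x}.
Proof.
move=> + Ur Vr UV; elim: L N q => [|s L IH] N q; first by move=> _; exact: UV.
move=> /andP[sL uL] qa.
have h i : (i < N.+1)%N -> {ae P, forall x, DeltaF k (s \in I) s i (SF k I L U (N - i)) q x =
    DeltaF k (s \in I) s i (SF k I L V (N - i)) q x}.
  move=> _; exact: (@fop_ae _ _ _ _ _ _ (sop_DeltaA k (s \in I) s i) (sop_DeltaB k (s \in I) s i) I L
    _ _ q sL (SF_reg _ uL Ur) (SF_reg _ uL Vr) (fun q' q'a => IH (N - i)%N q' uL q'a) qa).
by apply: (ae_imp (ae_ltn h)) => x hx /=; apply: eq_bigr => i _; exact: hx.
Qed.

Lemma SF_sum I L N (X : finType) (Q : pred X) (c : X -> R) (V : X -> fam) q : uniq L ->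
  (forall e, Q e -> reg I [::] (V e)) -> adm I L q ->
  {ae P, forall x, SF k I L (fun q x => \sum_(e | Q e) c e * V e q x) N q x =
                   \sum_(e | Q e) c e * SF k I L (V e) N q x}.
Proof.
move=> + Vr; have Sr : reg I [::] (fun q x => \sum_(e | Q e) c e * V e q x).
  by apply: reg_sum => e Qe; apply: regZ; exact: Vr.
elim: L N q => [|s L IH] N q; first by move=> _ _; exact: ae_all.
move=> /andP[sL uL] qa; have sA i := sop_DeltaA (R := R) k (s \in I) s i.
have sB i := sop_DeltaB (R := R) k (s \in I) s i.
have Tr i e : Q e -> reg I L (SF k I L (V e) (N - i)) by move=> /Vr/(SF_reg _ uL); exact.
have Tcr i e : Q e -> reg I L (fun q x => c e * SF k I L (V e) (N - i) q x).
  by move=> Qe; apply: regZ; exact: Tr.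
have h i : (i < N.+1)%N -> {ae P, forall x,
    DeltaF k (s \in I) s i (SF k I L (fun q x => \sum_(e | Q e) c e * V e q x) (N - i)) q x =
    \sum_(e | Q e) c e * DeltaF k (s \in I) s i (SF k I L (V e) (N - i)) q x}.
  move=> _; have h1 := @fop_ae _ _ _ _ _ _ (sA i) (sB i) I L _ _ q sL
    (SF_reg (N - i) uL Sr) (reg_sum _ (Tcr i)) (fun q' q'a => IH (N - i)%N q' uL q'a) qa.
  have h2 := @fop_sum _ _ _ _ _ _ (sA i) (sB i) I L _ (index_enum X) Q _ q sL (Tcr i) qa.
  have h3 : {ae P, forall x, forall e, Q e ->
      DeltaF k (s \in I) s i (fun q x => c e * SF k I L (V e) (N - i) q x) q x =
      c e * DeltaF k (s \in I) s i (SF k I L (V e) (N - i)) q x}.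
    apply: ae_fin => e; have [Qe|nQe] := boolP (Q e); last exact: ae_all.
    by apply: (ae_imp (fopZ (sA i) (sB i) (c e) sL (Tr i e Qe) qa)) => x E _.
  have h12 := ae_imp2 h1 h2 (fun x a b => conj a b).
  apply: (ae_imp2 h12 h3) => x [E1 E2] E3; rewrite [LHS]E1 [LHS]E2.
  by apply: eq_bigr => e Qe; exact: E3.
apply: (ae_imp (ae_ltn h)) => x hx /=.
rewrite (eq_bigr _ (fun (i : 'I_N.+1) _ => hx i (ltn_ord i))) exchange_big/=.
by apply: eq_bigr => e _; rewrite mulr_sumr.
Qed.

End DerivativeOfSparseSums.

(** * Test functions of several variables *)

Section TestFunctions.
Context {R : realType} {d : nat}.
Local Notation P := (@cubeP R d).
Implicit Types (f g phi : 'rV[R]_d -> R) (s : 'I_d) (psi : 'I_d -> R -> R) (x : 'rV[R]_d).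

Lemma add_delta_set_coord x s (h : R) :
  h *: delta_mx ord0 s + x = set_coord x s (h + x ord0 s).
Proof.
apply/rowP => i; rewrite !mxE eqxx /=; case: eqP => [->|_]; first by rewrite mulr1.
by rewrite mulr0 add0r.
Qed.

Lemma line_quotient f x s :
  (fun h : R => h^-1 *: (f (h *: delta_mx ord0 s + x) - f x)) =
  (fun h : R => h^-1 *: ((fun t => f (set_coord x s t)) (h *: (1 : R) + x ord0 s) -
     (fun t => f (set_coord x s t)) (x ord0 s))).
Proof.
by apply/funext => h; rewrite add_delta_set_coord set_coord_id [h *: 1]mulr1.
Qed.

Lemma derivable_line f x s : derivable f x (delta_mx ord0 s) <->
  derivable (fun t => f (set_coord x s t)) (x ord0 s) 1.
Proof. by rewrite /derivable line_quotient. Qed.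

Lemma partial_line f x s : partial s f x = derive1 (fun t => f (set_coord x s t)) (x ord0 s).
Proof. by rewrite derive1E /partial /derive line_quotient. Qed.

Lemma hasder_line f x s t : (forall x, derivable f x (delta_mx ord0 s)) ->
  hasder (fun t => f (set_coord x s t)) t (partial s f (set_coord x s t)).
Proof.
move=> df; rewrite partial_line set_coordE eqxx.
have E : (fun u => f (set_coord (set_coord x s t) s u)) = (fun u => f (set_coord x s u)).
  by apply/funext => u; rewrite set_coord_set.
rewrite E; apply: derivable_hasder.
by have /derivable_line := df (set_coord x s t); rewrite E set_coordE eqxx.
Qed.

Lemma tensor_line psi s x : (fun t => tensor psi (set_coord x s t)) =
  (fun t => tensor (upd psi s (fun=> 1)) x * psi s t).
Proof.
apply/funext => t; rewrite (tensor_split psi s) tensor_upd1_set_coord mulrC.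
by rewrite set_coordE eqxx.
Qed.

Lemma partial_tensor psi s : csmooth (psi s) ->
  partial s (tensor psi) = tensor (upd psi s (derive1 (psi s))).
Proof.
move=> ps; apply/funext => x; rewrite partial_line tensor_line [RHS]tensor_upd.
apply: hasder_derive1; have := hasderM (hasder_cst (tensor (upd psi s (fun=> 1)) x) (x ord0 s))
  (csmooth_hasder (x ord0 s) ps).
by rewrite mulr0 addr0 mulrC.
Qed.

Lemma derivable_tensor psi s x : csmooth (psi s) ->
  derivable (tensor psi) x (delta_mx ord0 s).
Proof.
move=> ps; apply/derivable_line; rewrite tensor_line; apply: hasder_derivable.
exact: hasderM (hasder_cst (tensor (upd psi s (fun=> 1)) x) (x ord0 s))
  (csmooth_hasder (x ord0 s) ps).
Qed.

Lemma continuous_tensor psi : (forall i, continuous (psi i)) -> continuous (tensor psi).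
Proof.
move=> pc; have H (r : seq 'I_d) : continuous (fun x : 'rV[R]_d => \prod_(i <- r) psi i (x ord0 i)).
  elim: r => [|i r IH].
    by have -> : (fun x : 'rV[R]_d => \prod_(i <- [::]) psi i (x ord0 i)) = (fun=> 1);
      [apply/funext => x; rewrite big_nil|exact: cst_continuous].
  have -> : (fun x : 'rV[R]_d => \prod_(j <- i :: r) psi j (x ord0 j)) =
      (fun x => psi i (x ord0 i) * \prod_(j <- r) psi j (x ord0 j)).
    by apply/funext => x; rewrite big_cons.
  move=> x; apply: continuousM; last exact: IH.
  apply: (@continuous_comp _ _ _ (fun y : 'rV[R]_d => y ord0 i) (psi i)); last exact: pc.
  exact: coord_continuous.
exact: H.
Qed.

Lemma iter_derive_Ccinf n (h : R -> R) : Ccinf h -> Ccinf (iter n (@derive1 R R) h).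
Proof. by move=> hC; elim: n => [//|n IH]; exact: Ccinf_derive. Qed.

Lemma smooth_tensor psi : (forall i, Ccinf (psi i)) -> smooth (tensor psi).
Proof.
move=> pC r; have [eta eC ->] : exists2 eta, (forall i, Ccinf (eta i)) &
    foldr (@partial R d) (tensor psi) r = tensor eta.
  elim: r => [|s r [eta eC E]]; first by exists psi.
  exists (upd eta s (derive1 (eta s))); last by rewrite /= E partial_tensor//; case: (eC s).
  by move=> i; rewrite /upd; case: eqP => // _; exact: Ccinf_derive.
split=> [|i x]; first by apply: continuous_tensor => i; exact: Ccinf_continuous.
by apply: derivable_tensor; case: (eC i).
Qed.

Lemma test_tensor psi : (forall i, Ccinf (psi i)) -> test_function (tensor psi).
Proof.
move=> pC; split; first exact: smooth_tensor.
have /choice[ab abP] : forall i, exists ab : R * R, [/\ 0 < ab.1, ab.2 < 1 &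
    forall t, ~~ (ab.1 <= t <= ab.2) -> psi i t = 0].
  by move=> i; have [_ [a [b h]]] := pC i; exists (a, b).
exists [set x : 'rV[R]_d | forall i, `[(ab i).1, (ab i).2]%classic (x ord0 i)]; split.
- apply: (@rV_compact _ _ (fun i => `[(ab i).1, (ab i).2]%classic)) => i.
  exact: segment_compact.
- move=> x h i; have [a0 b1 _] := abP i; have := h i; rewrite /= in_itv/= => /andP[h1 h2].
  by rewrite (lt_le_trans a0 h1) (le_lt_trans h2 b1).
move=> x /existsNP[i]; rewrite /= in_itv/= => /negP h.
have [_ _ p0] := abP i; rewrite /tensor (bigD1 i)//= p0 ?mul0r//.
Qed.

Lemma multi_partial_tensor (q : 'I_d -> nat) psi : (forall i, Ccinf (psi i)) ->
  multi_partial q (tensor psi) = tensor (fun i => iter (q i) (@derive1 R R) (psi i)).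
Proof.
(* These are the factors once the variables of r have been differentiated; each variable occurs only
   once in the enumeration. *)
move=> pC; pose eta (r : seq 'I_d) i := if i \in r then iter (q i) (@derive1 R R) (psi i) else psi i.
have etaC r i : Ccinf (eta r i) by rewrite /eta; case: ifP => // _; exact: iter_derive_Ccinf.
have H r : uniq r -> foldr (fun i g => iter (q i) (partial i) g) (tensor psi) r = tensor (eta r).
  elim: r => [//|s r IH] /= /andP[sr ur]; rewrite IH//.
  have Hn n : iter n (partial s) (tensor (eta r)) = tensor (upd (eta r) s (iter n (@derive1 R R) (psi s))).
    elim: n => [|n IHn] /=.
      by congr tensor; apply/funext => i; rewrite /upd /eta; case: eqP => // ->; rewrite (negbTE sr).
    rewrite IHn partial_tensor; last by rewrite upd_at; case: (iter_derive_Ccinf n (pC s)).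
    by rewrite upd_at upd_upd.
  rewrite Hn; congr tensor; apply/funext => i; rewrite /upd /eta inE.
  by case: eqP => // ->.
rewrite /multi_partial H ?enum_uniq//; congr tensor.
by apply/funext => i; rewrite /eta mem_enum.
Qed.

(* [phi] is a pointwise limit of functions that are constant on the cells of dyadic grids. *)
Lemma measurable_continuous_cube phi : continuous phi -> (forall x, ~ cube x -> phi x = 0) ->
  measurable_fun setT phi.
Proof.
move=> cphi phi0.
pose corner n (e : {ffun 'I_d -> 'I_(2 ^ n)}) : 'rV[R]_d := \row_i node R n (e i).
pose F n x := \sum_(e : {ffun 'I_d -> 'I_(2 ^ n)}) phi (corner n e) *
  tensor (fun i => cellind n (e i)) x.
have mF n : measurable_fun setT (F n).
  have [] // : bmeas (F n); apply: bmeas_sum => e _; apply: bmeasM; first exact: bmeas_cst.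
  by apply: bmeas_tensor => i; exact: bmeas_cellind.
apply: (measurable_fun_cvg mF) => x _.
have [x01|xn] := pselect (forall i, 0 <= x ord0 i < 1); last first.
  have -> : F ^~ x = fun=> 0.
    apply/funext => n; rewrite /F big1// => e _; have /existsNP[i xi] := xn.
    rewrite /tensor (bigD1 i)//= (_ : cellind _ _ _ = 0) ?mul0r ?mulr0//.
    apply/eqP; apply: contra_notT xi => /cellind_in/andP[h1 h2].
    by rewrite (le_trans (node_ge0 _ _) h1) (lt_le_trans h2)// node_le1.
  rewrite phi0; first exact: cvg_cst.
  by move=> xc; apply: xn => i; have /andP[/ltW -> ->] := xc i.
have FE n : exists2 y : 'rV[R]_d, F n x = phi y & forall i, `|x ord0 i - y ord0 i| < 2^-1 ^+ n.
  have /choice[e0 e0P] : forall i, exists j : 'I_(2 ^ n), node R n j <= x ord0 i < node R n j.+1.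
    by move=> i; have [j jn jx] := exists_cell n (x01 i); exists (Ordinal jn).
  pose e : {ffun 'I_d -> 'I_(2 ^ n)} := [ffun i => e0 i].
  exists (corner n e); last first.
    move=> i; rewrite mxE ffunE; have /andP[h1 h2] := e0P i.
    by rewrite ger0_norm ?subr_ge0// ltrBlDr addrC -nodeS.
  rewrite /F (bigD1 e)//= big1 ?addr0 => [|e' e'e].
    rewrite /tensor big1 ?mulr1// => i _; rewrite ffunE; exact: cellind1.
  have [i ie] : exists i, e' i != e i.
    apply: contrapT => /forallNP h; move/eqP: e'e; apply; apply/ffunP => i.
    by have /negP := h i; rewrite negbK => /eqP.
  rewrite /tensor (bigD1 i)//= (_ : cellind _ _ _ = 0) ?mul0r ?mulr0//.
  apply/eqP; apply: contra_neqT ie => ce; apply: val_inj.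
  apply: (cellind_neq0 ce); rewrite ffunE (cellind1 (e0P i)).
  exact: oner_neq0.
apply/cvgrPdist_lt => eps eps0.
have /cvgrPdist_lt/(_ _ eps0)/nbhs_ballP[del del0 hdel] := cphi x.
near=> n; have [y -> yx] := FE n; apply: hdel; split => // a b; rewrite (ord1 a).
rewrite /ball/=; apply: lt_trans (yx b) _; near: n.
have : (2^-1 : R) ^+ n @[n --> \oo] --> (0 : R).
  by apply: cvg_expr; rewrite ger0_norm ?invf_lt1 ?ltr1n.
move/cvgrPdist_lt => /(_ _ del0); apply: filterS => n.
by rewrite sub0r normrN ger0_norm// exprn_ge0.
Unshelve. all: by end_near. Qed.

Lemma bmeas_continuous_compact phi (K : set 'rV[R]_d) : continuous phi -> compact K ->
  K `<=` cube -> (forall x, ~ K x -> phi x = 0) -> bmeas phi.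
Proof.
move=> cphi Kc Ksub phi0; split.
  by apply: measurable_continuous_cube => // x xc; apply: phi0 => /Ksub.
have : compact (phi @` K) by apply: continuous_compact => //; exact: continuous_subspaceT.
move=> /compact_bounded[M [_ hM]]; exists (Num.max 0 (M + 1)) => x.
have [Kx|nKx] := pselect (K x); last by rewrite phi0// normr0 le_max lexx.
rewrite le_max; apply/orP; right; apply: hM; first by rewrite ltrDl.
by exists x.
Qed.

Lemma test_bmeas phi : test_function phi -> bmeas phi.
Proof.
move=> [sphi [K [Kc Ksub phi0]]]; apply: (bmeas_continuous_compact _ Kc Ksub phi0).
by have [] := sphi [::].
Qed.

Lemma test_partial_bmeas phi s : test_function phi -> bmeas (partial s phi).
Proof.
move=> [sphi [K [Kc Ksub phi0]]]; apply: (bmeas_continuous_compact _ Kc Ksub).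
  by have [] := sphi [:: s].
move=> x nKx; rewrite /partial -(derive_cst (0 : R) x (delta_mx ord0 s)).
apply: near_eq_derive; have oK : open (~` K).
  by apply: closed_openC; apply: compact_closed => //; exact: norm_hausdorff.
by apply: filterS (open_nbhs_nbhs (conj oK nKx)) => y /phi0.
Qed.

Lemma continuous_set_coord x s : continuous (set_coord x s : R -> 'rV[R]_d).
Proof.
move=> t; apply/cvgrPdist_lt => e e0; near=> u.
rewrite -[X in X < _]/(mx_norm _) mx_normrE; apply/bigmax_ltP; split => // -[a i] _ /=.
rewrite !mxE; case: eqP => _; last by rewrite subrr normr0.
by near: u; apply: cvgr_dist_lt.
Unshelve. all: by end_near. Qed.

(* [wD] only involves tensor products. On almost every line [f] is an antiderivative of [g] up
   to a constant, and the antiderivative operator is transposed onto the test function. *)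
Lemma wD_test s f g phi : sqintegrable P f -> sqintegrable P g -> wD s f g ->
  test_function phi ->
  \int[P]_x (f x * partial s phi x) = - \int[P]_x (g x * phi x).
Proof.
move=> fi gi fg tphi; have pb := test_bmeas tphi; have dpb := test_partial_bmeas s tphi.
have mulC (h k : 'rV[R]_d -> R) : (fun x => h x * k x) = (fun x => k x * h x).
  by apply/funext => x; rewrite mulrC.
have fi1 := sqintegrable_int fi; have gi1 := sqintegrable_int gi.
have i1 : rintegrable P (fun x => f x * partial s phi x) by rewrite mulC; exact: bmeasM_int.
have i2 : rintegrable P (fun x => g x * phi x) by rewrite mulC; exact: bmeasM_int.
rewrite -RintegralNT//; apply: (@eq_Rintegral_lines R d s) => //; first exact: rintegrableN.
have h1 := ae_imp2 (ae_line_prim fi gi fg) (ae_sqintegrable_line s gi) (fun x a b => conj a b).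
apply: (ae_imp2 (ae_cubeP (R := R) (d := d)) h1) => x x01 [fx gx].
case: tphi => sphi [K [Kc Ksub phi0]].
pose eta t := phi (set_coord x s t); pose deta t := partial s phi (set_coord x s t).
have deta_der t : hasder eta t (deta t).
  by apply: hasder_line => y; have [_] := sphi [::]; exact.
have deta_cont : continuous deta.
  move=> t; apply: (@continuous_comp _ _ _ (set_coord x s) (partial s phi)).
    exact: continuous_set_coord.
  by have [c _] := sphi [:: s]; exact: c.
have detab : bmeas (deta : measurableTypeR R -> R).
  by apply: (bmeas_comp dpb); exact: measurable_set_coord1.
have eta_out t : ~~ (0 < t < 1) -> eta t = 0.
  move=> tn; apply: phi0 => /Ksub/(_ s); rewrite set_coordE eqxx => t01.
  by rewrite t01 in tn.
set c := line_cst s f g x in fx; set v := fun t => g (set_coord x s t) in fx gx *.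
have v1 := sqintegrable_int gx.
have detai := bmeas_int lam detab.
transitivity (\int[lam]_t (c * deta t + deta t * prim v t)).
  by apply: ae_eq_Rintegral; apply: (ae_imp fx) => t /(_ Logic.I) -> _; rewrite /deta; ring.
rewrite RintegralDT; last 2 first.
- exact: rintegrableZ.
- by apply: bmeasM_int => //; apply: bmeas_int; exact: bmeas_prim.
rewrite RintegralZT// kint_dual//; last exact: bkernel_stepk.
have step u : 0 <= u < 1 -> kintT stepk deta u = - eta u.
  move=> /andP[u0 u1]; rewrite -[RHS]add0r -(eta_out 1) ?ltxx ?andbF//.
  rewrite -(Rintegral_FTC deta_der deta_cont u0 (ltW u1) (lexx 1)).
  apply: ae_eq_Rintegral; apply: ae_eqT.
  apply: (ae_imp2 (ae_lam_neq u) ae_lam_itv) => t tu /andP[_ t1].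
  by rewrite /stepk lt_def tu t1 andbT.
have -> : \int[lam]_t deta t = 0.
  rewrite -[RHS]oppr0 -(eta_out 0) ?ltxx// -step ?lexx ?ltr01//.
  apply: ae_eq_Rintegral; apply: ae_eqT; apply: (ae_imp ae_lam_itv) => t /andP[t0 _].
  by rewrite /stepk t0 mul1r.
rewrite mulr0 add0r; apply: ae_eq_Rintegral; apply: ae_eqT.
apply: (ae_imp ae_lam_itv) => t /andP[t0 t1]; rewrite step ?(ltW t0)// mulNr.
by rewrite mulrC.
Qed.

End TestFunctions.

(** * Borel representatives and families of weak derivatives *)

Section Representatives.
Context {R : realType} {d : nat}.
Local Notation P := (@cubeP R d).
Local Notation leb := (@lebesgue_rV R d).
Implicit Types (f g u v phi : 'rV[R]_d -> R) (s : 'I_d) (q : 'I_d -> nat).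

Lemma Rintegral_cube (h : 'rV[R]_d -> R) : \int[leb]_(x in cube) h x = \int[P]_x h x.
Proof. by rewrite Rintegral_mrestr. Qed.

Lemma isL2P u : isL2 u <-> exists g, sqintegrable P g /\ {ae P, forall x, u x = g x}.
Proof.
have mc := @measurable_cube R d; split=> [[g [mg ug gi]]|[g [[mg gi] ug]]].
  exists (g \_ cube); split; last first.
    apply/ae_mrestr; apply: filterS ug => x + xc; move/(_ xc) => ->.
    by rewrite patchE mem_set.
  have mg' : measurable_fun setT (g \_ cube) by apply/(measurable_restrictT _ mc).
  split => //; apply/integrableP; split; first by apply/measurable_EFinP; exact: measurable_funX.
  rewrite integral_mrestr; apply: le_lt_trans gi; rewrite le_eqVlt; apply/orP; left; apply/eqP.
  by apply: eq_integral => x xc /=; rewrite patchE xc ger0_norm ?sqr_ge0.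
exists g; split; first exact: measurable_funTS.
  by apply: filterS (iffLR (ae_mrestr _ _ _) ug) => x h xc; exact: h.
case/integrableP : gi => _; rewrite integral_mrestr; apply: le_lt_trans.
rewrite le_eqVlt; apply/orP; left; apply/eqP.
by apply: eq_integral => x xc /=; rewrite ger0_norm ?sqr_ge0.
Qed.

Lemma sqnormL2_nrm u g : {ae P, forall x, u x = g x} -> sqnormL2 u = nrm P g ^+ 2.
Proof.
move=> ug; rewrite sqr_nrm /sqnormL2 Rintegral_cube; apply: ae_eq_Rintegral; apply: ae_eqT.
by apply: (ae_imp ug) => x ->.
Qed.

Definition repL2 u : 'rV[R]_d -> R :=
  xget (fun=> 0) [set g | sqintegrable P g /\ {ae P, forall x, u x = g x}].

Lemma repL2P u : isL2 u -> sqintegrable P (repL2 u) /\ {ae P, forall x, u x = repL2 u x}.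
Proof. by move=> /isL2P h; exact: (xgetPex (fun=> 0) h). Qed.

Lemma Rintegral_ae_mul u g phi : {ae P, forall x, u x = g x} ->
  \int[leb]_(x in cube) (u x * phi x) = \int[P]_x (g x * phi x).
Proof.
move=> ug; rewrite Rintegral_cube; apply: ae_eq_Rintegral; apply: ae_eqT.
by apply: (ae_imp ug) => x ->.
Qed.

Lemma multi_partial0 phi : multi_partial (fun=> 0%N) phi = phi.
Proof. by rewrite /multi_partial; elim: (enum _) => //= i r ->. Qed.

(** The identity of order q, tested with the factor in x_s already differentiated, has the same
    left-hand side as the identity of order [inc s q] tested without it. The extra sign is the one
    in the definition of [wD]. *)
Lemma weak_partial_wD s q u f g f' g' : is_weak_partial q u f -> is_weak_partial (inc s q) u g ->
  sqintegrable P f' -> sqintegrable P g' ->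
  {ae P, forall x, f x = f' x} -> {ae P, forall x, g x = g' x} -> wD s f' g'.
Proof.
move=> [_ uf] [_ ug] f'i g'i ff gg.
apply: wD_Ccinf; do ?exact: sqintegrable_int.
move=> psi pC; have p1C i : Ccinf (upd psi s (derive1 (psi s)) i).
  by rewrite /upd; case: eqP => // _; exact: Ccinf_derive.
have E1 := uf _ (test_tensor p1C); have E2 := ug _ (test_tensor pC).
move: E1 E2; rewrite !multi_partial_tensor// (Rintegral_ae_mul _ ff) (Rintegral_ae_mul _ gg).
have -> : (fun i => iter (q i) (@derive1 R R) (upd psi s (derive1 (psi s)) i)) =
    (fun i => iter (inc s q i) (@derive1 R R) (psi i)).
  by apply/funext => i; rewrite /upd /inc; case: eqP => // ->; rewrite -iterSr.
move=> -> /eqP.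
have -> : (\sum_i inc s q i = (\sum_i q i).+1)%N.
  rewrite (bigD1 s)//= [in RHS](bigD1 s)//= {1}/inc eqxx addSn.
  by congr (_ + _).+1; apply: eq_bigr => i /negbTE si; rewrite /inc si.
rewrite exprS mulN1r mulNr -mulrN => /eqP /(mulfI _) h.
by apply: h; rewrite signr_eq0.
Qed.

Section Family.
Context (k : nat) (I : {set 'I_d}) (v : 'rV[R]_d -> R) (vX : in_X_coef k I v).
Local Notation adm := (@adm d k).
Local Notation reg := (@reg R d k).

Definition family q := repL2 (weak_partial q v).

Lemma weak_partialP q : adm I [::] q -> is_weak_partial q v (weak_partial q v).
Proof. by move=> [qa _]; case: vX => _ /(_ q qa) h; exact: (xgetPex (fun=> 0) h). Qed.

Lemma familyP q : adm I [::] q ->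
  sqintegrable P (family q) /\ {ae P, forall x, weak_partial q v x = family q x}.
Proof. by move=> /weak_partialP[h _]; exact: repL2P. Qed.

Lemma family_reg : reg I [::] family.
Proof.
split=> [q qa|q s _ qa]; first by case: (familyP qa).
have qa' := adm_inc qa; have [f1 f2] := familyP qa'; have [g1 g2] := familyP qa.
exact: (weak_partial_wD (weak_partialP qa') (weak_partialP qa)).
Qed.

Lemma family0 : {ae P, forall x, v x = family (fun=> 0%N) x}.
Proof.
have a0 := adm0 k I [::]; have [_ vw] := weak_partialP a0.
have [f1 f2] := familyP a0; have [v1 v2] := repL2P (proj1 vX).
suff h : {ae P, forall x, repL2 v x = family (fun=> 0%N) x}.
  by apply: (ae_imp2 v2 h) => x -> ->.
apply: ae_eq_Ccinf; do ?exact: sqintegrable_int.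
move=> psi pC; have := vw _ (test_tensor pC).
rewrite multi_partial0 (Rintegral_ae_mul _ v2) (Rintegral_ae_mul _ f2) big1 ?expr0 ?mul1r//.
Qed.

Lemma family_nrm q : adm I [::] q -> nrm P (family q) <= Num.sqrt (sqnorm_X_coef k I v).
Proof.
move=> qa; have [_ f2] := familyP qa; rewrite -[leLHS]ger0_norm ?nrm_ge0// -sqrtr_sqr.
rewrite ler_wsqrtr// -(sqnormL2_nrm f2) /sqnorm_X_coef.
have qk i : (q i < k.+3)%N.
  by case: qa => /(_ i) + _; rewrite /reg_order; case: ifP => _ h; rewrite ltnS (leq_trans h).
pose e : {ffun 'I_d -> 'I_k.+3} := [ffun i => Ordinal (qk i)].
have -> : q = fun i => e i : nat by apply/funext => i; rewrite ffunE.
rewrite (bigD1 e)/=; last first.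
  by apply/forallP => i; rewrite ffunE /=; case: qa => /(_ i).
rewrite lerDl; apply: sumr_ge0 => e' _.
by apply: Rintegral_ge0 => x _; exact: sqr_ge0.
Qed.

Lemma sqnorm_X_coef_ge0 : 0 <= sqnorm_X_coef k I v.
Proof.
by apply: sumr_ge0 => e' _; apply: Rintegral_ge0 => x _; exact: sqr_ge0.
Qed.

Definition remainder n x := family (fun=> 0%N) x - SF k I (vars I) family (n + d - 1) (fun=> 0%N) x.

Lemma remainder_sq n : sqintegrable P (remainder n).
Proof.
have a0 := adm0 k I (vars I); apply: sqintegrableB.
  by case: (familyP (adm0 k I [::])).
exact: (reg_sq (SF_reg _ (vars_uniq I) family_reg) a0).
Qed.

Lemma remainderP n : (0 < d)%N ->
  {ae P, forall x, v x - sparse_interp_coef k n I v x = remainder n x}.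
Proof.
move=> d0; apply: (ae_imp2 family0 (sparse_interp_SF n d0 family_reg family0)) => x E ->.
by rewrite E.
Qed.

Lemma remainder_nrm n (C : R) :
  ebound (nseq #|I| k.+1 ++ nseq (d - #|I|) k.+2) (n + d - 1) <= C * E_rate R #|I| k d n ->
  nrm P (remainder n) <= C * E_rate R #|I| k d n * Num.sqrt (sqnorm_X_coef k I v).
Proof.
move=> hC; have := SF_error (n + d - 1) (vars_uniq I) family_reg family_nrm (adm0 k I (vars I)).
rewrite reg_order_vars => /le_trans; apply.
by rewrite ler_wpM2r// sqrtr_ge0.
Qed.

End Family.
End Representatives.

(** * Commutation with the exterior derivative *)

Section ExteriorDerivative.
Context {R : realType} {d : nat}.
Local Notation P := (@cubeP R d).
Local Notation leb := (@lebesgue_rV R d).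
Implicit Types (J : {set 'I_d}) (j : 'I_d) (phi : 'rV[R]_d -> R).

Lemma Rintegral_lincomb (Q : pred 'I_d) (c : 'I_d -> R) (F : 'I_d -> 'rV[R]_d -> R) phi :
  (forall j, Q j -> rintegrable P (F j)) -> bmeas phi ->
  \int[P]_x ((\sum_(j | Q j) c j * F j x) * phi x) = \sum_(j | Q j) c j * \int[P]_x (F j x * phi x).
Proof.
move=> Fi pb; have Fpi j : Q j -> rintegrable P (fun x => F j x * phi x).
  move=> /Fi fi; have -> : (fun x => F j x * phi x) = (fun x => phi x * F j x).
    by apply/funext => x; rewrite mulrC.
  exact: bmeasM_int.
transitivity (\int[P]_x \sum_(j | Q j) (c j * (F j x * phi x))).
  by apply: eq_Rintegral => x _; rewrite mulr_suml; apply: eq_bigr => j _; rewrite mulrA.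
rewrite Rintegral_sumT => [|j /Fpi]; last exact: rintegrableZ.
by apply: eq_bigr => j /Fpi; exact: RintegralZT.
Qed.

(** [norm_Hd] measures the derivative selected by [xget]; uniqueness up to null sets lets an
    explicit derivative stand in for it. *)
Lemma weak_extd_unique l (w D1 D2 : diff_form R d) J : is_weak_extd l w D1 ->
  is_weak_extd l w D2 -> #|J| = l.+1 -> sqnormL2 (D1 J) = sqnormL2 (D2 J).
Proof.
move=> [L1 h1] [L2 h2] Jl.
have [g1i e1] := repL2P (L1 J Jl); have [g2i e2] := repL2P (L2 J Jl).
rewrite (sqnormL2_nrm e1) (sqnormL2_nrm e2); congr (_ ^+ 2); apply: ae_eq_nrm.
apply: ae_eq_Ccinf; do ?exact: sqintegrable_int.
move=> psi pC; have tp := test_tensor pC.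
have := h1 J Jl _ tp; rewrite -(h2 J Jl _ tp).
by rewrite (Rintegral_ae_mul _ e1) (Rintegral_ae_mul _ e2).
Qed.

Section Commutation.
Context (k l n : nat) (d_gt0 : (0 < d)%N) (w dw : diff_form R d).
Hypotheses (wX : in_X k l w) (wdw : is_weak_extd l w dw) (dwX : in_X k l.+1 dw).
Local Notation N := (n + d - 1)%N.
Local Notation q0 := (fun=> 0%N).
Local Notation sgn j J := (wedge_sign R j (J :\ j)).

Lemma card_face J j : #|J| = l.+1 -> j \in J -> #|J :\ j| = l.
Proof. by move=> Jl jJ; have := cardsD1 j J; rewrite jJ Jl add1n => -[]. Qed.

Lemma face_reg J j : #|J| = l.+1 -> j \in J -> reg k (J :\ j) [::] (family (w (J :\ j))).
Proof. by move=> Jl jJ; apply: family_reg; apply: wX; exact: card_face. Qed.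

Lemma extd_ibp J phi : #|J| = l.+1 -> test_function phi ->
  \int[P]_x (family (dw J) q0 x * phi x) =
  - \sum_(j in J) sgn j J * \int[P]_x (family (w (J :\ j)) q0 x * partial j phi x).
Proof.
move=> Jl tp; have [_ /(_ J Jl phi tp)] := wdw.
rewrite (Rintegral_ae_mul _ (family0 (dwX Jl))) => ->; congr (- _).
apply: eq_bigr => j jJ; rewrite (Rintegral_ae_mul _ (family0 (wX (card_face Jl jJ))))//.
Qed.

(** The definition of d only gives the alternating sum as a distribution. Mixed regularity of w
    makes each partial derivative an L^2 function, so the sum can be taken pointwise. *)
Lemma extd_family J : #|J| = l.+1 -> {ae P, forall x,
  family (dw J) q0 x = \sum_(j in J) sgn j J * deriv_fam j (family (w (J :\ j))) q0 x}.
Proof.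
move=> Jl; have si j : j \in J -> rintegrable P (deriv_fam j (family (w (J :\ j))) q0).
  by move=> jJ; exact: (reg_int (reg_shift jJ (face_reg Jl jJ)) (adm0 k J [::])).
apply: ae_eq_Ccinf.
- exact: (reg_int (family_reg (dwX Jl)) (adm0 k J [::])).
- by apply: rintegrable_sum => j /si; exact: rintegrableZ.
move=> psi pC; have pb : allbmeas psi by move=> i; exact: Ccinf_bmeas.
rewrite [LHS](extd_ibp Jl (test_tensor pC)) [RHS](Rintegral_lincomb _ si (bmeas_tensor pb)).
rewrite -sumrN; apply: eq_bigr => j jJ; rewrite -mulrN; congr (_ * _).
rewrite partial_tensor; last by case: (pC j).
have := proj2 (face_reg Jl jJ) q0 j isT (adm_shift jJ (adm0 k J [::])) psi pb (pC j).
by move=> E; apply: (etrans (congr1 -%R E)); rewrite opprK.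
Qed.

(** The sparse sum reads all the mixed derivatives of its argument. By [reg_unique] the equality in
    [extd_family] passes to them, and linearity of the sparse sum concludes. *)
Lemma SF_extd J : #|J| = l.+1 -> {ae P, forall x,
  SF k J (vars J) (family (dw J)) N q0 x =
  \sum_(j in J) sgn j J * SF k J (vars J) (deriv_fam j (family (w (J :\ j)))) N q0 x}.
Proof.
move=> Jl; have Vr j : j \in J -> reg k J [::] (deriv_fam j (family (w (J :\ j)))).
  by move=> jJ; exact: reg_shift (face_reg Jl jJ).
have Sr : reg k J [::] (fun q x => \sum_(j in J) sgn j J * deriv_fam j (family (w (J :\ j))) q x).
  by apply: reg_sum => j /Vr; exact: regZ.
have Dr := family_reg (dwX Jl); have a0 := adm0 k J (vars J).
have h1 := SF_ae N (vars_uniq J) Dr Sr (reg_unique Dr Sr (extd_family Jl)) a0.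
have h2 := SF_sum N (fun j => sgn j J) (vars_uniq J) Vr a0.
by apply: (ae_imp2 h1 h2) => x E1 E2; rewrite [LHS]E1 [LHS]E2.
Qed.

(** The interpolant commutes with d, so the error of dw is the exterior derivative of the error of
    w. The error bound for dw can then be used for the derivative part of the norm. *)
Lemma remainder_extd : is_weak_extd l (fun I x => w I x - sparse_interp k n w I x)
  (fun J x => dw J x - sparse_interp k n dw J x).
Proof.
split=> [J Jl|J Jl phi tp].
  apply/isL2P; exists (remainder k J (dw J) n); split; first exact: remainder_sq (dwX Jl) n.
  exact: remainderP (dwX Jl) n d_gt0.
have pb := test_bmeas tp; have dpb j := test_partial_bmeas j tp.
have mi (f h : 'rV[R]_d -> R) : sqintegrable P f -> bmeas h -> rintegrable P (fun x => f x * h x).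
  move=> fi hb; have -> : (fun x => f x * h x) = (fun x => h x * f x).
    by apply/funext => x; rewrite mulrC.
  by apply: bmeasM_int => //; exact: sqintegrable_int.
have split_rem I v h : in_X_coef k I v -> bmeas h ->
    \int[leb]_(x in cube) ((v x - sparse_interp_coef k n I v x) * h x) =
    \int[P]_x (family v q0 x * h x) - \int[P]_x (SF k I (vars I) (family v) N q0 x * h x).
  move=> vX hb; rewrite (Rintegral_ae_mul _ (remainderP vX n d_gt0)).
  have r0 := family_reg vX; have a0 := adm0 k I [::]; have a1 := adm0 k I (vars I).
  rewrite -RintegralBT; last 2 first.
  - by apply: mi => //; exact: (reg_sq r0 a0).
  - by apply: mi => //; exact: (reg_sq (SF_reg _ (vars_uniq I) r0) a1).
  by apply: eq_Rintegral => x _; rewrite mulrBl.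
rewrite split_rem//; last exact: dwX.
have -> : \sum_(j in J) sgn j J * \int[leb]_(x in cube)
      ((w (J :\ j) x - sparse_interp k n w (J :\ j) x) * partial j phi x) =
    \sum_(j in J) sgn j J * \int[P]_x (family (w (J :\ j)) q0 x * partial j phi x) -
    \sum_(j in J) sgn j J * \int[P]_x (SF k (J :\ j) (vars (J :\ j)) (family (w (J :\ j))) N q0 x *
      partial j phi x).
  rewrite -sumrB; apply: eq_bigr => j jJ; rewrite -mulrBr; congr (_ * _).
  by apply: split_rem => //; apply: wX; exact: card_face.
(* The contributions of w and dw themselves match by [extd_ibp]; the same identity remains for the
   sparse sums. *)
rewrite opprB (extd_ibp Jl tp) addrC; congr (_ - _); apply: oppr_inj; rewrite opprK.
transitivity (\int[P]_x ((\sum_(j in J) sgn j J *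
    SF k J (vars J) (deriv_fam j (family (w (J :\ j)))) N q0 x) * phi x)).
  apply: ae_eq_Rintegral; apply: ae_eqT; apply: (ae_imp (SF_extd Jl)) => x E.
  by rewrite [X in X * _]E.
have Sr j : j \in J -> reg k J (vars J) (SF k J (vars J) (deriv_fam j (family (w (J :\ j)))) N).
  by move=> jJ; apply: SF_reg; [exact: vars_uniq|exact: reg_shift (face_reg Jl jJ)].
have a0 := adm0 k J (vars J).
rewrite Rintegral_lincomb// => [|j jJ]; last exact: (reg_int (Sr j jJ) a0).
rewrite -sumrN; apply: eq_bigr => j jJ; rewrite -mulrN; congr (_ * _).
have Wr := face_reg Jl jJ.
(* Each term is integrated by parts separately, against a test function that need not be a tensor
   product. *)
rewrite (wD_test _ _ (wD_SF N jJ Wr))// ?opprK//; last exact: (reg_sq (Sr j jJ) a0).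
exact: (reg_sq (SF_reg N (vars_uniq _) Wr) (adm0 k _ _)).
Qed.

End Commutation.
End ExteriorDerivative.

(** * Error bounds for forms and conclusion *)

Section FormBounds.
Context {R : realType} {d : nat} (k l n : nat) (d_gt0 : (0 < d)%N).
Variables (w : diff_form R d) (B : R).
Hypotheses (wX : in_X k l w) (B_ge0 : 0 <= B).
Hypothesis ebB : ebound (nseq l k.+1 ++ nseq (d - l) k.+2) (n + d - 1) <= B * E_rate R l k d n.

Lemma E_rate_ge0 j : 0 <= E_rate R j k d n.
Proof. by case: j => [|j]; rewrite mulr_ge0// ?invr_ge0// ?exprn_ge0. Qed.

Lemma remainder_form_L2 : isL2_form l (fun I x => w I x - sparse_interp k n w I x).
Proof.
move=> I Il; apply/isL2P; exists (remainder k I (w I) n); split; first exact: remainder_sq (wX Il) n.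
exact: remainderP (wX Il) n d_gt0.
Qed.

Lemma norm_X_ge0 : 0 <= norm_X k l w.
Proof. exact: sqrtr_ge0. Qed.

Lemma remainder_form_bound :
  sqnormL2_form l (fun I x => w I x - sparse_interp k n w I x) <=
  (B * E_rate R l k d n * norm_X k l w) ^+ 2.
Proof.
have X0 : 0 <= \sum_(I : {set 'I_d} | #|I| == l) sqnorm_X_coef k I (w I).
  by apply: sumr_ge0 => I /eqP Il; exact: sqnorm_X_coef_ge0.
rewrite exprMn sqr_sqrtr// mulr_sumr; apply: ler_sum => I /eqP Il.
rewrite (sqnormL2_nrm (remainderP (wX Il) n d_gt0)).
have := @remainder_nrm R d k I (w I) (wX Il) n B; rewrite Il => /(_ ebB) h.
rewrite -[sqnorm_X_coef k I (w I)]sqr_sqrtr ?sqnorm_X_coef_ge0// -exprMn.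
by rewrite lerXn2r ?nnegrE ?nrm_ge0// !mulr_ge0// ?E_rate_ge0// sqrtr_ge0.
Qed.

End FormBounds.

Lemma sqrt_sum_sqr_le (R : realType) (x y B1 B2 a b : R) :
  0 <= B1 -> 0 <= B2 -> 0 <= a -> 0 <= b -> x <= (B1 * a) ^+ 2 -> y <= (B2 * b) ^+ 2 ->
  Num.sqrt (x + y) <= (B1 + B2) * (a + b).
Proof.
move=> B1_ge0 B2_ge0 a_ge0 b_ge0 hx hy.
have aB : 0 <= B1 * a by exact: mulr_ge0.
have bB : 0 <= B2 * b by exact: mulr_ge0.
have rhs_ge0 : 0 <= (B1 + B2) * (a + b) by apply: mulr_ge0; exact: addr_ge0.
rewrite -(ger0_norm rhs_ge0) -sqrtr_sqr ler_wsqrtr//.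
apply: (@le_trans _ _ ((B1 * a + B2 * b) ^+ 2)).
  by rewrite (le_trans (lerD hx hy))// sqrrD lerD2r lerDl mulrn_wge0// mulr_ge0.
rewrite lerXn2r ?nnegrE ?addr_ge0// mulrDl.
by apply: lerD; apply: ler_wpM2l; rewrite ?lerDl ?lerDr.
Qed.

Theorem corollary4p3 (R : realType) (d k l : nat)
    (d_ge1 : (1 <= d)%N) (l_le : (l <= d - 1)%N) :
  exists C : R, forall (n : nat) (w dw : diff_form R d),
    in_X k l w -> is_weak_extd l w dw -> in_X k l.+1 dw ->
    let err : diff_form R d := fun I x => w I x - sparse_interp k n w I x in
    in_Hd l err /\
    norm_Hd l err <=
      C * (E_rate R l k d n * norm_X k l w +
           E_rate R l.+1 k d n * norm_X k l.+1 dw).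
Proof.
have [B1 B1_ge0 hB1] := @ebound_E_rate R k d l d_ge1.
have [B2 B2_ge0 hB2] := @ebound_E_rate R k d l.+1 d_ge1.
(* The rate constants for l slow variables, used for w, and for l+1, used for dw, are fixed before n
   and the forms are introduced. *)
exists (B1 + B2) => n w dw wX wdw dwX err.
have derr := remainder_extd n d_ge1 wX wdw dwX.
have err_extd : exists D, is_weak_extd l err D by eexists; exact: derr.
split; first by split => //; exact: remainder_form_L2.
have chosen : is_weak_extd l err (weak_extd l err) by exact: (xgetPex _ err_extd).
have -> : norm_Hd l err = Num.sqrt (sqnormL2_form l err +
    sqnormL2_form l.+1 (fun J x => dw J x - sparse_interp k n dw J x)).
  congr (Num.sqrt (_ + _)); apply: eq_bigr => J /eqP Jl.
  exact: weak_extd_unique chosen derr Jl.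
apply: sqrt_sum_sqr_le; rewrite ?mulr_ge0 ?E_rate_ge0 ?norm_X_ge0// mulrA.
  exact: (remainder_form_bound d_ge1 wX B1_ge0 (hB1 n)).
exact: (remainder_form_bound d_ge1 dwX B2_ge0 (hB2 n)).
Qed.
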